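(* Suppose that the gap condition $\hat\lambda-\check\lambda>4L$ is satisfied. Then the random graph transform $\Phi$ has a unique generalized fixed point $\gamma^\ast(\omega,\cdot)$ in $\mathcal{H}$, i.e. there is a unique map $\Omega\ni\omega\mapsto\gamma^\ast(\omega,\cdot)\in\mathcal{H}$ such that $\Phi(T,\omega,\gamma^\ast(\omega,\cdot))=\gamma^\ast(\theta_T\omega,\cdot)$ for all $\omega\in\Omega$ and $T\ge 0$. The graph of this generalized fixed point, $$M(\omega)=\{x^++\gamma^\ast(\omega,x^+)\;:\;x^+\in H^+\},$$ is an invariant manifold (a Lipschitz continuous invariant manifold in the sense of the context) for the random dynamical system $\phi$ generated by the random evolution equation $$\frac{d\phi}{dt}=A\phi+G(\theta_t\omega,\phi)+z(\theta_t\omega)\phi,\qquad \phi(0)=x\in H .$$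
   Context: Noise. $C_0(\mathbb{R},\mathbb{R})$ is the space of continuous $\omega:\mathbb{R}\to\mathbb{R}$ with $\omega(0)=0$, with the compact-open topology, its Borel $\sigma$-algebra and the (two-sided) Wiener measure $\mathbb{P}$; $\theta_t\omega=\omega(\cdot+t)-\omega(t)$, $t\in\mathbb{R}$. $\Omega\subset C_0(\mathbb{R},\mathbb{R})$ is a fixed Borel set with $\mathbb{P}(\Omega)=1$, $\theta_t\Omega=\Omega$ for all $t$, such that for all $\omega\in\Omega$: $\omega(t)/t\to0$ as $t\to\pm\infty$, $z(\omega):=-\int_{-\infty}^0e^\tau\omega(\tau)d\tau$ exists, $t\mapsto z(\theta_t\omega)$ is continuous, $z(\theta_t\omega)/t\to0$ and $\frac1t\int_0^tz(\theta_\tau\omega)d\tau\to0$ as $t\to\pm\infty$. $\mathcal{F}$ is the trace of the Borel $\sigma$-algebra on $\Omega$. Operator and nonlinearity. $(H,\|\cdot\|_H)$ is a separable Banach space; $A$ generates a strongly continuous semigroup $\{S(t)\}_{t\ge0}$ on $H$; there are $\hat\lambda>\check\lambda$ and a continuous projection $\pi^+$ on $H$, $\pi^-=I-\pi^+$, $H^\pm=\pi^\pm H$, such that $\pi^+S(t)=S(t)\pi^+$, $S(t)|_{H^+}$ is an isomorphism of $H^+$ onto itself for $t\ge0$ (and $S(t)$ on $H^+$ for $t<0$ denotes the inverse of $S(-t)|_{H^+}$), and $\|\pi^+S(t)\pi^+\|\le e^{\hat\lambda t}$ for $t\le0$, $\|\pi^-S(t)\pi^-\|\le e^{\check\lambda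 t}$ for $t\ge0$. $F:H\to H$ satisfies $F(0)=0$ and $\|\pi^\pm(F(x_1)-F(x_2))\|_H\le L\|x_1-x_2\|_H$ with $L>0$. Put $G(\omega,u)=e^{-z(\omega)}F(e^{z(\omega)}u)$. Random dynamical system $\phi$. $\phi(t,\omega,x)$ is the unique continuous solution of $\phi(t)=e^{\int_0^tz(\theta_\tau\omega)d\tau}S(t)x+\int_0^te^{\int_\tau^tz(\theta_r\omega)dr}S(t-\tau)G(\theta_\tau\omega,\phi(\tau))d\tau$, $t\ge0$; it satisfies the cocycle property $\phi(t_1+t_2,\omega,x)=\phi(t_2,\theta_{t_1}\omega,\phi(t_1,\omega,x))$. Invariant manifold. A family $M=\{M(\omega)\}_{\omega\in\Omega}$ of nonempty closed subsets of $H$ is a random set if $\omega\mapsto\inf_{y\in M(\omega)}\|x-y\|_H$ is $\mathcal{F}$-measurable for all $x\in H$. A random set is invariant if $\phi(t,\omega,M(\omega))\subset M(\theta_t\omega)$ for all $t\ge0$, $\omega\in\Omega$. An invariant set of the form $M(\omega)=\{x^++\gamma^\ast(\omega,x^+):x^+\in H^+\}$ with $\gamma^\ast(\omega,\cdot):H^+\to H^-$ Lipschitz is called a Lipschitz continuous invariant manifold. Graph transform. For Lipschitz $\gamma:H^+\to H^-$ with $\gamma(0)=0$, $\omega\in\Omega$, $T\ge0$ and $y^+\in H^+$ consider on $[0,T]$ the system for continuous $(w,v):[0,T]\to H^+\times H^-$ $$w(t)=e^{\int_T^tz(\theta_\tau\omega)d\tau}\pi^+S(t-T)y^+-\int_t^Te^{\int_\tau^tz(\theta_{r}\omega)dr}\pi^+S(t-\tau)\pi^+G(\theta_\tau\omega,w(\tau)+v(\tau))d\tau,$$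 $$v(t)=e^{\int_0^tz(\theta_\tau\omega)d\tau}\pi^-S(t)\gamma(w(0))+\int_0^te^{\int_\tau^tz(\theta_{r}\omega)dr}\pi^-S(t-\tau)\pi^-G(\theta_\tau\omega,w(\tau)+v(\tau))d\tau.$$ If it has a unique solution for every $y^+$, then $\Phi(T,\omega,\gamma)(y^+):=v(T)$. Under the gap condition this is well defined for all $T\ge0$, $\omega\in\Omega$, $\gamma\in\mathcal{H}$. State space. Under the gap condition the matrix $B=\begin{pmatrix}\hat\lambda-L&-L\\ L&\check\lambda+L\end{pmatrix}$ has real distinct eigenvalues $\lambda_+>\lambda_-$ with eigenvectors $(e_+,1),(e_-,1)$, $e_\pm>0$; put $\kappa=e_+^{-1}$. $\mathcal{H}$ is the set of $\gamma:H^+\to H^-$ with $\gamma(0)=0$ and Lipschitz constant at most $\kappa$, with metric $d_{\mathcal{H}}(\gamma_1,\gamma_2)=\sup_{0\ne y^+\in H^+}\|\gamma_1(y^+)-\gamma_2(y^+)\|_H/\|y^+\|_H$. *)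

(* Defs.v *)
From Stdlib Require Import Reals.
From Coquelicot Require Import Coquelicot.
From HB Require Import structures.
From mathcomp Require Import all_boot all_order all_algebra.
From mathcomp Require Import all_classical all_reals all_analysis.
From mathcomp Require Import Rstruct Rstruct_topology.

Set Implicit Arguments.
Unset Strict Implicit.
Unset Printing Implicit Defensive.

(* The reals are the R of the standard library throughout, seen as a realType
   through Rstruct: measure theory is MathComp-Analysis's, while integration of
   functions with values in a Banach space is Coquelicot's RInt.  All the
   H-valued integrands below are continuous, so that the Riemann and Bochner
   integrals agree. *)

Local Open Scope classical_set_scope.
Local Open Scope R_scope.

Definition C0_set : set {compact-open, R -> R} :=
  [set w | continuous (w : R -> R) /\ (w : R -> R) 0 = 0].

Definition C0 : Type := set_type C0_set.

Definition path_of (w : C0) : R -> R := set_val w.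
Coercion path_of : C0 >-> Funclass.

Lemma cst0_C0 : (fun _ : R => 0) \in C0_set.
Proof. by rewrite inE; split => // x; apply: cvg_cst. Qed.

HB.instance Definition _ := Topological.copy C0 (set_type C0_set).
HB.instance Definition _ := isPointed.Build C0 (SigSub cst0_C0).
HB.instance Definition _ :=
  Measurable.copy C0 (g_sigma_algebraType (@open C0)).

Lemma shift_C0 (t : R) (w : C0) : (fun s => w (s + t) - w t) \in C0_set.
Proof.
have [cw _] : C0_set (set_val w) by have := set_valP w.
rewrite inE; split; last by rewrite Rplus_0_l Rminus_diag.
move=> s; apply/continuity_pt_cvg; apply: continuity_pt_minus.
  apply: (continuity_pt_comp (fun s => s + t)).
    by apply: continuity_pt_plus;
      [exact: derivable_continuous_pt (derivable_pt_id _)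
      |exact: continuity_pt_const].
  exact/continuity_pt_cvg/cw.
exact: continuity_pt_const.
Qed.

Definition theta (t : R) (w : C0) : C0 := SigSub (shift_C0 t w).

(* Increments over successive intervals are independent and centred Gaussian,
   with variance the length of the interval (normal_prob takes a standard
   deviation).  The times range over all of R and w(0) = 0 on C0, so this is
   the two-sided Wiener measure. *)
Definition wiener_measure (P : probability C0 R) : Prop :=
  forall (n : nat) (t : nat -> R) (B : nat -> set (measurableTypeR R)),
    (forall i : nat, (i < n)%N -> t i < t i.+1) ->
    (forall i : nat, measurable (B i)) ->
    P [set w : C0 | forall i : nat, (i < n)%N -> B i (w (t i.+1) - w (t i))] =
    \big[mule/1%E]_(i < n) normal_prob 0 (sqrt (t i.+1 - t i)) (B i).

(* From here on plus, minus, norm, within, at_right, ... are Coquelicot's. *)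
Import Coquelicot.Hierarchy.

Definition z (w : C0) : R :=
  - RInt_gen (V := R_CompleteNormedModule) (fun s => exp s * w s)
      (Rbar_locally m_infty) (at_point 0).

Definition zint (w : C0) (a b : R) : R :=
  RInt (V := R_CompleteNormedModule) (fun r => z (theta r w)) a b.

Record noise_space (P : probability C0 R) (Om : set C0) : Prop := NoiseSpace {
  noise_borel : measurable Om ;
  noise_full : P Om = 1%E ;
  noise_theta : forall t : R, theta t @` Om = Om ;
  noise_sublin : forall w, Om w ->
    is_lim (fun t => w t / t) p_infty 0 /\ is_lim (fun t => w t / t) m_infty 0 ;
  noise_z : forall w, Om w ->
    ex_RInt_gen (V := R_CompleteNormedModule) (fun s => exp s * w s)
      (Rbar_locally m_infty) (at_point 0) ;
  noise_zcont : forall w, Om w ->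
    forall t : R, Continuity.continuous (fun s : R => z (theta s w)) t ;
  noise_zsublin : forall w, Om w ->
    is_lim (fun t => z (theta t w) / t) p_infty 0 /\
    is_lim (fun t => z (theta t w) / t) m_infty 0 ;
  noise_zmean : forall w, Om w ->
    is_lim (fun t => / t * zint w 0 t) p_infty 0 /\
    is_lim (fun t => / t * zint w 0 t) m_infty 0
}.

Section BanachSpace.
Context {H : CompleteNormedModule R_AbsRing}.
Implicit Types (S : R -> H -> H) (pi F g : H -> H) (w : C0) (x y : H).

Definition separable : Prop :=
  exists u : nat -> H, forall x (e : R), 0 < e ->
    exists n : nat, norm (minus x (u n)) < e.

(* A semigroup is given as S : R -> H -> H, but only the S t with 0 <= t are
   operators on H; at negative times S is used on H^+ only (see dichotomy). *)
Record strongly_continuous_semigroup S : Prop := SemigroupAxioms {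
  semigroup_linear : forall t, 0 <= t -> is_linear (S t) ;
  semigroup_0 : forall x, S 0 x = x ;
  semigroup_add : forall t s x, 0 <= t -> 0 <= s -> S (t + s) x = S t (S s x) ;
  semigroup_cont : forall x, filterlim (fun t => S t x) (at_right 0) (locally x)
}.

Definition generator (DA : set H) (A : H -> H) S : Prop :=
  forall x y, (DA x /\ A x = y) <->
    filterlim (fun t => scal (/ t) (minus (S t x) x)) (at_right 0) (locally y).

Definition compl_proj pi : H -> H := fun x => minus x (pi x).

Definition Hplus pi : set H := range pi.
Definition Hminus pi : set H := range (compl_proj pi).

(* dich_inv says that S t is a bijection of H^+ with inverse S (- t); the
   inverse is then linear, and bounded by dich_plus. *)
Record dichotomy S pi (hl cl : R) : Prop := Dichotomy {
  dich_lt : cl < hl ;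
  dich_pi_linear : is_linear pi ;
  dich_pi_proj : forall x, pi (pi x) = pi x ;
  dich_comm : forall t x, 0 <= t -> pi (S t x) = S t (pi x) ;
  dich_inv : forall t x, 0 <= t -> Hplus pi x ->
    [/\ Hplus pi (S (- t) x), S t (S (- t) x) = x & S (- t) (S t x) = x] ;
  dich_plus : forall t x, t <= 0 ->
    norm (pi (S t (pi x))) <= exp (hl * t) * norm x ;
  dich_minus : forall t x, 0 <= t ->
    norm (compl_proj pi (S t (compl_proj pi x))) <= exp (cl * t) * norm x
}.

Record nonlinearity pi F (L : R) : Prop := Nonlinearity {
  nonlin_L : 0 < L ;
  nonlin_0 : F zero = zero ;
  nonlin_plus : forall x y,
    norm (pi (minus (F x) (F y))) <= L * norm (minus x y) ;
  nonlin_minus : forall x y,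
    norm (compl_proj pi (minus (F x) (F y))) <= L * norm (minus x y)
}.

Definition G F w x : H := scal (exp (- z w)) (F (scal (exp (z w)) x)).

Definition mild_solution S F w x (u : R -> H) : Prop :=
  continuous_on [set t | 0 <= t] u /\
  forall t, 0 <= t ->
    u t = plus (scal (exp (zint w 0 t)) (S t x))
               (RInt (fun r => scal (exp (zint w r t))
                                    (S (t - r) (G F (theta r w) (u r)))) 0 t).

Definition generated_rds (Om : set C0) S F (phi : R -> C0 -> H -> H) : Prop :=
  forall w x, Om w -> mild_solution S F w x (fun t => phi t w x).

(* A map H^+ -> H^- is represented by a function H -> H of which only the
   values on H^+ matter. *)
Definition maps_to pi g : Prop := forall x, Hplus pi x -> Hminus pi (g x).

Definition lipschitz_on_Hplus pi (k : R) g : Prop :=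
  forall x y, Hplus pi x -> Hplus pi y ->
    norm (minus (g x) (g y)) <= k * norm (minus x y).

Definition calH pi (kappa : R) : set (H -> H) :=
  [set g | [/\ maps_to pi g, g zero = zero & lipschitz_on_Hplus pi kappa g]].

Definition graph_system S pi F (T : R) w g y (u v : R -> H) : Prop :=
  let I := [set t | 0 <= t <= T] in
  [/\ continuous_on I u /\ continuous_on I v,
      (forall t, I t -> Hplus pi (u t) /\ Hminus pi (v t)),
      (forall t, I t ->
        u t = minus
          (scal (exp (zint w T t)) (pi (S (t - T) y)))
          (RInt (fun r => scal (exp (zint w r t))
             (pi (S (t - r) (pi (G F (theta r w) (plus (u r) (v r)))))))
             t T)) &
      (forall t, I t ->
        v t = plus
          (scal (exp (zint w 0 t)) (compl_proj pi (S t (g (u 0)))))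
          (RInt (fun r => scal (exp (zint w r t))
             (compl_proj pi (S (t - r)
               (compl_proj pi (G F (theta r w) (plus (u r) (v r)))))))
             0 t))].

(* Phi(T, w, g) is defined and equal to g' on H^+. *)
Definition graph_transform S pi F (T : R) w g g' : Prop :=
  forall y, Hplus pi y ->
    exists u v : R -> H,
      [/\ graph_system S pi F T w g y u v,
          (forall u' v' : R -> H, graph_system S pi F T w g y u' v' ->
             forall t, 0 <= t <= T -> u' t = u t /\ v' t = v t) &
          g' y = v T].

Definition generalized_fixed_point (Om : set C0) S pi F
    (gs : C0 -> H -> H) : Prop :=
  forall w T, Om w -> 0 <= T ->
    graph_transform S pi F T w (gs w) (gs (theta T w)).

(* As Om is a Borel set, its trace sigma-algebra consists of the Borel sets
   included in Om, and measurability for it is measurable_fun Om. *)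
Definition random_set (Om : set C0) (M : C0 -> set H) : Prop :=
  (forall w, Om w -> M w !=set0 /\ Hierarchy.closed (M w)) /\
  (forall x, measurable_fun Om
     (fun w => inf [set norm (minus x y) | y in M w] : measurableTypeR R)).

Definition invariant_set (Om : set C0) (phi : R -> C0 -> H -> H)
    (M : C0 -> set H) : Prop :=
  forall t w, 0 <= t -> Om w -> phi t w @` M w `<=` M (theta t w).

Definition graph_of pi g : set H := [set plus x (g x) | x in Hplus pi].

Definition lipschitz_invariant_manifold (Om : set C0) pi
    (phi : R -> C0 -> H -> H) (M : C0 -> set H) : Prop :=
  [/\ random_set Om M, invariant_set Om phi M &
      exists gs : C0 -> H -> H, forall w, Om w ->
        [/\ maps_to pi (gs w), (exists k : R, lipschitz_on_Hplus pi k (gs w)) &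
            M w = graph_of pi (gs w)]].

End BanachSpace.

Arguments separable : clear implicits.

Section StateSpaceConstant.
Local Open Scope ring_scope.
Implicit Types hl cl L e : R.

Definition gap_matrix hl cl L : 'M[R]_(1 + 1) :=
  block_mx (hl - L)%:M (- L)%:M L%:M (cl + L)%:M.

Definition col_e1 e : 'cV[R]_(1 + 1) := col_mx e%:M 1%:M.

Definition state_space_constant hl cl L (kappa : R) : Prop :=
  exists lp lm ep em : R,
    [/\ lm < lp, 0 < ep /\ 0 < em,
        gap_matrix hl cl L *m col_e1 ep = lp *: col_e1 ep,
        gap_matrix hl cl L *m col_e1 em = lm *: col_e1 em &
        kappa = ep^-1].

End StateSpaceConstant.

(* Main.v *)
Require Import Defs.
From Stdlib Require Import Reals Lra Lia.
From Coquelicot Require Import Coquelicot.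
From mathcomp Require Import all_boot all_order all_algebra.
From mathcomp Require Import all_classical all_reals all_analysis.
From mathcomp Require Import Rstruct Rstruct_topology.

(** Along a noise path [w] the random equation is a non-autonomous equation with
    the linear weight [exp (C t - C r)], where [C t] is the integral of
    [z (theta r w)] over [0, t].  A mild solution on a window [a, b] splits into
    an unstable part, steered from its value at [b] by a group, and a stable
    part, steered from its value at [a] by a semigroup ([trajectory]).  The graph
    transform of [g] from [a] to [b] at [y] is the stable part at [b] of the
    trajectory that ends over [y] and starts on the graph of [g] ([steered]).

    Two estimates carry the proof.  In the norm weighted by
    [exp (C t + (hl + cl) / 2 * t)] the two integral operators together contract
    by [4 L / (hl - cl)] ([window_contraction]), which is less than 1 by the gap
    condition.  This gives existence and uniqueness of steered trajectories by
    Picard iteration ([steered_exists], [steered_unique]) and bounds the distance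
    of two trajectories with the same endpoint by the distance of their initial
    stable parts ([trajectory_stability]).  On the other hand,
    [exp (lam t) (1, kappa)], built from the upper eigenpair of the gap matrix,
    solves the linear comparison system, so the cone of slope [kappa] is
    preserved by every Picard iterate, and inside the cone trajectories decay
    backward in time like [exp (lam t)] ([window_cone], [steered_cone_diff]).

    As [lam] exceeds [(hl + cl) / 2], the second estimate beats the first: two
    cone trajectories with the same endpoint at time [b] that started at time [a]
    differ at [b] by at most a multiple of [exp ((lam - (hl + cl) / 2) (a - b))]
    ([cone_stability]).  Hence the images at time [b] of [kappa]-Lipschitz graphs
    placed at time [a] converge as [a] tends to minus infinity, to a limit that does not
    depend on these graphs ([limit_graph], [limit_graph_exists],
    [limit_graph_unique]).  The limit is [kappa]-Lipschitz
    ([limit_graph_lipschitz]), it is mapped to itself by the graph transform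
    ([limit_graph_invariant]), and translation of the path translates it
    ([limit_graph_translate]), so that the limit graph of [w] at time 0 is a
    generalized fixed point.  Every generalized fixed point is an image of
    itself from arbitrarily far in the past, hence equal to it ([gs_unique]).

    Restricted to [0, T], a forward solution starting on the graph is a steered
    trajectory ([mild_solution_steered]), which gives the invariance of the
    graph.  The Picard iterates are measurable in the noise, being made of
    integrals and continuous maps ([picard_measurable]); so are their limits,
    and the distance to the graph is an infimum over a dense sequence of
    abscissae ([dist_graph_measurable]). *)

Import Coquelicot.Hierarchy.

Set Implicit Arguments.
Unset Strict Implicit.
Unset Printing Implicit Defensive.

Local Open Scope classical_set_scope.
Local Open Scope R_scope.

(** * Linear identities in a real module *)

Section LinearIdentities.
Context {V : ModuleSpace R_Ring}.

(** Reified linear combinations of the entries of an environment. *)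
Inductive lexpr := LVar of nat | LZero | LPlus of lexpr & lexpr | LOpp of lexpr
  | LScal of R & lexpr.

Fixpoint leval (env : seq V) e : V :=
  match e with
  | LVar n => nth zero env n
  | LZero => zero
  | LPlus e1 e2 => plus (leval env e1) (leval env e2)
  | LOpp e1 => opp (leval env e1)
  | LScal k e1 => scal k (leval env e1)
  end.

Fixpoint lcoef e (n : nat) : R :=
  match e with
  | LVar m => if m == n then 1 else 0
  | LZero => 0
  | LPlus e1 e2 => lcoef e1 n + lcoef e2 n
  | LOpp e1 => - lcoef e1 n
  | LScal k e1 => k * lcoef e1 n
  end.

Fixpoint lcomb (env : seq V) (c : nat -> R) : V :=
  if env is x :: l then plus (scal (c 0%N) x) (lcomb l (fun n => c n.+1)) else zero.

Lemma plus_ACAC (a b c d : V) : plus (plus a b) (plus c d) = plus (plus a c) (plus b d).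
Proof.
by rewrite -!plus_assoc; congr (plus a _); rewrite !plus_assoc (plus_comm b).
Qed.

Lemma lcomb_plus env c d : lcomb env (fun n => c n + d n) = plus (lcomb env c) (lcomb env d).
Proof.
elim: env c d => [|x l IH] c d /=; first by rewrite plus_zero_l.
by rewrite IH plus_ACAC (@scal_distr_r R_Ring).
Qed.

Lemma lcomb_scal env k c : lcomb env (fun n => k * c n) = scal k (lcomb env c).
Proof.
elim: env c => [|x l IH] c /=; first by rewrite scal_zero_r.
by rewrite IH scal_distr_l scal_assoc.
Qed.

Lemma lcomb_ext env c d : c =1 d -> lcomb env c = lcomb env d.
Proof.
by elim: env c d => //= x l IH c d cd; rewrite cd (IH _ (fun n => d n.+1)) // => n; apply: cd.
Qed.

Lemma lcomb_zero env : lcomb env (fun _ => 0) = zero.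
Proof. by elim: env => //= x l ->; rewrite (@scal_zero_l R_Ring) plus_zero_l. Qed.

Lemma lcomb_var env m : lcomb env (fun n => if m == n then 1 else 0) = nth zero env m.
Proof.
elim: env m => [|x l IH] [|m] //=.
  by rewrite lcomb_zero plus_zero_r (@scal_one R_Ring).
by rewrite IH (@scal_zero_l R_Ring) plus_zero_l.
Qed.

Lemma leval_lcomb env e : leval env e = lcomb env (lcoef e).
Proof.
elim: e => /= [m||e1 -> e2 ->|e ->|k e ->].
- by rewrite lcomb_var.
- by rewrite lcomb_zero.
- by rewrite lcomb_plus.
- rewrite -(@scal_opp_one R_Ring) -lcomb_scal.
  by apply: lcomb_ext => n /=; rewrite /opp /one /=; ring.
- by rewrite lcomb_scal.
Qed.

Lemma leval_eq env e1 e2 :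
  lcomb env (lcoef e1) = lcomb env (lcoef e2) -> leval env e1 = leval env e2.
Proof. by rewrite !leval_lcomb. Qed.

End LinearIdentities.

Ltac lmem x l :=
  lazymatch l with
  | nil => constr:(false)
  | x :: _ => constr:(true)
  | _ :: ?l' => lmem x l'
  end.

Ltac lindex x l :=
  lazymatch l with
  | x :: _ => constr:(0%nat)
  | _ :: ?l' => let n := lindex x l' in constr:(S n)
  end.

Ltac latoms l e :=
  lazymatch e with
  | plus ?a ?b => let l1 := latoms l a in latoms l1 b
  | minus ?a ?b => let l1 := latoms l a in latoms l1 b
  | opp ?a => latoms l a
  | scal _ ?a => latoms l a
  | zero => l
  | _ => lazymatch lmem e l with true => l | false => constr:(e :: l) end
  end.

Ltac lreify l e :=
  lazymatch e with
  | plus ?a ?b => let x := lreify l a in let y := lreify l b in constr:(LPlus x y)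
  | minus ?a ?b =>
      let x := lreify l a in let y := lreify l b in constr:(LPlus x (LOpp y))
  | opp ?a => let x := lreify l a in constr:(LOpp x)
  | scal ?k ?a => let x := lreify l a in constr:(LScal k x)
  | zero => constr:(LZero)
  | _ => let n := lindex e l in constr:(LVar n)
  end.

Ltac lin_eq tac :=
  lazymatch goal with
  | |- @eq ?T ?a ?b =>
      let l0 := latoms (@nil T) a in
      let l := latoms l0 b in
      let x := lreify l a in
      let y := lreify l b in
      apply: (@leval_eq _ l x y); rewrite /=;
      repeat (congr plus); try reflexivity; (congr scal; tac)
  end.

(** Both sides are reified over their common atoms; it remains to compare the
    coefficients, in the ring of scalars. *)
Ltac lin_ring := lin_eq ltac:(rewrite /=; ring).

Section NormedSpace.
Context {H : CompleteNormedModule R_AbsRing}.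
Implicit Types (x y : H) (f : R -> H).

Lemma norm_minusC x y : norm (minus x y) = norm (minus y x).
Proof. by rewrite -(norm_opp (minus x y)) opp_minus. Qed.

Lemma norm_minus_triangle z x y : norm (minus x y) <= norm (minus x z) + norm (minus z y).
Proof. by rewrite (minus_trans z x y); apply: norm_triangle. Qed.

Lemma norm_plus_le x y a b : norm x <= a -> norm y <= b -> norm (plus x y) <= a + b.
Proof. by move=> xa yb; apply: Rle_trans (norm_triangle x y) (Rplus_le_compat _ _ _ _ xa yb). Qed.

Lemma norm_minus_le x y a b : norm x <= a -> norm y <= b -> norm (minus x y) <= a + b.
Proof. by move=> xa yb; apply: norm_plus_le => //; rewrite norm_opp. Qed.

Lemma norm_scal_exp c x : norm (scal (exp c) x) <= exp c * norm x.
Proof.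
have := norm_scal (V := H) (exp c) x; rewrite /abs /= Rabs_pos_eq //.
exact/Rlt_le/exp_pos.
Qed.

Lemma norm_minus_eq0 x y : (forall e, 0 < e -> norm (minus x y) <= e) -> x = y.
Proof.
move=> h; have h0 : norm (minus x y) = 0.
  apply: Rle_antisym (norm_ge_0 _); apply: le_epsilon => e e0.
  by rewrite Rplus_0_l; apply: h.
have := norm_eq_zero _ h0 => e0.
have -> : x = plus (minus x y) y by lin_ring.
by rewrite e0 plus_zero_l.
Qed.
End NormedSpace.
(** * Continuity and integrals of functions with values in a Banach space *)

Section Calculus.
Context {H : CompleteNormedModule R_AbsRing}.
Implicit Types (f g : R -> H) (x y : H).

Lemma continuous_normP f t :
  Continuity.continuous f t <->
  forall e, 0 < e -> exists d, 0 < d /\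
    forall s, Rabs (s - t) < d -> norm (minus (f s) (f t)) < e.
Proof.
split=> [/filterlim_locally_ball_norm h e e0|h].
  have [d hd] := h (mkposreal _ e0).
  by exists d; split=> [|s sd]; [exact: cond_pos|exact: hd].
apply/filterlim_locally_ball_norm => e.
have [d [d0 hd]] := h e (cond_pos e).
by exists (mkposreal _ d0) => s sd; apply: hd.
Qed.

Lemma continuous2_normP (f : R -> R -> H) t r :
  Continuity.continuous (fun p : R * R => f p.1 p.2) (t, r) <->
  forall e, 0 < e -> exists d, 0 < d /\
    forall t' r', Rabs (t' - t) < d -> Rabs (r' - r) < d ->
      norm (minus (f t' r') (f t r)) < e.
Proof.
split=> [/filterlim_locally_ball_norm h e e0|h].
  have [d hd] := h (mkposreal _ e0).
  by exists d; split=> [|t' r' td rd]; [exact: cond_pos|exact: (hd (t', r'))].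
apply/filterlim_locally_ball_norm => e.
have [d [d0 hd]] := h e (cond_pos e).
by exists (mkposreal _ d0) => -[t' r'] [td rd]; apply: hd.
Qed.

Lemma ex_RInt_cont f a b : (forall t, Continuity.continuous f t) -> ex_RInt f a b.
Proof. by move=> cf; apply: ex_RInt_continuous => t _; apply: cf. Qed.

Lemma RInt_eq f g a b : a <= b -> (forall t, a <= t <= b -> f t = g t) ->
  RInt f a b = RInt g a b.
Proof.
move=> ab fg; apply: RInt_ext => t; rewrite Rmin_left // Rmax_right // => h.
by apply: fg; lra.
Qed.

Lemma norm_RInt_le_unordered f a b M :
  (forall t, Continuity.continuous f t) ->
  (forall t, Rmin a b <= t <= Rmax a b -> norm (f t) <= M) ->
  norm (RInt f a b) <= Rabs (b - a) * M.
Proof.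
move=> cf fM.
have key c d : c <= d -> (forall t, c <= t <= d -> norm (f t) <= M) ->
    norm (RInt f c d) <= (d - c) * M.
  move=> cd h; apply: (norm_RInt_le_const f c d) => //.
  exact/RInt_correct/ex_RInt_cont.
case: (Rle_lt_dec a b) => ab.
  rewrite Rabs_pos_eq; last lra.
  by apply: key => // t h; apply: fM; rewrite Rmin_left // Rmax_right.
rewrite -(opp_RInt_swap f b a); last exact: ex_RInt_cont.
rewrite norm_opp Rabs_left1; last lra.
have -> : - (b - a) = a - b by ring.
apply: key => [|t h]; first lra.
by apply: fM; rewrite Rmin_right ?Rmax_left; lra.
Qed.

(** Both endpoints are kept in the bound: later the endpoint terms cancel
    against the free parts of the mild equations. *)
Lemma norm_RInt_le_exp f a b k m :
  a <= b -> m <> 0 -> (forall t, Continuity.continuous f t) ->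
  (forall t, a <= t <= b -> norm (f t) <= k * exp (m * t)) ->
  norm (RInt f a b) <= k * (exp (m * b) - exp (m * a)) / m.
Proof.
move=> ab m0 cf fle.
apply: (norm_RInt_le f (fun t => k * exp (m * t)) a b) => //.
  exact/RInt_correct/ex_RInt_cont.
have -> : k * (exp (m * b) - exp (m * a)) / m =
    minus (k / m * exp (m * b)) (k / m * exp (m * a)).
  by rewrite /minus /plus /opp /=; field.
apply: (is_RInt_derive (fun t => k / m * exp (m * t))) => t _.
  by auto_derive => //; field.
by apply: ex_derive_continuous; auto_derive.
Qed.

Lemma is_linear_RInt (T : H -> H) f a b :
  is_linear T -> (forall t, Continuity.continuous f t) ->
  RInt (fun t => T (f t)) a b = T (RInt f a b).
Proof.
move=> lT cf; apply: is_RInt_unique.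
have hf : is_RInt f a b (RInt f a b) by apply/RInt_correct/ex_RInt_cont.
have hT := filterlim_comp _ _ _ _ _ _ _ _ hf (linear_cont T (RInt f a b) lT).
apply: filterlim_ext hT => ptd; rewrite (linear_scal _ lT); congr scal.
move: ptd; apply: (@SF_cons_ind R) => [u|[u v] s IH]; rewrite ?Riemann_sum_cons.
  by rewrite /Riemann_sum /= (linear_zero _ lT).
by rewrite (linear_plus _ lT) (linear_scal _ lT) IH.
Qed.

(** A finite subcover of the compact interval makes the continuity in [t]
    uniform in [r]. *)
Lemma tube (f : R -> R -> H) a b t0 e :
  (forall t r, Continuity.continuous (fun p : R * R => f p.1 p.2) (t, r)) ->
  0 < e -> exists d, 0 < d /\ forall t r, Rabs (t - t0) < d -> a <= r <= b ->
    norm (minus (f t r) (f t0 r)) < e.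
Proof.
move=> cf e0.
have e20 : 0 < e / 2 by lra.
have loc r : exists d : posreal, forall t' r',
    Rabs (t' - t0) < d -> Rabs (r' - r) < d -> norm (minus (f t' r') (f t0 r)) < e / 2.
  have [d [d0 hd]] := (continuous2_normP f t0 r).1 (cf t0 r) _ e20.
  by exists (mkposreal _ d0).
have [dl dlP] := choice loc.
have [d hd] := compactness_value_1d a b dl.
exists d; split=> [|t r td rab]; first exact: cond_pos.
have [s [_ [rs ds]]] := contrapT (hd r rab).
have h1 := dlP s t r (Rlt_le_trans _ _ _ td ds) rs.
have h2 : norm (minus (f t0 r) (f t0 s)) < e / 2.
  by apply: dlP => //; rewrite Rminus_diag Rabs_R0; apply: cond_pos.
have h3 := norm_minus_triangle (f t0 s) (f t r) (f t0 r).
rewrite (norm_minusC (f t0 s)) in h3; lra.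
Qed.

(** In the mild equations [t] is an endpoint and also occurs in the integrand. *)
Lemma continuous_RInt_param (f : R -> R -> H) a t0 :
  (forall t r, Continuity.continuous (fun p : R * R => f p.1 p.2) (t, r)) ->
  Continuity.continuous (fun t => RInt (f t) a t) t0.
Proof.
move=> cf.
have cf1 t r : Continuity.continuous (f t) r.
  apply: (continuous_comp_2 (fun _ => t) (fun s => s) f).
  - exact: continuous_const.
  - exact: continuous_id.
  - exact: cf.
apply/continuous_normP => e e0.
pose lo := Rmin a t0 - 1; pose hi := Rmax a t0 + 1.
have [mina maxa] := (Rmin_l a t0, Rmax_l a t0).
have [mint maxt] := (Rmin_r a t0, Rmax_r a t0).
have w0 : 0 < hi - lo by rewrite /hi /lo; lra.
have [M hM] : {M | forall r, lo <= r <= hi -> norm (f t0 r) < M}.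
  by apply: bounded_continuity => r _; apply: cf1.
have M0 : 0 < M.
  by apply: Rle_lt_trans (norm_ge_0 (f t0 t0)) (hM _ _); rewrite /lo /hi; lra.
have e1 : 0 < e / (2 * (hi - lo)) by apply: Rdiv_lt_0_compat; lra.
have [d [d0 hd]] := tube lo hi t0 cf e1.
pose d1 := Rmin (Rmin d 1) (e / (4 * M)).
have eM : 0 < e / (4 * M) by apply: Rdiv_lt_0_compat; lra.
exists d1; split=> [|t td1].
  by rewrite /d1; do 2 (apply: Rmin_glb_lt => //); lra.
have td : Rabs (t - t0) < d.
  by apply: Rlt_le_trans td1 _; apply: Rle_trans (Rmin_l _ _) (Rmin_l _ _).
have t1 : Rabs (t - t0) < 1.
  by apply: Rlt_le_trans td1 _; apply: Rle_trans (Rmin_l _ _) (Rmin_r _ _).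
have tM : Rabs (t - t0) < e / (4 * M).
  by apply: Rlt_le_trans td1 _; apply: Rmin_r.
have [t1a t1b] := Rabs_def2 _ _ t1.
have -> : minus (RInt (f t) a t) (RInt (f t0) a t0) =
    plus (RInt (fun r => minus (f t r) (f t0 r)) a t) (RInt (f t0) t0 t).
  rewrite RInt_minus; try exact: ex_RInt_cont.
  rewrite -(RInt_Chasles (f t0) a t0 t); try exact: ex_RInt_cont.
  by lin_ring.
have c1 r : Continuity.continuous (fun r => minus (f t r) (f t0 r)) r.
  by apply: continuous_minus; apply: cf1.
have b1 : norm (RInt (fun r => minus (f t r) (f t0 r)) a t) <= e / 2.
  apply: Rle_trans (norm_RInt_le_unordered (M := e / (2 * (hi - lo))) c1 _) _ => [r rat|].
    apply/Rlt_le/hd => //; move: rat; rewrite /lo /hi /Rmin /Rmax.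
    by move: mina maxa mint maxt; rewrite /Rmin /Rmax; do ! case: Rle_dec; lra.
  have : Rabs (t - a) <= hi - lo.
    by rewrite /lo /hi; apply: Rabs_le; lra.
  move=> h; apply: Rle_trans (Rmult_le_compat_r _ _ _ _ h) _; first lra.
  by right; field; lra.
have b2 : norm (RInt (f t0) t0 t) <= e / 4.
  apply: Rle_trans (norm_RInt_le_unordered (M := M) (cf1 t0) _) _ => [r rat|].
    apply/Rlt_le/hM; move: rat; rewrite /lo /hi /Rmin /Rmax.
    by move: mina maxa mint maxt; rewrite /Rmin /Rmax; do ! case: Rle_dec; lra.
  have -> : e / 4 = e / (4 * M) * M by field; lra.
  by apply: Rmult_le_compat_r; lra.
by have := norm_plus_le b1 b2; lra.
Qed.

(** The explicit rate later makes the convergence of Picard iterates uniform in time. *)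
Lemma geometric_limit (u : nat -> H) K th :
  0 <= th < 1 -> (forall n, norm (minus (u n.+1) (u n)) <= K * th ^ n) ->
  exists l, filterlim u eventually (locally l) /\
    forall n, norm (minus (u n) l) <= K * th ^ n / (1 - th).
Proof.
move=> [th0 th1] hu.
have step n p : norm (minus (u (p + n)%N) (u n)) <= K * th ^ n * (1 - th ^ p) / (1 - th).
  elim: p => [|p IH]; first by rewrite add0n minus_eq_zero norm_zero /=; right; field; lra.
  apply: Rle_trans (norm_minus_triangle (u (p + n)%N) _ _) _.
  apply: Rle_trans (Rplus_le_compat _ _ _ _ (hu (p + n)%N) IH) _.
  by right; rewrite addnC -[th ^ (n + p)]/(pow th (Nat.add n p)) pow_add /=; field; lra.
have K0 : 0 <= K by have := hu 0%N; have := norm_ge_0 (minus (u 1%N) (u 0%N)) => /=; lra.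
have thn n : 0 <= th ^ n by apply: pow_le.
have bound n p : (n <= p)%N -> norm (minus (u p) (u n)) <= K * th ^ n / (1 - th).
  move=> /subnK <-; apply: Rle_trans (step _ _) _.
  apply: Rmult_le_compat_r; first by apply/Rlt_le/Rinv_0_lt_compat; lra.
  rewrite -[X in _ <= X]Rmult_1_r; apply: Rmult_le_compat_l; first exact: Rmult_le_pos.
  by have := thn (p - n)%N; lra.
have small e : 0 < e -> exists n, K * th ^ n / (1 - th) < e.
  move=> e0; have e1 : 0 < e * (1 - th) / (K + 1).
    by apply: Rdiv_lt_0_compat; [apply: Rmult_lt_0_compat|]; lra.
  have [n hn] := pow_lt_1_zero th ltac:(by rewrite Rabs_pos_eq) _ e1.
  exists n; have := hn n (le_n _); rewrite Rabs_pos_eq // => h.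
  apply: (Rmult_lt_reg_r (1 - th)); first lra.
  have -> : K * th ^ n / (1 - th) * (1 - th) = K * th ^ n by field; lra.
  have h2 : (K + 1) * th ^ n < e * (1 - th).
    have -> : e * (1 - th) = (K + 1) * (e * (1 - th) / (K + 1)) by field; lra.
    by apply: Rmult_lt_compat_l; lra.
  by have := thn n; lra.
have [l hl] : exists l, filterlim u eventually (locally l).
  apply: (filterlim_locally_cauchy (F := eventually) u).1 => e.
  have [n hn] := small _ (is_pos_div_2 e).
  exists (fun p => (n <= p)%N); split=> [|p p' np np'].
    by exists n => p /leP.
  apply: norm_compat1; apply: Rle_lt_trans (norm_minus_triangle (u n) _ _) _.
  rewrite (norm_minusC (u n)).
  have := bound _ _ np; have := bound _ _ np'; move: hn => /=; lra.
exists l; split=> // n.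
apply: le_epsilon => e e0.
have [m hm] := (filterlim_locally_ball_norm u l).1 hl (mkposreal _ e0).
have h1 := hm (m + n)%coq_nat (Nat.le_add_r _ _).
have h2 : norm (minus (u (m + n)%coq_nat) (u n)) <= K * th ^ n / (1 - th).
  by apply: bound; apply/leP; rewrite Nat.add_comm; apply: Nat.le_add_r.
have h3 := norm_minus_triangle (u (m + n)%coq_nat) (u n) l.
rewrite (norm_minusC (u n) (u _)) in h3.
have h4 : norm (minus (u (m + n)%coq_nat) l) < e := h1; lra.
Qed.

End Calculus.
(** * Trajectories on a compact time window *)

Section Window.
Context {H : CompleteNormedModule R_AbsRing}.
Implicit Types (X Y : R -> H) (x y h : H) (g : H -> H).

(** [Up] is the evolution on the range of [pi], a group, hence defined at all
    times; [Um] is the one on the complementary range, where only the times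
    [0 <= s] are meaningful. *)
Record splitting (pi : H -> H) (Up Um : R -> H -> H) (hl cl : R) : Prop := Splitting {
  split_pi : is_linear pi ;
  split_pi_idem : forall x, pi (pi x) = pi x ;
  split_up_linear : forall s, is_linear (Up s) ;
  split_up_add : forall s t x, Up (s + t) x = Up s (Up t x) ;
  split_up0 : forall x, Up 0 x = pi x ;
  split_up_cont : forall s x, Continuity.continuous (fun p : R * H => Up p.1 p.2) (s, x) ;
  split_up_le : forall s x, s <= 0 -> norm (Up s x) <= exp (hl * s) * norm x ;
  split_um_linear : forall s, is_linear (Um s) ;
  split_um_add : forall s t x, 0 <= s -> 0 <= t -> Um (s + t) x = Um s (Um t x) ;
  split_um0 : forall x, Um 0 x = compl_proj pi x ;
  split_um_cont : forall s x, Continuity.continuous (fun p : R * H => Um p.1 p.2) (s, x) ;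
  split_um_le : forall s x, 0 <= s -> norm (Um s x) <= exp (cl * s) * norm x
}.

(** Continuity is required only along paths; this is what the integrals need. *)
Record forcing (pi : H -> H) (N : R -> H -> H) (L : R) : Prop := Forcing {
  forcing_cont : forall X, (forall t, Continuity.continuous X t) ->
    forall t, Continuity.continuous (fun r => N r (X r)) t ;
  forcing_0 : forall r, N r zero = zero ;
  forcing_plus : forall r x y,
    norm (pi (minus (N r x) (N r y))) <= L * norm (minus x y) ;
  forcing_minus : forall r x y,
    norm (compl_proj pi (minus (N r x) (N r y))) <= L * norm (minus x y)
}.

(** [lam] is the upper eigenvalue of the gap matrix and [kappa] the slope of
    its eigenvector: [exp (lam t) (1, kappa)] solves the comparison system. *)
Record gap_constants (hl cl L kappa lam : R) : Prop := GapConstants {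
  gap_L : 0 < L ;
  gap_lt : 4 * L < hl - cl ;
  gap_kappa : 0 < kappa <= 1 ;
  gap_up : hl - lam = L * (1 + kappa) ;
  gap_down : (lam - cl) * kappa = L * (1 + kappa) ;
  gap_mid : (hl + cl) / 2 < lam
}.

Record lipschitz_graph (pi : H -> H) (kappa : R) (g : H -> H) : Prop := LipschitzGraph {
  graph_minus : forall x, pi x = x -> pi (g x) = zero ;
  graph_0 : g zero = zero ;
  graph_lip : forall x y, pi x = x -> pi y = y ->
    norm (minus (g x) (g y)) <= kappa * norm (minus x y)
}.

Lemma compl_proj_linear (p : H -> H) : is_linear p -> is_linear (compl_proj p).
Proof.
move=> l; split.
- by move=> x y; rewrite /compl_proj (linear_plus _ l); lin_ring.
- by move=> k x; rewrite /compl_proj (linear_scal _ l); lin_ring.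
- have [M [M0 hM]] := linear_norm _ l.
  exists (1 + M); split=> [|x]; first lra.
  rewrite Rmult_plus_distr_r Rmult_1_l.
  by apply: norm_minus_le; [exact: Rle_refl|exact: hM].
Qed.

Lemma pi_plus_compl (p : H -> H) x : plus (p x) (compl_proj p x) = x.
Proof. by rewrite /compl_proj; lin_ring. Qed.

Context (pi : H -> H) {Up Um : R -> H -> H} {C : R -> R} {N : R -> H -> H}.
Context {hl cl L kappa lam : R}.
Hypothesis spl : splitting pi Up Um hl cl.
Hypothesis frc : forcing pi N L.
Hypothesis gap : gap_constants hl cl L kappa lam.
Hypothesis cC : forall t, Continuity.continuous C t.

Local Notation q := (compl_proj pi).

Lemma compl_linear : is_linear q.
Proof. exact: compl_proj_linear (split_pi spl). Qed.

Lemma pi_minus x y : pi (minus x y) = minus (pi x) (pi y).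
Proof. exact: linear_minus (split_pi spl). Qed.

Lemma compl_minus x y : q (minus x y) = minus (q x) (q y).
Proof. exact: linear_minus compl_linear. Qed.

Lemma pi_compl x : pi (q x) = zero.
Proof.
by rewrite /compl_proj (linear_minus _ _ _ (split_pi spl)) (split_pi_idem spl) minus_eq_zero.
Qed.

Lemma pi_0 : pi zero = zero. Proof. exact: linear_zero (split_pi spl). Qed.

Lemma compl_id x : pi x = zero -> q x = x.
Proof. by rewrite /compl_proj => ->; rewrite minus_zero_r. Qed.

Lemma compl_of_plus x : pi x = x -> q x = zero.
Proof. by rewrite /compl_proj => ->; rewrite minus_eq_zero. Qed.

Lemma pi_up s x : pi (Up s x) = Up s x.
Proof. by rewrite -(split_up0 spl) -(split_up_add spl) Rplus_0_l. Qed.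

Lemma up_pi s x : Up s (pi x) = Up s x.
Proof. by rewrite -(split_up0 spl) -(split_up_add spl) Rplus_0_r. Qed.

Lemma compl_um s x : 0 <= s -> q (Um s x) = Um s x.
Proof.
by move=> s0; rewrite -(split_um0 spl) -(split_um_add spl) ?Rplus_0_l //; lra.
Qed.

Lemma um_compl s x : 0 <= s -> Um s (q x) = Um s x.
Proof.
by move=> s0; rewrite -(split_um0 spl) -(split_um_add spl) ?Rplus_0_r //; lra.
Qed.

Lemma norm_pi_le x : norm (pi x) <= norm x.
Proof.
have := split_up_le spl x (Rle_refl 0).
by rewrite (split_up0 spl) Rmult_0_r exp_0 Rmult_1_l.
Qed.

Lemma norm_compl_le x : norm (q x) <= norm x.
Proof.
have := split_um_le spl x (Rle_refl 0).
by rewrite (split_um0 spl) Rmult_0_r exp_0 Rmult_1_l.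
Qed.

Lemma up_le s x : s <= 0 -> norm (Up s x) <= exp (hl * s) * norm (pi x).
Proof. by rewrite -up_pi; apply: (split_up_le spl). Qed.

Lemma um_le s x : 0 <= s -> norm (Um s x) <= exp (cl * s) * norm (q x).
Proof. by move=> s0; rewrite -um_compl //; apply: (split_um_le spl). Qed.

Definition plus_kernel X t r := scal (exp (C t - C r)) (Up (t - r) (N r (X r))).
Definition minus_kernel X t r := scal (exp (C t - C r)) (Um (t - r) (N r (X r))).

Definition plus_part b y X t :=
  minus (scal (exp (C t - C b)) (Up (t - b) y)) (RInt (plus_kernel X t) t b).

Definition minus_part a h X t :=
  plus (scal (exp (C t - C a)) (Um (t - a) h)) (RInt (minus_kernel X t) a t).

Definition path X := forall t, Continuity.continuous X t.

(** A mild solution: its unstable part is steered from the end of the window,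
    as the group is estimated backward in time, its stable part from the
    beginning.  The noise enters through the weight [exp (C t - C r)]. *)
Record trajectory (a b : R) X : Prop := Trajectory {
  traj_cont : path X ;
  traj_plus : forall t, a <= t <= b -> pi (X t) = plus_part b (pi (X b)) X t ;
  traj_minus : forall t, a <= t <= b -> q (X t) = minus_part a (q (X a)) X t
}.

Lemma weight_cont t r :
  Continuity.continuous (fun p : R * R => exp (C p.1 - C p.2)) (t, r).
Proof.
apply: (Continuity.continuous_comp (fun p : R * R => C p.1 - C p.2) exp).
  apply: (continuous_minus (fun p : R * R => C p.1) (fun p => C p.2)).
  - by apply: (Continuity.continuous_comp fst C); [exact: continuous_fst|exact: cC].
  - by apply: (Continuity.continuous_comp snd C); [exact: continuous_snd|exact: cC].
exact: continuous_exp.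
Qed.

Lemma kernel_cont (U : R -> H -> H) (k : R -> H) t r :
  (forall s x, Continuity.continuous (fun p : R * H => U p.1 p.2) (s, x)) ->
  (forall s, Continuity.continuous k s) ->
  Continuity.continuous
    (fun p : R * R => scal (exp (C p.1 - C p.2)) (U (p.1 - p.2) (k p.2))) (t, r).
Proof.
move=> cU ck.
apply: (continuous_scal (fun p : R * R => exp (C p.1 - C p.2))
  (fun p : R * R => U (p.1 - p.2) (k p.2))); first exact: weight_cont.
apply: (continuous_comp_2 (fun p : R * R => p.1 - p.2) (fun p : R * R => k p.2) U).
- apply: (continuous_minus (fun p : R * R => p.1) (fun p : R * R => p.2)).
  + exact: continuous_fst.
  + exact: continuous_snd.
- by apply: (Continuity.continuous_comp snd k); [exact: continuous_snd|exact: ck].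
- exact: cU.
Qed.

Lemma plus_kernel_cont X t r : path X ->
  Continuity.continuous (fun p : R * R => plus_kernel X p.1 p.2) (t, r).
Proof.
move=> cX; apply: (kernel_cont (k := fun r => N r (X r))).
- exact: split_up_cont spl.
- exact: forcing_cont frc _ cX.
Qed.

Lemma minus_kernel_cont X t r : path X ->
  Continuity.continuous (fun p : R * R => minus_kernel X p.1 p.2) (t, r).
Proof.
move=> cX; apply: (kernel_cont (k := fun r => N r (X r))).
- exact: split_um_cont spl.
- exact: forcing_cont frc _ cX.
Qed.

Lemma plus_kernel_cont1 X t r : path X -> Continuity.continuous (plus_kernel X t) r.
Proof.
move=> cX; apply: (continuous_comp_2 (fun _ => t) (fun s => s) (plus_kernel X)).
- exact: continuous_const.
- exact: continuous_id.
- exact: plus_kernel_cont.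
Qed.

Lemma minus_kernel_cont1 X t r : path X -> Continuity.continuous (minus_kernel X t) r.
Proof.
move=> cX; apply: (continuous_comp_2 (fun _ => t) (fun s => s) (minus_kernel X)).
- exact: continuous_const.
- exact: continuous_id.
- exact: minus_kernel_cont.
Qed.

Lemma free_part_cont (U : R -> H -> H) a h t :
  (forall s x, Continuity.continuous (fun p : R * H => U p.1 p.2) (s, x)) ->
  Continuity.continuous (fun t => scal (exp (C t - C a)) (U (t - a) h)) t.
Proof.
move=> cU.
apply: (continuous_comp_2 (fun t => t) (fun _ => a)
  (fun t r => scal (exp (C t - C r)) (U (t - r) h))).
- exact: continuous_id.
- exact: continuous_const.
- apply: (kernel_cont (k := fun _ => h)) => // s.
  exact: continuous_const.
Qed.

Lemma plus_part_cont b y X : path X -> path (plus_part b y X).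
Proof.
move=> cX t; apply: continuous_minus; first by apply: free_part_cont (split_up_cont spl).
apply: (continuous_ext (fun t => opp (RInt (plus_kernel X t) b t))) => [s|].
  by apply: opp_RInt_swap; apply: ex_RInt_cont => r; apply: plus_kernel_cont1.
apply: continuous_opp.
by apply: continuous_RInt_param => s r; apply: plus_kernel_cont.
Qed.

Lemma minus_part_cont a h X : path X -> path (minus_part a h X).
Proof.
move=> cX t; apply: continuous_plus; first by apply: free_part_cont (split_um_cont spl).
by apply: continuous_RInt_param => s r; apply: minus_kernel_cont.
Qed.

Lemma pi_plus_part b y X t : path X -> pi (plus_part b y X t) = plus_part b y X t.
Proof.
move=> cX; rewrite /plus_part (linear_minus _ _ _ (split_pi spl)).
rewrite (linear_scal _ (split_pi spl)) pi_up; congr minus.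
rewrite -(is_linear_RInt _ _ (split_pi spl)); last by move=> r; apply: plus_kernel_cont1.
apply: RInt_ext => r _.
by rewrite /plus_kernel (linear_scal _ (split_pi spl)) pi_up.
Qed.

Lemma compl_minus_part a h X t : path X -> a <= t ->
  q (minus_part a h X t) = minus_part a h X t.
Proof.
move=> cX tab; rewrite /minus_part (linear_plus _ compl_linear).
have ta : 0 <= t - a by lra.
rewrite (linear_scal _ compl_linear) (compl_um _ ta); congr plus.
rewrite -(is_linear_RInt _ _ compl_linear); last by move=> r; apply: minus_kernel_cont1.
apply: RInt_eq => // r rat; have tr : 0 <= t - r by lra.
by rewrite /minus_kernel (linear_scal _ compl_linear) (compl_um _ tr).
Qed.

Lemma plus_part_end b y X : plus_part b y X b = pi y.
Proof.
rewrite /plus_part RInt_point !Rminus_diag exp_0 (split_up0 spl).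
by rewrite minus_zero_r (@scal_one R_Ring).
Qed.

Lemma minus_part_start a h X : minus_part a h X a = q h.
Proof.
rewrite /minus_part RInt_point !Rminus_diag exp_0 (split_um0 spl).
by rewrite plus_zero_r (@scal_one R_Ring).
Qed.

Lemma norm_up_forcing t r x y : t <= r ->
  norm (Up (t - r) (minus (N r x) (N r y))) <= exp (hl * (t - r)) * (L * norm (minus x y)).
Proof.
move=> tr; apply: Rle_trans (up_le _ _) _; first lra.
apply: Rmult_le_compat_l; first exact/Rlt_le/exp_pos.
exact: forcing_plus frc _ _ _.
Qed.

Lemma norm_um_forcing t r x y : r <= t ->
  norm (Um (t - r) (minus (N r x) (N r y))) <= exp (cl * (t - r)) * (L * norm (minus x y)).
Proof.
move=> tr; apply: Rle_trans (um_le _ _) _; first lra.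
apply: Rmult_le_compat_l; first exact/Rlt_le/exp_pos.
exact: forcing_minus frc _ _ _.
Qed.

Lemma exp_split a b c : a = b + c -> exp a = exp b * exp c.
Proof. by move=> ->; apply: exp_plus. Qed.

(** The weight [exp (C t + nu t)] is an almost eigenfunction of the integral
    operator; the deficit is what the free part carries to the end [b]. *)
Lemma plus_part_diff b y y' X Y t K nu :
  path X -> path Y -> t <= b -> nu < hl ->
  (forall r, t <= r <= b -> norm (minus (X r) (Y r)) <= K * exp (C r + nu * r)) ->
  norm (minus (plus_part b y X t) (plus_part b y' Y t)) <=
    exp (C t - C b + hl * (t - b)) * norm (minus y y') +
    L * K / (hl - nu) * exp (C t) * (exp (nu * t) - exp (nu * b + hl * (t - b))).
Proof.
move=> cX cY tb nuh XY.
have -> : minus (plus_part b y X t) (plus_part b y' Y t) =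
    minus (scal (exp (C t - C b)) (Up (t - b) (minus y y')))
      (RInt (fun r => minus (plus_kernel X t r) (plus_kernel Y t r)) t b).
  rewrite RInt_minus; try by apply: ex_RInt_cont => r; apply: plus_kernel_cont1.
  by rewrite /plus_part (linear_minus _ _ _ (split_up_linear spl _)); lin_ring.
apply: norm_minus_le.
  apply: Rle_trans (norm_scal_exp _ _) _.
  rewrite exp_plus Rmult_assoc.
  apply: Rmult_le_compat_l; first exact/Rlt_le/exp_pos.
  by apply: (split_up_le spl); lra.
have -> : L * K / (hl - nu) * exp (C t) * (exp (nu * t) - exp (nu * b + hl * (t - b))) =
    L * K * exp (C t + hl * t) * (exp ((nu - hl) * b) - exp ((nu - hl) * t)) / (nu - hl).
  rewrite (@exp_split (nu * t) (hl * t) ((nu - hl) * t)); last by ring.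
  rewrite (@exp_split (nu * b + hl * (t - b)) (hl * t) ((nu - hl) * b)); last by ring.
  by rewrite exp_plus; field; lra.
apply: norm_RInt_le_exp => // [|r|r rtb]; first lra.
  by apply: continuous_minus; apply: plus_kernel_cont1.
have -> : minus (plus_kernel X t r) (plus_kernel Y t r) =
    scal (exp (C t - C r)) (Up (t - r) (minus (N r (X r)) (N r (Y r)))).
  by rewrite /plus_kernel (linear_minus _ _ _ (split_up_linear spl _)); lin_ring.
apply: Rle_trans (norm_scal_exp _ _) _.
have tr : t <= r by lra.
apply: Rle_trans (Rmult_le_compat_l _ _ _ (Rlt_le _ _ (exp_pos _)) (norm_up_forcing _ _ tr)) _.
have h := Rmult_le_compat_l _ _ _ (Rlt_le _ _ (gap_L gap)) (XY r rtb).
apply: Rle_trans (Rmult_le_compat_l _ _ _ (Rlt_le _ _ (exp_pos _))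
  (Rmult_le_compat_l _ _ _ (Rlt_le _ _ (exp_pos _)) h)) _.
right; rewrite (@exp_split (C t + hl * t) (C t - C r) (C r + hl * t)); last by ring.
rewrite (@exp_split (C r + nu * r) (C r) (nu * r)) //.
rewrite (@exp_split (C r + hl * t) (C r) (hl * t)) //.
rewrite (@exp_split (hl * (t - r)) (hl * t) (- (hl * r))); last by ring.
rewrite (@exp_split ((nu - hl) * r) (nu * r) (- (hl * r))); last by ring.
by ring.
Qed.

Lemma minus_part_diff a h h' X Y t K nu :
  path X -> path Y -> a <= t -> cl < nu ->
  (forall r, a <= r <= t -> norm (minus (X r) (Y r)) <= K * exp (C r + nu * r)) ->
  norm (minus (minus_part a h X t) (minus_part a h' Y t)) <=
    exp (C t - C a + cl * (t - a)) * norm (minus h h') +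
    L * K / (nu - cl) * exp (C t) * (exp (nu * t) - exp (nu * a + cl * (t - a))).
Proof.
move=> cX cY tab nuh XY.
have -> : minus (minus_part a h X t) (minus_part a h' Y t) =
    plus (scal (exp (C t - C a)) (Um (t - a) (minus h h')))
      (RInt (fun r => minus (minus_kernel X t r) (minus_kernel Y t r)) a t).
  rewrite RInt_minus; try by apply: ex_RInt_cont => r; apply: minus_kernel_cont1.
  by rewrite /minus_part (linear_minus _ _ _ (split_um_linear spl _)); lin_ring.
apply: norm_plus_le.
  apply: Rle_trans (norm_scal_exp _ _) _.
  rewrite exp_plus Rmult_assoc.
  apply: Rmult_le_compat_l; first exact/Rlt_le/exp_pos.
  by apply: (split_um_le spl); lra.
have -> : L * K / (nu - cl) * exp (C t) * (exp (nu * t) - exp (nu * a + cl * (t - a))) =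
    L * K * exp (C t + cl * t) * (exp ((nu - cl) * t) - exp ((nu - cl) * a)) / (nu - cl).
  rewrite (@exp_split (nu * t) (cl * t) ((nu - cl) * t)); last by ring.
  rewrite (@exp_split (nu * a + cl * (t - a)) (cl * t) ((nu - cl) * a)); last by ring.
  by rewrite exp_plus; field; lra.
apply: norm_RInt_le_exp => // [|r|r rtb]; first lra.
  by apply: continuous_minus; apply: minus_kernel_cont1.
have -> : minus (minus_kernel X t r) (minus_kernel Y t r) =
    scal (exp (C t - C r)) (Um (t - r) (minus (N r (X r)) (N r (Y r)))).
  by rewrite /minus_kernel (linear_minus _ _ _ (split_um_linear spl _)); lin_ring.
apply: Rle_trans (norm_scal_exp _ _) _.
have tr : r <= t by lra.
apply: Rle_trans (Rmult_le_compat_l _ _ _ (Rlt_le _ _ (exp_pos _)) (norm_um_forcing _ _ tr)) _.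
have hh := Rmult_le_compat_l _ _ _ (Rlt_le _ _ (gap_L gap)) (XY r rtb).
apply: Rle_trans (Rmult_le_compat_l _ _ _ (Rlt_le _ _ (exp_pos _))
  (Rmult_le_compat_l _ _ _ (Rlt_le _ _ (exp_pos _)) hh)) _.
right; rewrite (@exp_split (C t + cl * t) (C t - C r) (C r + cl * t)); last by ring.
rewrite (@exp_split (C r + nu * r) (C r) (nu * r)) //.
rewrite (@exp_split (C r + cl * t) (C r) (cl * t)) //.
rewrite (@exp_split (cl * (t - r)) (cl * t) (- (cl * r))); last by ring.
rewrite (@exp_split ((nu - cl) * r) (nu * r) (- (cl * r))); last by ring.
by ring.
Qed.

(** In the weight halfway between the two growth rates both parts contract by
    [ratio / 2]. *)
Definition mid := (hl + cl) / 2.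
Definition ratio := 4 * L / (hl - cl).

Lemma ratio_bounds : 0 <= ratio < 1.
Proof.
have := gap_L gap; have := gap_lt gap => h1 h2; rewrite /ratio; split.
  by apply: Rdiv_le_0_compat; lra.
by apply: (Rmult_lt_reg_r (hl - cl)); [lra|rewrite /Rdiv Rmult_assoc Rinv_l; lra].
Qed.

(** Each part contributes [ratio / 2].  The initial stable parts may differ by
    as much as the unstable parts at time [a], up to [d]: this excess is
    absorbed because it only fills the deficit left by the stable integral at
    [a]. *)
Lemma window_contraction a b y h h' X Y K d :
  path X -> path Y -> 0 <= K -> 0 <= d ->
  (forall t, a <= t <= b -> norm (minus (X t) (Y t)) <= K * exp (C t + mid * t)) ->
  norm (minus h h') <= d * exp (C a + mid * a) +
    norm (minus (plus_part b y X a) (plus_part b y Y a)) ->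
  forall t, a <= t <= b ->
    norm (minus (plus_part b y X t) (plus_part b y Y t)) <=
      ratio / 2 * K * exp (C t + mid * t) /\
    norm (minus (plus (plus_part b y X t) (minus_part a h X t))
                (plus (plus_part b y Y t) (minus_part a h' Y t))) <=
      (ratio * K + d) * exp (C t + mid * t).
Proof.
have := gap_L gap; have := gap_lt gap => h1 h2.
have muh : mid < hl by rewrite /mid; lra.
have mul : cl < mid by rewrite /mid; lra.
move=> cX cY K0 d0 XY hh'.
have U t : a <= t <= b -> norm (minus (plus_part b y X t) (plus_part b y Y t)) <=
    ratio / 2 * K * exp (C t + mid * t).
  move=> tab; apply: Rle_trans (plus_part_diff (K := K) y y cX cY tab.2 muh _) _ => [r rtb|].
    by apply: XY; lra.
  rewrite minus_eq_zero norm_zero Rmult_0_r Rplus_0_l.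
  have -> : L * K / (hl - mid) = ratio / 2 * K by rewrite /ratio /mid; field; lra.
  rewrite (exp_plus (C t)).
  have := exp_pos (mid * b + hl * (t - b)) => e0.
  have := exp_pos (C t) => c0; have [th0 _] := ratio_bounds.
  rewrite -!Rmult_assoc; apply: Rmult_le_compat_l; last by lra.
  by do 2 (apply: Rmult_le_pos; last lra); lra.
move=> t tab; split; first exact: U.
have -> : minus (plus (plus_part b y X t) (minus_part a h X t))
                (plus (plus_part b y Y t) (minus_part a h' Y t)) =
    plus (minus (plus_part b y X t) (plus_part b y Y t))
         (minus (minus_part a h X t) (minus_part a h' Y t)) by lin_ring.
have -> : (ratio * K + d) * exp (C t + mid * t) =
    ratio / 2 * K * exp (C t + mid * t) + (ratio / 2 * K + d) * exp (C t + mid * t).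
  by field.
apply: norm_plus_le; first exact: U.
apply: Rle_trans (minus_part_diff (K := K) h h' cX cY tab.1 mul _) _ => [r rtb|].
  by apply: XY; lra.
have -> : L * K / (mid - cl) = ratio / 2 * K by rewrite /ratio /mid; field; lra.
have Ua := U a ltac:(lra).
have {}hh' : norm (minus h h') <= (d + ratio / 2 * K) * exp (C a + mid * a) by lra.
apply: Rle_trans (Rplus_le_compat_r _ _ _
  (Rmult_le_compat_l _ _ _ (Rlt_le _ _ (exp_pos _)) hh')) _.
have -> : exp (C t - C a + cl * (t - a)) * ((d + ratio / 2 * K) * exp (C a + mid * a)) =
    (d + ratio / 2 * K) * (exp (C t) * exp (mid * a + cl * (t - a))).
  rewrite Rmult_comm Rmult_assoc -!exp_plus; congr (_ * exp _); ring.
have le : exp (mid * a + cl * (t - a)) <= exp (mid * t).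
  have : mid * a + cl * (t - a) <= mid * t.
    by have := Rmult_le_pos (mid - cl) (t - a) ltac:(lra) ltac:(lra); lra.
  by case=> [/exp_increasing|->]; lra.
rewrite (exp_plus (C t)).
have := Rmult_le_compat_l _ _ _ (Rmult_le_pos _ _ d0 (Rlt_le _ _ (exp_pos (C t)))) le.
by lra.
Qed.

(** The comparison system [u' = hl u - L (u + v)], [v' = cl v + L (u + v)] has
    the solution [exp (lam t) (1, kappa)], so the cone of slope [kappa] is
    reproduced exactly. *)
Lemma window_cone a b y y' h h' X Y M :
  path X -> path Y ->
  (forall t, a <= t <= b -> norm (pi (minus (X t) (Y t))) <= M * exp (C t + lam * t)) ->
  (forall t, a <= t <= b -> norm (q (minus (X t) (Y t))) <= kappa * M * exp (C t + lam * t)) ->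
  norm (minus y y') <= M * exp (C b + lam * b) ->
  norm (minus h h') <= kappa * norm (minus (plus_part b y X a) (plus_part b y' Y a)) ->
  forall t, a <= t <= b ->
    norm (minus (plus_part b y X t) (plus_part b y' Y t)) <= M * exp (C t + lam * t) /\
    norm (minus (minus_part a h X t) (minus_part a h' Y t)) <= kappa * M * exp (C t + lam * t).
Proof.
have [L0 k0] := (gap_L gap, gap_kappa gap).
have [up down] := (gap_up gap, gap_down gap).
have Lk : 0 < L * (1 + kappa) by apply: Rmult_lt_0_compat; lra.
have lamh : lam < hl by lra.
have laml : cl < lam.
  have lk : 0 < (lam - cl) * kappa by lra.
  by have := Rmult_lt_reg_r kappa 0 (lam - cl) k0.1; lra.
move=> cX cY piXY qXY yy' hh'.
have XY t : a <= t <= b ->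
    norm (minus (X t) (Y t)) <= (1 + kappa) * M * exp (C t + lam * t).
  move=> tab; rewrite -(pi_plus_compl pi (minus (X t) (Y t))).
  have -> : (1 + kappa) * M * exp (C t + lam * t) =
    M * exp (C t + lam * t) + kappa * M * exp (C t + lam * t) by ring.
  by apply: norm_plus_le; [exact: piXY|exact: qXY].
have U t : a <= t <= b ->
    norm (minus (plus_part b y X t) (plus_part b y' Y t)) <= M * exp (C t + lam * t).
  move=> tab.
  apply: Rle_trans (plus_part_diff (K := (1 + kappa) * M) y y' cX cY tab.2 lamh _) _ => [r rtb|].
    by apply: XY; lra.
  have -> : L * ((1 + kappa) * M) / (hl - lam) = M by rewrite up; field; lra.
  apply: Rle_trans (Rplus_le_compat_r _ _ _
    (Rmult_le_compat_l _ _ _ (Rlt_le _ _ (exp_pos _)) yy')) _.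
  have -> : exp (C t - C b + hl * (t - b)) * (M * exp (C b + lam * b)) =
      M * (exp (C t) * exp (lam * b + hl * (t - b))).
    rewrite Rmult_comm Rmult_assoc -!exp_plus; congr (_ * exp _); ring.
  by rewrite (exp_plus (C t)); lra.
move=> t tab; split; first exact: U.
apply: Rle_trans (minus_part_diff (K := (1 + kappa) * M) h h' cX cY tab.1 laml _) _ => [r rtb|].
  by apply: XY; lra.
have -> : L * ((1 + kappa) * M) / (lam - cl) = kappa * M.
  have -> : L * ((1 + kappa) * M) = (lam - cl) * kappa * M by rewrite down; ring.
  by field; lra.
have Ua := Rmult_le_compat_l _ _ _ (Rlt_le _ _ k0.1) (U a ltac:(lra)).
apply: Rle_trans (Rplus_le_compat_r _ _ _
  (Rmult_le_compat_l _ _ _ (Rlt_le _ _ (exp_pos _)) (Rle_trans _ _ _ hh' Ua))) _.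
have -> : exp (C t - C a + cl * (t - a)) * (kappa * (M * exp (C a + lam * a))) =
    kappa * M * (exp (C t) * exp (lam * a + cl * (t - a))).
  rewrite Rmult_comm -Rmult_assoc Rmult_assoc -!exp_plus; congr (_ * exp _); ring.
by rewrite (exp_plus (C t)); lra.
Qed.

(** * Trajectories steered by a graph: existence, uniqueness and comparison *)

(** The graph transform of [g] over the window [a, b] maps [y] to [q (X b)]. *)
Record steered g (a b : R) y X : Prop := Steered {
  steered_traj : trajectory a b X ;
  steered_end : pi (X b) = y ;
  steered_start : q (X a) = g (pi (X a))
}.

Definition clamp (a b t : R) : R := Rmax a (Rmin t b).

(** Clamping makes the iterates uniformly convergent on the whole line, so that
    the limit is continuous there. *)
Definition window_map g a b y X : R -> H := fun t =>
  plus (plus_part b y X (clamp a b t))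
       (minus_part a (g (plus_part b y X a)) X (clamp a b t)).

Fixpoint picard g a b y n : R -> H :=
  if n is m.+1 then window_map g a b y (picard g a b y m) else fun _ => zero.

Lemma clamp_id a b t : a <= t <= b -> clamp a b t = t.
Proof. by move=> [at_ tb]; rewrite /clamp Rmin_left // Rmax_right. Qed.

Lemma clamp_in a b t : a <= b -> a <= clamp a b t <= b.
Proof.
rewrite /clamp => ab; split; first exact: Rmax_l.
by apply: Rmax_lub => //; apply: Rmin_r.
Qed.

Lemma clamp_cont a b t : Continuity.continuous (clamp a b) t.
Proof.
apply/filterlim_locally => e; exists e => s.
rewrite /ball /= /AbsRing_ball /abs /minus /plus /opp /= /clamp => st.
apply: Rle_lt_trans st.
have maxL (x y : R) : Rabs (Rmax a x + - Rmax a y) <= Rabs (x + - y).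
  by rewrite /Rmax; do ! case: Rle_dec => ?; unfold Rabs; do ! case: Rcase_abs => ?; lra.
apply: Rle_trans (maxL _ _) _; rewrite /Rmin.
by do ! case: Rle_dec => ?; unfold Rabs; do ! case: Rcase_abs => ?; lra.
Qed.

Lemma path_clamp a b X : path X -> path (fun t => X (clamp a b t)).
Proof. by move=> cX t; apply: Continuity.continuous_comp; [exact: clamp_cont|exact: cX]. Qed.

Lemma window_map_cont g a b y X : path X -> path (window_map g a b y X).
Proof.
move=> cX t; apply: continuous_plus.
- by apply: path_clamp; apply: plus_part_cont.
- by apply: path_clamp; apply: minus_part_cont.
Qed.

Lemma picard_cont g a b y n : path (picard g a b y n).
Proof.
elim: n => [|n IH] t /=; first exact: continuous_const.
exact: window_map_cont.
Qed.

Lemma picard_clamp g a b y n t : a <= b ->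
  picard g a b y n t = picard g a b y n (clamp a b t).
Proof. by case: n => // n ab /=; rewrite /window_map (clamp_id (clamp_in t ab)). Qed.

Lemma trajectory_sum a b X t : trajectory a b X -> a <= t <= b ->
  X t = plus (plus_part b (pi (X b)) X t) (minus_part a (q (X a)) X t).
Proof.
by move=> [_ hp hm] tab; rewrite -hp // -hm // pi_plus_compl.
Qed.

Lemma steered_fixed g a b y X t :
  steered g a b y X -> a <= t <= b -> X t = window_map g a b y X t.
Proof.
move=> [tX eX sX] tab; rewrite /window_map (clamp_id tab).
rewrite {1}(trajectory_sum tX tab) eX sX (traj_plus tX) ?eX //; lra.
Qed.

Lemma fixed_steered g a b y X :
  lipschitz_graph pi kappa g -> a <= b -> pi y = y -> path X ->
  (forall t, a <= t <= b -> X t = window_map g a b y X t) -> steered g a b y X.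
Proof.
move=> lg ab yp cX fX.
have piX t : a <= t <= b -> pi (X t) = plus_part b y X t.
  move=> tab; rewrite fX // /window_map (clamp_id tab) (linear_plus _ (split_pi spl)).
  by rewrite -(compl_minus_part _ cX tab.1) pi_compl plus_zero_r pi_plus_part.
have qX t : a <= t <= b -> q (X t) = minus_part a (g (plus_part b y X a)) X t.
  move=> tab; rewrite fX // /window_map (clamp_id tab) (linear_plus _ compl_linear).
  rewrite compl_of_plus; last exact: pi_plus_part.
  by rewrite plus_zero_l (compl_minus_part _ cX tab.1).
have eX : pi (X b) = y by rewrite piX ?plus_part_end //; lra.
have sX : q (X a) = g (pi (X a)).
  rewrite qX ?minus_part_start ?piX; try lra.
  by apply: compl_id; apply: (graph_minus lg); apply: pi_plus_part.
split=> //; split=> // t tab; first by rewrite eX piX.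
by rewrite qX // sX piX //; lra.
Qed.

Lemma window_map_contraction g a b y X Y K :
  lipschitz_graph pi kappa g -> path X -> path Y -> 0 <= K ->
  (forall t, a <= t <= b -> norm (minus (X t) (Y t)) <= K * exp (C t + mid * t)) ->
  forall t, a <= t <= b ->
    norm (minus (window_map g a b y X t) (window_map g a b y Y t)) <=
      ratio * K * exp (C t + mid * t).
Proof.
move=> lg cX cY K0 XY t tab; rewrite /window_map (clamp_id tab).
have [|_] := window_contraction (d := 0) (h := g (plus_part b y X a))
  (h' := g (plus_part b y Y a)) (y := y) cX cY K0 (Rle_refl _) XY _ tab.
  rewrite Rmult_0_l Rplus_0_l.
  apply: Rle_trans (graph_lip lg _ _) _; try exact: pi_plus_part.
  rewrite -[X in _ <= X]Rmult_1_l; apply: Rmult_le_compat_r; first exact: norm_ge_0.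
  exact: (gap_kappa gap).2.
by rewrite Rplus_0_r.
Qed.

Lemma weighted_bound a b X : a <= b -> path X ->
  exists K, 0 <= K /\ forall t, a <= t <= b -> norm (X t) <= K * exp (C t + mid * t).
Proof.
move=> ab cX.
have cw (k : R) t : Continuity.continuous (fun t => exp (k * (C t + mid * t))) t.
  apply: (Continuity.continuous_comp (fun t => k * (C t + mid * t)) exp); last exact: continuous_exp.
  apply: (continuous_scal_r (V := R_NormedModule) k (fun t => C t + mid * t)).
  apply: (continuous_plus (V := R_NormedModule) C (fun t => mid * t)); first exact: cC.
  exact: (continuous_scal_r (V := R_NormedModule) mid (fun t => t) _ (continuous_id _)).
have [K hK] : {K | forall t, a <= t <= b ->
    norm (scal (exp (-1 * (C t + mid * t))) (X t)) < K}.
  apply: bounded_continuity => t _.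
  by apply: (continuous_scal (fun t => exp (-1 * (C t + mid * t))) X); [exact: cw|exact: cX].
exists K; split=> [|t tab].
  by apply/Rlt_le; apply: Rle_lt_trans (norm_ge_0 _) (hK a _); lra.
have -> : X t = scal (exp (C t + mid * t)) (scal (exp (-1 * (C t + mid * t))) (X t)).
  rewrite scal_assoc /mult /= -exp_plus.
  have -> : C t + mid * t + -1 * (C t + mid * t) = 0 by ring.
  by rewrite exp_0 (@scal_one R_Ring).
apply: Rle_trans (norm_scal_exp _ _) _; rewrite Rmult_comm.
by apply: Rmult_le_compat_r; [exact/Rlt_le/exp_pos|exact/Rlt_le/hK].
Qed.

Lemma weight_bound a b : a <= b ->
  exists W, 0 <= W /\ forall t, a <= t <= b -> exp (C t + mid * t) <= W.
Proof.
move=> ab.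
have [W hW] : {W | forall t, a <= t <= b -> norm (exp (C t + mid * t) : R_NormedModule) < W}.
  apply: bounded_continuity => t _.
  apply: (Continuity.continuous_comp (fun t => C t + mid * t) exp); last exact: continuous_exp.
  apply: (continuous_plus (V := R_NormedModule) C (fun t => mid * t)); first exact: cC.
  exact: (continuous_scal_r (V := R_NormedModule) mid (fun t => t) _ (continuous_id _)).
have hW1 t : a <= t <= b -> exp (C t + mid * t) <= W.
  by move=> /hW; rewrite /norm /= /abs /= Rabs_pos_eq => [|]; [lra|exact/Rlt_le/exp_pos].
exists W; split=> //.
by apply: Rle_trans (Rlt_le _ _ (exp_pos _)) (hW1 a _); lra.
Qed.

(** Uniqueness of steered trajectories is a consequence: all of them are the
    limit of the same iterates. *)
Lemma picard_steered g a b y X : lipschitz_graph pi kappa g -> a <= b ->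
  steered g a b y X ->
  exists K, 0 <= K /\ forall n t, a <= t <= b ->
    norm (minus (picard g a b y n t) (X t)) <= K * ratio ^ n * exp (C t + mid * t).
Proof.
move=> lg ab sX; have cX := traj_cont (steered_traj sX).
have [K [K0 hK]] := weighted_bound ab cX.
exists K; split=> //; elim=> [|n IH] t tab.
  by rewrite /= Rmult_1_r norm_minusC minus_zero_r; apply: hK.
rewrite (steered_fixed sX tab).
have tn : 0 <= ratio ^ n by apply: pow_le; have := ratio_bounds; lra.
have := window_map_contraction y lg (@picard_cont g a b y n) cX
  (Rmult_le_pos _ _ K0 tn) IH tab.
by rewrite /= => /Rle_trans; apply; right; ring.
Qed.

Lemma ratio_pow_small K e : 0 < e -> exists n, K * ratio ^ n <= e.
Proof.
move=> e0; have [th0 th1] := ratio_bounds.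
have K1 : 0 < Rabs K + 1 by have := Rabs_pos K; lra.
have [n hn] := pow_lt_1_zero ratio ltac:(by rewrite Rabs_pos_eq) _
  (Rdiv_lt_0_compat _ _ e0 K1).
exists n; have := hn n (le_n _); have tn := pow_le _ n th0; rewrite Rabs_pos_eq // => h.
apply: Rle_trans (Rmult_le_compat_r _ _ (Rabs K + 1) tn _) _.
  by have := Rle_abs K; lra.
have -> : e = (Rabs K + 1) * (e / (Rabs K + 1)) by field; lra.
by apply: Rmult_le_compat_l; lra.
Qed.

Lemma picard_cv g a b y X t : lipschitz_graph pi kappa g -> a <= b ->
  steered g a b y X -> a <= t <= b ->
  filterlim (fun n => picard g a b y n t) eventually (locally (X t)).
Proof.
move=> lg ab sX tab; have [K [K0 hK]] := picard_steered lg ab sX.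
apply/filterlim_locally_ball_norm => e; have e2 := is_pos_div_2 e.
have [n hn] := ratio_pow_small (K * exp (C t + mid * t)) e2.
exists n => m nm; rewrite /ball_norm.
apply: Rle_lt_trans (hK m t tab) _.
apply: Rle_lt_trans (_ : e / 2 < e); last by have := cond_pos e; lra.
apply: Rle_trans hn.
have -> : K * ratio ^ m * exp (C t + mid * t) = K * exp (C t + mid * t) * ratio ^ m by ring.
apply: Rmult_le_compat_l; first by apply: Rmult_le_pos => //; exact/Rlt_le/exp_pos.
have [th0 th1] := ratio_bounds.
have -> : m = (n + (m - n))%coq_nat by rewrite Nat.add_comm Nat.sub_add.
rewrite pow_add -[X in _ <= X]Rmult_1_r; apply: Rmult_le_compat_l; first exact: pow_le.
by rewrite -(pow1 (m - n)%coq_nat); apply: pow_incr; lra.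
Qed.

Lemma steered_unique g a b y X Y t : lipschitz_graph pi kappa g -> a <= b ->
  steered g a b y X -> steered g a b y Y -> a <= t <= b -> X t = Y t.
Proof.
move=> lg ab sX sY tab.
apply: (@filterlim_locally_unique _ _ H eventually _ (fun n => picard g a b y n t)).
- exact: picard_cv.
- exact: picard_cv.
Qed.

(** The weight is bounded on a compact window, so the weighted contraction
    gives uniform convergence and a continuous limit. *)
Lemma steered_exists g a b y : lipschitz_graph pi kappa g -> a <= b -> pi y = y ->
  exists X, steered g a b y X.
Proof.
move=> lg ab yp; have [th0 th1] := ratio_bounds.
pose P := picard g a b y.
have cP n : path (P n) by apply: picard_cont.
have [K [K0 hK]] := weighted_bound ab (cP 1%N).
have [W [W0 hW]] := weight_bound ab.
have tn n : 0 <= ratio ^ n by apply: pow_le.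
have inc n t : a <= t <= b ->
    norm (minus (P n.+1 t) (P n t)) <= K * exp (C t + mid * t) * ratio ^ n.
  elim: n t => [|n IH] t tab; first by rewrite minus_zero_r Rmult_1_r; apply: hK.
  have IH' s : a <= s <= b -> norm (minus (P n.+1 s) (P n s)) <=
      K * ratio ^ n * exp (C s + mid * s) by move=> /IH /Rle_trans; apply; right; ring.
  have := window_map_contraction y lg (cP n.+1) (cP n)
    (Rmult_le_pos _ _ K0 (tn n)) IH' tab.
  by move=> /Rle_trans; apply; right => /=; ring.
have inc' t n : norm (minus (P n.+1 (clamp a b t)) (P n (clamp a b t))) <=
    K * exp (C (clamp a b t) + mid * clamp a b t) * ratio ^ n.
  by apply: inc; apply: clamp_in.
have [X hX] := choice (fun t => geometric_limit ratio_bounds (inc' t)).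
have rate n t : norm (minus (P n t) (X t)) <=
    K / (1 - ratio) * ratio ^ n * exp (C (clamp a b t) + mid * clamp a b t).
  rewrite /P picard_clamp //; apply: Rle_trans ((hX t).2 n) _.
  by right; field; lra.
pose B := K / (1 - ratio) * W.
have K1 : 0 <= K / (1 - ratio) by apply: Rdiv_le_0_compat; lra.
have rateW n t : norm (minus (P n t) (X t)) <= B * ratio ^ n.
  apply: Rle_trans (rate n t) _.
  have -> : B * ratio ^ n = K / (1 - ratio) * ratio ^ n * W by rewrite /B; ring.
  apply: Rmult_le_compat_l; first exact: Rmult_le_pos.
  by apply: hW; apply: clamp_in.
have cX : path X.
  move=> t; apply/continuous_normP => e e0.
  have [n hn] : exists n, B * ratio ^ n <= e / 4 by apply: ratio_pow_small; lra.
  have [d [d0 hd]] := (continuous_normP (P n) t).1 (cP n t) (e / 4) ltac:(lra).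
  exists d; split=> // s /hd sd.
  have h1 := Rle_trans _ _ _ (rateW n s) hn; have h2 := Rle_trans _ _ _ (rateW n t) hn.
  have := norm_minus_triangle (P n s) (X s) (X t).
  have := norm_minus_triangle (P n t) (P n s) (X t).
  by rewrite (norm_minusC (X s) (P n s)); lra.
exists X; apply: fixed_steered => // t tab.
apply: norm_minus_eq0 => e e0.
pose D := 2 * (K / (1 - ratio)) * exp (C t + mid * t).
have [n hn] := ratio_pow_small D e0.
apply: Rle_trans hn.
have rate' s : a <= s <= b -> norm (minus (P n s) (X s)) <=
    K / (1 - ratio) * ratio ^ n * exp (C s + mid * s).
  by move=> sab; have := rate n s; rewrite (clamp_id sab).
have h1 := window_map_contraction y lg (cP n) cX
  (Rmult_le_pos _ _ K1 (tn n)) rate' tab.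
have h2 := rate n.+1 t; rewrite (clamp_id tab) in h2.
have h3 := norm_minus_triangle (P n.+1 t) (X t) (window_map g a b y X t).
rewrite (norm_minusC (X t) (P n.+1 t)) in h3.
have p0 : 0 <= K / (1 - ratio) * ratio ^ n * exp (C t + mid * t).
  by apply: Rmult_le_pos; [exact: Rmult_le_pos|exact/Rlt_le/exp_pos].
have h4 : ratio * (K / (1 - ratio) * ratio ^ n * exp (C t + mid * t)) <=
    1 * (K / (1 - ratio) * ratio ^ n * exp (C t + mid * t)).
  by apply: Rmult_le_compat_r; lra.
apply: Rle_trans h3 _; apply: Rle_trans (Rplus_le_compat _ _ _ _ h2 h1) _.
have e1 : K / (1 - ratio) * ratio ^ n.+1 * exp (C t + mid * t) =
  ratio * (K / (1 - ratio) * ratio ^ n * exp (C t + mid * t)) by rewrite /=; ring.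
have e2 : ratio * (K / (1 - ratio) * ratio ^ n) * exp (C t + mid * t) =
  ratio * (K / (1 - ratio) * ratio ^ n * exp (C t + mid * t)) by ring.
have e3 : D * ratio ^ n = 2 * (K / (1 - ratio) * ratio ^ n * exp (C t + mid * t)).
  by rewrite /D; ring.
by rewrite e1 e2 e3; lra.
Qed.

(** * Restriction to subwindows *)

Lemma kernel_shift (U : R -> H -> H) s t r x : is_linear (U (t - s)) ->
  U (t - r) x = U (t - s) (U (s - r) x) ->
  scal (exp (C t - C r)) (U (t - r) x) =
    scal (exp (C t - C s)) (U (t - s) (scal (exp (C s - C r)) (U (s - r) x))).
Proof.
move=> lU ->; rewrite (linear_scal _ lU) scal_assoc /mult /= -exp_plus.
by congr (scal (exp _) _); ring.
Qed.

(** The group property moves the point from which the unstable part is steered. *)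
Lemma plus_part_split b c y X t : path X ->
  plus_part b (plus_part c y X b) X t = plus_part c y X t.
Proof.
move=> cX; have lU := split_up_linear spl (t - b).
have shift r x : Up (t - r) x = Up (t - b) (Up (b - r) x).
  by rewrite -(split_up_add spl); congr Up; ring.
rewrite /plus_part (kernel_shift (s := b) lU (shift c y)).
rewrite (linear_minus _ _ _ lU) scal_minus_distr_l.
rewrite -(RInt_Chasles (plus_kernel X t) t b c);
  try by apply: ex_RInt_cont => r; apply: plus_kernel_cont1.
have -> : RInt (plus_kernel X t) b c =
    scal (exp (C t - C b)) (Up (t - b) (RInt (plus_kernel X b) b c)).
  rewrite -(is_linear_RInt _ _ lU); last by move=> r; apply: plus_kernel_cont1.
  rewrite -RInt_scal.
    by apply: RInt_ext => r _; rewrite /plus_kernel; apply: kernel_shift.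
  apply: ex_RInt_cont => r; apply: Continuity.continuous_comp; first exact: plus_kernel_cont1.
  exact: linear_cont.
by lin_ring.
Qed.

Lemma minus_part_split a b h X t : path X -> a <= b -> b <= t ->
  minus_part b (minus_part a h X b) X t = minus_part a h X t.
Proof.
move=> cX ab bt; have lU := split_um_linear spl (t - b).
have shift r x : r <= b -> Um (t - r) x = Um (t - b) (Um (b - r) x).
  by move=> rb; rewrite -(split_um_add spl); try lra; congr Um; ring.
rewrite /minus_part (kernel_shift (s := b) lU (shift a h ab)).
rewrite (linear_plus _ lU) scal_distr_l.
rewrite -(RInt_Chasles (minus_kernel X t) a b t);
  try by apply: ex_RInt_cont => r; apply: minus_kernel_cont1.
have -> : RInt (minus_kernel X t) a b =
    scal (exp (C t - C b)) (Um (t - b) (RInt (minus_kernel X b) a b)).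
  rewrite -(is_linear_RInt _ _ lU); last by move=> r; apply: minus_kernel_cont1.
  rewrite -RInt_scal.
    apply: RInt_eq => // r [_ rb]; rewrite /minus_kernel.
    by apply: kernel_shift => //; apply: shift.
  apply: ex_RInt_cont => r; apply: Continuity.continuous_comp; first exact: minus_kernel_cont1.
  exact: linear_cont.
by lin_ring.
Qed.

Lemma trajectory_left a b c X :
  a <= b <= c -> trajectory a c X -> trajectory a b X.
Proof.
move=> [ab bc] [cX hp hm]; split=> // t tab; last by apply: hm; lra.
by rewrite (hp t) ?(hp b) ?(plus_part_split _ _ _ _ cX) //; lra.
Qed.

Lemma trajectory_right a b c X :
  a <= b <= c -> trajectory a c X -> trajectory b c X.
Proof.
move=> [ab bc] [cX hp hm]; split=> // t tab; first by apply: hp; lra.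
by rewrite (hm t) ?(hm b) ?(minus_part_split _ cX ab tab.1) //; lra.
Qed.

Lemma steered_left g a b c y X :
  a <= b <= c -> steered g a c y X -> steered g a b (pi (X b)) X.
Proof. by move=> abc [tX _ sX]; split=> //; apply: trajectory_left tX. Qed.

(** * Decay of trajectories inside the cone *)

Lemma steered_0 g a b : lipschitz_graph pi kappa g -> steered g a b zero (fun _ => zero).
Proof.
move=> lg; have [lp lq] := (split_pi spl, compl_linear).
have kp t r : plus_kernel (fun _ => zero) t r = zero.
  rewrite /plus_kernel (forcing_0 frc) (linear_zero _ (split_up_linear spl _)).
  exact: scal_zero_r.
have km t r : minus_kernel (fun _ => zero) t r = zero.
  rewrite /minus_kernel (forcing_0 frc) (linear_zero _ (split_um_linear spl _)).
  exact: scal_zero_r.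
split; rewrite ?(linear_zero _ lp) ?(linear_zero _ lq) ?(graph_0 lg) //.
split=> [t|t _|t _]; rewrite ?(linear_zero _ lp) ?(linear_zero _ lq).
- exact: continuous_const.
- rewrite /plus_part (linear_zero _ (split_up_linear spl _)) scal_zero_r.
  rewrite (RInt_ext _ (fun _ => zero)); last by move=> r _; apply: kp.
  by rewrite RInt_const scal_zero_r minus_zero_r.
- rewrite /minus_part (linear_zero _ (split_um_linear spl _)) scal_zero_r.
  rewrite (RInt_ext _ (fun _ => zero)); last by move=> r _; apply: km.
  by rewrite RInt_const scal_zero_r plus_zero_r.
Qed.

Lemma norm_limit_le (u : nat -> H) x B : filterlim u eventually (locally x) ->
  (forall n, norm (u n) <= B) -> norm x <= B.
Proof.
move=> ux uB; apply: le_epsilon => e e0.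
have [n hn] := (filterlim_locally_ball_norm u x).1 ux (mkposreal _ e0).
have h1 : norm (minus (u n) x) < e := hn n (le_n n).
have -> : x = minus (u n) (minus (u n) x) by lin_ring.
by apply: norm_minus_le; [exact: uB|lra].
Qed.

(** The Picard iterates start from zero, hence in the cone, and [window_cone]
    keeps them there; the bounds are closed conditions. *)
Lemma steered_cone_diff g a b y y' X Y : lipschitz_graph pi kappa g -> a <= b ->
  pi y = y -> pi y' = y' -> steered g a b y X -> steered g a b y' Y ->
  forall t, a <= t <= b ->
    norm (pi (minus (X t) (Y t))) <=
      exp (C t - C b + lam * (t - b)) * norm (minus y y') /\
    norm (q (minus (X t) (Y t))) <=
      kappa * (exp (C t - C b + lam * (t - b)) * norm (minus y y')).
Proof.
move=> lg ab yp yp' sX sY.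
have [lp lq] := (split_pi spl, compl_linear).
pose M := norm (minus y y') * exp (- (C b + lam * b)).
have M0 : 0 <= M by apply: Rmult_le_pos; [exact: norm_ge_0|exact/Rlt_le/exp_pos].
have yM : norm (minus y y') <= M * exp (C b + lam * b).
  rewrite /M Rmult_assoc -exp_plus Rplus_opp_l exp_0 Rmult_1_r; exact: Rle_refl.
have k0 := (gap_kappa gap).1.
have cone n t : a <= t <= b ->
    norm (pi (minus (picard g a b y n t) (picard g a b y' n t))) <= M * exp (C t + lam * t) /\
    norm (q (minus (picard g a b y n t) (picard g a b y' n t))) <=
      kappa * M * exp (C t + lam * t).
  elim: n t => [|n IH] t tab.
    have p0 := Rmult_le_pos _ _ M0 (Rlt_le _ _ (exp_pos (C t + lam * t))).
    rewrite /= minus_eq_zero (linear_zero _ lp) (linear_zero _ lq) norm_zero.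
    by split=> //; rewrite Rmult_assoc; apply: Rmult_le_pos; lra.
  rewrite /= /window_map (clamp_id tab).
  set X' := picard g a b y n; set Y' := picard g a b y' n.
  have cX' : path X' by apply: picard_cont.
  have cY' : path Y' by apply: picard_cont.
  have [|hp hm] := window_cone (h := g (plus_part b y X' a)) (h' := g (plus_part b y' Y' a))
    cX' cY' (fun s sab => (IH s sab).1) (fun s sab => (IH s sab).2) yM _ tab.
    by apply: (graph_lip lg); apply: pi_plus_part.
  set p := plus_part b y X' t; set p' := plus_part b y' Y' t.
  set m := minus_part a _ X' t; set m' := minus_part a _ Y' t.
  have pm : pi m = zero by rewrite /m -(compl_minus_part _ cX' tab.1) pi_compl.
  have pm' : pi m' = zero by rewrite /m' -(compl_minus_part _ cY' tab.1) pi_compl.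
  have pp : pi p = p by apply: pi_plus_part.
  have pp' : pi p' = p' by apply: pi_plus_part.
  have e : pi (minus (plus p m) (plus p' m')) = minus p p'.
    rewrite (linear_minus _ (plus p m) (plus p' m') lp).
    rewrite (linear_plus _ lp p m) (linear_plus _ lp p' m') pm pm' pp pp'; lin_ring.
  split; first by rewrite e.
  have -> : q (minus (plus p m) (plus p' m')) = minus m m'.
    by rewrite /compl_proj e; lin_ring.
  exact: hm.
move=> t tab.
have -> : exp (C t - C b + lam * (t - b)) * norm (minus y y') = M * exp (C t + lam * t).
  rewrite /M Rmult_comm Rmult_assoc -exp_plus; congr (_ * exp _); ring.
rewrite -Rmult_assoc.
have cv : filterlim (fun n => minus (picard g a b y n t) (picard g a b y' n t))
    eventually (locally (minus (X t) (Y t))).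
  apply: (@filterlim_comp_2 _ _ _ _ eventually (locally (X t)) (locally (opp (Y t))) _ _
    (fun n => picard g a b y n t) (fun n => opp (picard g a b y' n t)) plus).
  - exact: picard_cv.
  - apply: (filterlim_comp _ _ _ (fun n => picard g a b y' n t) opp).
      exact: picard_cv lg ab sY tab.
    exact: filterlim_opp.
  - exact: filterlim_plus.
split; apply: norm_limit_le (filterlim_comp _ _ _ _ _ _ _ _ cv (linear_cont _ _ _)) _ => //.
- by move=> n; exact: (cone n t tab).1.
- by move=> n; exact: (cone n t tab).2.
Qed.

(** What comparison with the zero trajectory leaves of having started on a
    [kappa]-Lipschitz graph at or before time [a]. *)
Record cone_trajectory (a b : R) X : Prop := ConeTrajectory {
  cone_traj : trajectory a b X ;
  cone_slope : norm (q (X a)) <= kappa * norm (pi (X a)) ;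
  cone_decay : norm (pi (X a)) <= exp (C a - C b + lam * (a - b)) * norm (pi (X b))
}.

Lemma steered_cone g a s t b y X : lipschitz_graph pi kappa g ->
  a <= s -> s <= t -> t <= b -> steered g a b y X -> cone_trajectory s t X.
Proof.
move=> lg as_ st tb sX.
have cone r r' : a <= r' -> r' <= r -> r <= b ->
    norm (pi (X r')) <= exp (C r' - C r + lam * (r' - r)) * norm (pi (X r)) /\
    norm (q (X r')) <= kappa * (exp (C r' - C r + lam * (r' - r)) * norm (pi (X r))).
  move=> ar' r'r rb; have sXr : steered g a r (pi (X r)) X by apply: steered_left sX; lra.
  have ar : a <= r by lra.
  have := steered_cone_diff lg ar (split_pi_idem spl _) pi_0 sXr (steered_0 a r lg) (conj ar' r'r).
  by rewrite !minus_zero_r.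
split.
- apply: (@trajectory_right a); first lra.
  by apply: (@trajectory_left _ _ b); [lra|exact: steered_traj sX].
- have [_] := cone s s ltac:(lra) ltac:(lra) ltac:(lra).
  by rewrite !Rminus_diag Rmult_0_r Rplus_0_r exp_0 Rmult_1_l.
- by have [] := cone t s ltac:(lra) ltac:(lra) ltac:(lra).
Qed.

(** * Comparison of trajectories with the same endpoint *)

(** A weighted bound [K] on the distance, which exists by compactness, improves
    to [ratio * K + d]; iterating leaves the fixed point [d / (1 - ratio)]. *)
Lemma trajectory_stability a b X Y d :
  trajectory a b X -> trajectory a b Y -> a <= b -> pi (X b) = pi (Y b) -> 0 <= d ->
  norm (minus (q (X a)) (q (Y a))) <=
    d * exp (C a + mid * a) + norm (minus (pi (X a)) (pi (Y a))) ->
  forall t, a <= t <= b ->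
    norm (minus (X t) (Y t)) <= d / (1 - ratio) * exp (C t + mid * t).
Proof.
move=> tX tY ab XYb d0 XYa; have [th0 th1] := ratio_bounds.
have [cX cY] := (traj_cont tX, traj_cont tY).
have [|K [K0 hK]] := weighted_bound (X := fun t => minus (X t) (Y t)) ab.
  by move=> t; apply: continuous_minus; [exact: cX|exact: cY].
have dth : 0 <= d / (1 - ratio) by apply: Rdiv_le_0_compat; lra.
have tn n : 0 <= ratio ^ n by apply: pow_le.
have improve n t : a <= t <= b ->
    norm (minus (X t) (Y t)) <= (K * ratio ^ n + d / (1 - ratio)) * exp (C t + mid * t).
  elim: n t => [|n IH] t tab.
    apply: Rle_trans (hK t tab) _; apply: Rmult_le_compat_r; first exact/Rlt_le/exp_pos.
    by rewrite /= Rmult_1_r; lra.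
  have K1 : 0 <= K * ratio ^ n + d / (1 - ratio).
    by have := Rmult_le_pos _ _ K0 (tn n); lra.
  have [|_] := window_contraction (h := q (X a)) (h' := q (Y a)) (y := pi (X b))
    cX cY K1 d0 IH _ tab.
    by rewrite {2}XYb -(traj_plus tX) -?(traj_plus tY) //; lra.
  rewrite {2}XYb -(trajectory_sum tX tab) -(trajectory_sum tY tab).
  move=> /Rle_trans; apply; right; congr (_ * _) => /=; field; lra.
move=> t tab; apply: le_epsilon => e e0.
have [n hn] := ratio_pow_small (K * exp (C t + mid * t)) e0.
by apply: Rle_trans (improve n t tab) _; lra.
Qed.

(** In the cone the initial stable parts are of order [exp (lam (a - b))],
    relative to the endpoint and up to the noise weight, while
    [trajectory_stability] loses only [exp (mid (b - a))]. *)
Lemma cone_stability a b X Y : a <= b ->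
  cone_trajectory a b X -> cone_trajectory a b Y -> pi (X b) = pi (Y b) ->
  norm (minus (X b) (Y b)) <=
    2 / (1 - ratio) * exp ((lam - mid) * (a - b)) * norm (pi (X b)).
Proof.
move=> ab [tX sX dX] [tY sY dY] XYb; have [th0 th1] := ratio_bounds.
have [k0 k1] := gap_kappa gap.
set y := norm (pi (X b)) in dX *.
have y0 : 0 <= y by apply: norm_ge_0.
rewrite -XYb -/y in dY.
pose d := 2 * exp (- C b + lam * (a - b) - mid * a) * y.
have d0 : 0 <= d.
  by apply: Rmult_le_pos => //; apply: Rmult_le_pos; [lra|exact/Rlt_le/exp_pos].
have bb : a <= b <= b by lra.
have := trajectory_stability tX tY ab XYb d0 _ bb.
have -> : d / (1 - ratio) * exp (C b + mid * b) =
    2 / (1 - ratio) * exp ((lam - mid) * (a - b)) * y.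
  rewrite (@exp_split ((lam - mid) * (a - b)) (- C b + lam * (a - b) - mid * a) (C b + mid * b)).
    by rewrite /d; field; lra.
  by ring.
apply; have dE : d * exp (C a + mid * a) = 2 * (exp (C a - C b + lam * (a - b)) * y).
  rewrite (@exp_split (C a - C b + lam * (a - b)) (- C b + lam * (a - b) - mid * a) (C a + mid * a)).
    by rewrite /d; ring.
  by ring.
have kle (r : R) : 0 <= r -> kappa * r <= r.
  by move=> r0; rewrite -[X in _ <= X]Rmult_1_l; apply: Rmult_le_compat_r.
have := norm_minus_le (Rle_trans _ _ _ sX (kle _ (norm_ge_0 _)))
  (Rle_trans _ _ _ sY (kle _ (norm_ge_0 _))).
have := norm_ge_0 (minus (pi (X a)) (pi (Y a))).
by rewrite dE; lra.
Qed.

(** * The graph reached from the infinite past *)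

Definition approach_bound (s : R) : R := 2 / (1 - ratio) * exp ((lam - mid) * s).

(** [G] is the graph formed at time [b] by the trajectories that have stayed in
    the cone for arbitrarily long; this determines [G] on the range of [pi]. *)
Definition limit_graph (b : R) (G : H -> H) : Prop :=
  forall a X, a <= b -> cone_trajectory a b X ->
    norm (minus (G (pi (X b))) (q (X b))) <= approach_bound (a - b) * norm (pi (X b)).

Lemma approach_bound_ge0 s : 0 <= approach_bound s.
Proof.
have [r0 r1] := ratio_bounds.
apply: Rmult_le_pos; last exact/Rlt_le/exp_pos.
by apply: Rdiv_le_0_compat; lra.
Qed.

Lemma approach_bound_small c e : 0 < e ->
  exists a0, forall a, a <= a0 -> approach_bound a * c <= e.
Proof.
move=> e0; have [r0 r1] := ratio_bounds; have lm := gap_mid gap.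
have k0 : 0 < 2 / (1 - ratio) * (Rabs c + 1).
  apply: Rmult_lt_0_compat; last by have := Rabs_pos c; lra.
  by apply: Rdiv_lt_0_compat; lra.
pose k := 2 / (1 - ratio) * (Rabs c + 1).
have ek : 0 < e / k by apply: Rdiv_lt_0_compat.
have lm0 : 0 < lam - mid by rewrite /mid; lra.
exists (Rpower.ln (e / k) / (lam - mid)) => a ha.
have le : exp ((lam - mid) * a) <= e / k.
  rewrite -[X in _ <= X]exp_ln //.
  have : (lam - mid) * a <= Rpower.ln (e / k).
    have -> : Rpower.ln (e / k) = (lam - mid) * (Rpower.ln (e / k) / (lam - mid)) by field; lra.
    by apply: Rmult_le_compat_l; lra.
  by case=> [/exp_increasing|->]; lra.
apply: Rle_trans (_ : approach_bound a * (Rabs c + 1) <= e).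
  by apply: Rmult_le_compat_l; [exact: approach_bound_ge0|have := Rle_abs c; lra].
have -> : approach_bound a * (Rabs c + 1) = k * exp ((lam - mid) * a).
  by rewrite /approach_bound /k; ring.
have -> : e = k * (e / k) by field; rewrite /k; lra.
by apply: Rmult_le_compat_l; [rewrite /k; lra|].
Qed.

Lemma zero_graph : lipschitz_graph pi kappa (fun _ => zero).
Proof.
split=> // [x _|x y _ _]; first exact: pi_0.
rewrite minus_eq_zero norm_zero; apply: Rmult_le_pos (norm_ge_0 _).
by have := (gap_kappa gap).1; lra.
Qed.

Lemma steered_cone_full g a b y X : lipschitz_graph pi kappa g -> a <= b ->
  steered g a b y X -> cone_trajectory a b X.
Proof.
by move=> lg ab sX; apply: (steered_cone lg _ ab _ sX); apply: Rle_refl.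
Qed.

(** Trajectories that start on the zero graph at the times [b - n] have, by
    [cone_stability], endpoints with geometrically decreasing increments. *)
Lemma limit_graph_exists b : exists G, limit_graph b G.
Proof.
have [r0 r1] := ratio_bounds; have lm := gap_mid gap.
have lm0 : 0 < lam - mid by rewrite /mid; lra.
suff pt y : exists l, forall a X, a <= b -> cone_trajectory a b X -> pi (X b) = y ->
    norm (minus l (q (X b))) <= approach_bound (a - b) * norm y.
  have [G hG] := choice pt.
  by exists G => a X ab cX; apply: hG.
have [yp|yn] := EM (pi y = y); last first.
  by exists zero => a X ab _ Xy; case: yn; rewrite -Xy (split_pi_idem spl).
have bn n : b - INR n <= b by have := pos_INR n; lra.
have [X sX] := choice (fun n => steered_exists zero_graph (bn n) yp).
have eX n : pi (X n b) = y := steered_end (sX n).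
have close n a Y : a <= b -> b - INR n <= a -> cone_trajectory a b Y -> pi (Y b) = y ->
    norm (minus (q (X n b)) (q (Y b))) <= approach_bound (a - b) * norm y.
  move=> ab na cY Yy.
  have cX : cone_trajectory a b (X n).
    exact: (steered_cone zero_graph na ab (Rle_refl b) (sX n)).
  have := cone_stability ab cX cY; rewrite eX Yy => /(_ erefl).
  rewrite -compl_minus; apply: Rle_trans.
  exact: norm_compl_le.
pose e := exp (- (lam - mid)).
have e01 : 0 <= e < 1.
  split; first exact/Rlt_le/exp_pos.
  by rewrite /e -exp_0; apply: exp_increasing; lra.
have epow n : exp ((lam - mid) * (b - INR n - b)) = e ^ n.
  elim: n => [|n IH]; first by rewrite /= Rminus_0_r Rminus_diag Rmult_0_r exp_0.
  rewrite S_INR /= -IH /e -exp_plus; congr exp; ring.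
have inc n : norm (minus (q (X n.+1 b)) (q (X n b))) <=
    2 / (1 - ratio) * norm y * e ^ n.
  apply: Rle_trans (close n.+1 (b - INR n) (X n) (bn n) _ _ (eX n)) _.
  - by rewrite S_INR; lra.
  - exact: steered_cone_full zero_graph (bn n) (sX n).
  - by rewrite /approach_bound epow; right; ring.
have [l [hl' rate]] := geometric_limit e01 inc.
exists l => a Y ab cY Yy; apply: le_epsilon => d d0.
have [n0 hn0] := (filterlim_locally_ball_norm _ l).1 hl' (mkposreal _ d0).
have [n1 hn1] := INR_unbounded (b - a).
pose n := (n0 + n1)%coq_nat.
have h1 : norm (minus (q (X n b)) l) < d := hn0 n (Nat.le_add_r _ _).
have h2 := close n a Y ab _ cY Yy.
have h3 := norm_minus_triangle (q (X n b)) l (q (Y b)).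
rewrite (norm_minusC l (q (X n b))) in h3.
have : b - INR n <= a by rewrite /n plus_INR; have := pos_INR n0; lra.
by move=> /h2; lra.
Qed.

Lemma limit_graph_unique b G G' y : limit_graph b G -> limit_graph b G' ->
  pi y = y -> G y = G' y.
Proof.
move=> lG lG' yp; apply: norm_minus_eq0 => e e0.
have e2 : 0 < e / 2 by lra.
have [a0 ha0] := approach_bound_small (norm y) e2.
pose a := Rmin a0 0 + b.
have ab : a <= b by have := Rmin_r a0 0; rewrite /a; lra.
have [X sX] := steered_exists zero_graph ab yp.
have cX := steered_cone_full zero_graph ab sX.
have := lG a X ab cX; have := lG' a X ab cX; rewrite (steered_end sX) => h1 h2.
have := ha0 (a - b) ltac:(rewrite /a; have := Rmin_l a0 0; lra).
have := norm_minus_triangle (q (X b)) (G y) (G' y).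
by rewrite (norm_minusC (q (X b)) (G' y)); lra.
Qed.

Lemma limit_graph_lipschitz b G : limit_graph b G -> lipschitz_graph pi kappa G.
Proof.
move=> lG.
have near y e : pi y = y -> 0 < e -> exists a0, forall a, a <= a0 ->
    a <= b /\ forall X, steered (fun _ => zero) a b y X -> norm (minus (G y) (q (X b))) <= e.
  move=> yp e0; have [a0 ha0] := approach_bound_small (norm y) e0.
  exists (Rmin a0 0 + b) => a aa0; have := Rmin_l a0 0; have := Rmin_r a0 0 => h1 h2.
  have ab : a <= b by lra.
  split=> // X sX; have := lG a X ab (steered_cone_full zero_graph ab sX).
  by rewrite (steered_end sX) => /Rle_trans; apply; apply: ha0; lra.
split.
- move=> y yp; apply: norm_minus_eq0 => e e0; rewrite minus_zero_r.
  have [a ha] := near y e yp e0; have {ha}[ab ha] := ha a (Rle_refl a).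
  have [X sX] := steered_exists zero_graph ab yp.
  have -> : pi (G y) = pi (minus (G y) (q (X b))).
    by rewrite pi_minus pi_compl minus_zero_r.
  exact: Rle_trans (norm_pi_le _) (ha X sX).
- have := lG b (fun _ => zero) (Rle_refl b)
    (steered_cone_full zero_graph (Rle_refl b) (steered_0 b b zero_graph)).
  rewrite pi_0 norm_zero Rmult_0_r (linear_zero _ compl_linear) minus_zero_r => h.
  by apply: norm_eq_zero; apply: Rle_antisym h (norm_ge_0 _).
- move=> x y xp yp; apply: le_epsilon => e e0; have e2 : 0 < e / 2 by lra.
  have [a1 h1] := near x (e / 2) xp e2; have [a2 h2] := near y (e / 2) yp e2.
  have [ab {}h1] := h1 (Rmin a1 a2) (Rmin_l _ _).
  have [_ {}h2] := h2 (Rmin a1 a2) (Rmin_r _ _).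
  have [X sX] := steered_exists zero_graph ab xp.
  have [Y sY] := steered_exists zero_graph ab yp.
  have [_] := steered_cone_diff zero_graph ab xp yp sX sY (conj ab (Rle_refl b)).
  rewrite !Rminus_diag Rmult_0_r Rplus_0_r exp_0 Rmult_1_l.
  rewrite compl_minus => h3.
  have := h1 X sX; have := h2 Y sY.
  have := norm_minus_triangle (q (X b)) (G x) (G y).
  have := norm_minus_triangle (q (Y b)) (q (X b)) (G y).
  by rewrite (norm_minusC (q (Y b)) (G y)); lra.
Qed.

(** A trajectory that starts on the limit graph at time [a] is shadowed by
    trajectories [Z] that come from the distant past [c]: at [a] these are close
    to the limit graph, hence to [X] up to the difference of the unstable parts,
    which [trajectory_stability] tolerates. *)
Lemma limit_graph_invariant a b Ga Gb y X :
  limit_graph a Ga -> limit_graph b Gb -> a <= b -> pi y = y ->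
  steered Ga a b y X -> q (X b) = Gb y.
Proof.
move=> lGa lGb ab yp sX; have [r0 r1] := ratio_bounds.
have lipGa := limit_graph_lipschitz lGa.
apply: norm_minus_eq0 => e e0.
pose w := exp (C a - C b + lam * (a - b)) * norm y.
have w0 : 0 <= w by apply: Rmult_le_pos; [exact/Rlt_le/exp_pos|exact: norm_ge_0].
pose s := exp (- (C a + mid * a)) * / (1 - ratio) * exp (C b + mid * b).
have s0 : 0 < s.
  apply: Rmult_lt_0_compat; last exact: exp_pos.
  by apply: Rmult_lt_0_compat; [exact: exp_pos|apply: Rinv_0_lt_compat; lra].
have e2 : 0 < e / 2 by lra.
have es : 0 < e / 2 / s by apply: Rdiv_lt_0_compat.
have [a1 h1] := approach_bound_small (norm y) e2.
have [a2 h2] := approach_bound_small w es.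
pose c := Rmin 0 (Rmin a1 a2) + a.
have [c0 c1] : c - a <= 0 /\ c - a <= Rmin a1 a2.
  by have := Rmin_l 0 (Rmin a1 a2); have := Rmin_r 0 (Rmin a1 a2); rewrite /c; lra.
have [c2 c3] := (Rle_trans _ _ _ c1 (Rmin_l _ _), Rle_trans _ _ _ c1 (Rmin_r _ _)).
have cb : c <= b by lra.
have ca : c <= a by lra.
have [Z sZ] := steered_exists zero_graph cb yp.
have cZ := steered_cone_full zero_graph cb sZ.
have cZa : cone_trajectory c a Z := steered_cone zero_graph (Rle_refl c) ca ab sZ.
have cZb : cone_trajectory a b Z := steered_cone zero_graph ca ab (Rle_refl b) sZ.
have nb := lGb c Z cb cZ; rewrite (steered_end sZ) in nb.
have na := lGa c Z ca cZa.
have Zaw : norm (pi (Z a)) <= w by have := cone_decay cZb; rewrite (steered_end sZ).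
pose d := approach_bound (c - a) * w * exp (- (C a + mid * a)).
have d0 : 0 <= d.
  apply: Rmult_le_pos; last exact/Rlt_le/exp_pos.
  by apply: Rmult_le_pos => //; apply: approach_bound_ge0.
have bb : a <= b <= b by lra.
have XZ := trajectory_stability (steered_traj sX) (cone_traj cZb) ab _ d0 _ bb.
have {}XZ : norm (minus (X b) (Z b)) <= d / (1 - ratio) * exp (C b + mid * b).
  apply: XZ; first by rewrite (steered_end sX) (steered_end sZ).
  have -> : d * exp (C a + mid * a) = approach_bound (c - a) * w.
    by rewrite /d Rmult_assoc -exp_plus Rplus_opp_l exp_0 Rmult_1_r.
  rewrite (steered_start sX).
  apply: Rle_trans (norm_minus_triangle (Ga (pi (Z a))) _ _) _; rewrite Rplus_comm.
  apply: Rplus_le_compat.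
    by apply: Rle_trans na _; apply: Rmult_le_compat_l => //; apply: approach_bound_ge0.
  apply: Rle_trans (graph_lip lipGa (split_pi_idem spl _) (split_pi_idem spl _)) _.
  rewrite -[X in _ <= X]Rmult_1_l; apply: Rmult_le_compat_r; first exact: norm_ge_0.
  exact: (gap_kappa gap).2.
have ds : d / (1 - ratio) * exp (C b + mid * b) <= e / 2.
  have -> : d / (1 - ratio) * exp (C b + mid * b) = approach_bound (c - a) * w * s.
    by rewrite /d /s /Rdiv; ring.
  have -> : e / 2 = e / 2 / s * s by field; lra.
  by apply: Rmult_le_compat_r; [lra|exact: h2].
have qXZ : norm (minus (q (X b)) (q (Z b))) <= e / 2.
  rewrite -compl_minus.
  by apply: Rle_trans (norm_compl_le _) _; lra.
have := h1 (c - b) ltac:(lra).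
have := norm_minus_triangle (q (Z b)) (q (X b)) (Gb y).
by rewrite (norm_minusC (q (Z b)) (Gb y)); lra.
Qed.

End Window.

Arguments plus_kernel {H} Up C N X t r.
Arguments minus_kernel {H} Um C N X t r.
Arguments plus_part {H} Up C N b y X t.
Arguments minus_part {H} Um C N a h X t.
Arguments trajectory {H} pi Up Um C N a b X.
Arguments cone_trajectory {H} pi Up Um C N kappa lam a b X.
Arguments steered {H} pi Up Um C N g a b y X.
Arguments picard {H} Up Um C N g a b y n.
Arguments limit_graph {H} pi Up Um C N hl cl L kappa lam b G.

(** * Translation in time *)

(** Replacing the path by its translate shifts the forcing, and shifts the
    weight up to the additive constant [k], which cancels in all the kernels. *)
Section Translation.
Context {H : CompleteNormedModule R_AbsRing}.
Context (pi : H -> H) {Up Um : R -> H -> H} {C : R -> R} {N : R -> H -> H}.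
Context {hl cl L kappa lam : R}.
Hypothesis spl : splitting pi Up Um hl cl.
Hypothesis frc : forcing pi N L.
Hypothesis cC : forall t, Continuity.continuous C t.
Variables (s k : R) (C' : R -> R) (N' : R -> H -> H).
Hypothesis C'E : forall t, C' t = C (t + s) - k.
Hypothesis N'E : forall t x, N' t x = N (t + s) x.

Lemma RInt_translate (f : R -> H) a b : (forall t, Continuity.continuous f t) ->
  RInt (fun t => f (t + s)) a b = RInt f (a + s) (b + s).
Proof.
move=> cf; have := RInt_comp_lin f 1 s a b; rewrite !Rmult_1_l => <-.
  by apply: RInt_ext => t _; rewrite Rmult_1_l (@scal_one R_Ring).
exact: ex_RInt_cont.
Qed.

Lemma cone_trajectory_translate a b X : path X ->
  cone_trajectory pi Up Um C' N' kappa lam a b (fun t => X (t + s)) ->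
  cone_trajectory pi Up Um C N kappa lam (a + s) (b + s) X.
Proof.
move=> cX [[_ hp hm] sl dc].
have dC t r : C' t - C' r = C (t + s) - C (r + s) by rewrite !C'E; ring.
have kp t r : plus_kernel Up C' N' (fun t => X (t + s)) t r =
    plus_kernel Up C N X (t + s) (r + s).
  rewrite /plus_kernel dC N'E; congr (scal _ (Up _ _)); ring.
have km t r : minus_kernel Um C' N' (fun t => X (t + s)) t r =
    minus_kernel Um C N X (t + s) (r + s).
  rewrite /minus_kernel dC N'E; congr (scal _ (Um _ _)); ring.
have tE t : t - s + s = t by ring.
split=> //; last first.
  by rewrite dC in dc; have -> : a + s - (b + s) = a - b by ring.
split=> // t tab.
- have := hp (t - s) ltac:(lra); rewrite tE => ->.
  rewrite /plus_part dC tE; congr minus.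
    by congr (scal _ (Up _ _)); ring.
  rewrite (RInt_ext _ (fun r => plus_kernel Up C N X t (r + s))).
    rewrite RInt_translate ?tE // => r.
    by apply: (plus_kernel_cont1 spl frc cC).
  by move=> r _; rewrite kp tE.
- have := hm (t - s) ltac:(lra); rewrite tE => ->.
  rewrite /minus_part dC tE; congr plus.
    by congr (scal _ (Um _ _)); ring.
  rewrite (RInt_ext _ (fun r => minus_kernel Um C N X t (r + s))).
    rewrite RInt_translate ?tE // => r.
    by apply: (minus_kernel_cont1 spl frc cC).
  by move=> r _; rewrite km tE.
Qed.

Lemma limit_graph_translate G b :
  limit_graph pi Up Um C N hl cl L kappa lam (b + s) G ->
  limit_graph pi Up Um C' N' hl cl L kappa lam b G.
Proof.
move=> lG a X ab cX.
have cX1 := traj_cont (cone_traj cX).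
pose Y t := X (t - s).
have cY : path Y.
  move=> t; apply: (Continuity.continuous_comp (fun t => t - s) X); last exact: cX1.
  apply: (continuous_minus (V := R_NormedModule) (fun t => t) (fun _ => s)).
    exact: continuous_id.
  exact: continuous_const.
have YE t : Y (t + s) = X t by rewrite /Y; congr X; ring.
have cX' := cone_trajectory_translate (a := a) (b := b) cY.
have {}cX' := cX' ltac:(by have -> : (fun t => Y (t + s)) = X by apply: funext).
by have := lG (a + s) Y ltac:(lra) cX'; rewrite !YE;
  have -> : a + s - (b + s) = a - b by ring.
Qed.
End Translation.

(** * The two evolutions of a semigroup with exponential dichotomy *)

Lemma Hplus_fixed {H : CompleteNormedModule R_AbsRing} (pi : H -> H) :
  (forall x, pi (pi x) = pi x) -> forall x, Hplus pi x <-> pi x = x.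
Proof.
move=> idem x; split=> [[y _ <-]|<-]; first exact: idem.
by exists x.
Qed.

Section Semigroup.
Context {H : CompleteNormedModule R_AbsRing}.
Context (S : R -> H -> H) (pi : H -> H) {hl cl : R}.
Hypothesis hS : strongly_continuous_semigroup S.
Hypothesis hd : dichotomy S pi hl cl.

Local Notation q := (compl_proj pi).

Definition plus_group (s : R) (x : H) : H := S s (pi x).

(** Negative times are clamped, since [S s] means nothing there on the range of [q]. *)
Definition minus_semigroup (s : R) (x : H) : H := q (S (Rmax 0 s) (q x)).

Lemma HplusP x : Hplus pi x <-> pi x = x.
Proof. exact: Hplus_fixed (dich_pi_proj hd) x. Qed.

Lemma HminusP x : Hminus pi x <-> pi x = zero.
Proof.
have lp := dich_pi_linear hd; split=> [[y _ <-]|px0].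
  by rewrite /compl_proj (linear_minus _ _ _ lp) (dich_pi_proj hd) minus_eq_zero.
by exists x => //; rewrite /compl_proj px0 minus_zero_r.
Qed.

Lemma q_linear : is_linear q.
Proof. exact: compl_proj_linear (dich_pi_linear hd). Qed.

Lemma pi_plus_group s x : pi (plus_group s x) = plus_group s x.
Proof.
rewrite /plus_group; have [s0|s0] := Rle_lt_dec 0 s.
  by rewrite (dich_comm hd) // (dich_pi_proj hd).
have Hx : Hplus pi (pi x) by apply/HplusP; apply: dich_pi_proj hd _.
have [Hs _ _] := dich_inv hd (t := - s) ltac:(lra) Hx.
by apply/HplusP; rewrite Ropp_involutive in Hs.
Qed.

(** Large positive times turn every product of operators on the range of [pi]
    into one power of the semigroup. *)
Lemma semigroup_plus_group n s x : 0 <= n -> 0 <= n + s ->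
  S n (plus_group s x) = S (n + s) (pi x).
Proof.
move=> n0 ns; rewrite /plus_group; have [s0|s0] := Rle_lt_dec 0 s.
  by rewrite -(semigroup_add hS).
have Hx : Hplus pi (pi x) by apply/HplusP; apply: dich_pi_proj hd _.
have [_ inv _] := dich_inv hd (t := - s) ltac:(lra) Hx.
rewrite Ropp_involutive in inv.
have {1}-> : n = n + s + - s by ring.
by rewrite (semigroup_add hS) ?inv //; lra.
Qed.

Lemma semigroup_inj_plus n x y : 0 <= n -> pi x = x -> pi y = y -> S n x = S n y -> x = y.
Proof.
move=> n0 /HplusP Hx /HplusP Hy e.
have [_ _ ex] := dich_inv hd n0 Hx; have [_ _ ey] := dich_inv hd n0 Hy.
by rewrite -ex e ey.
Qed.

Lemma plus_group_add s t x : plus_group (s + t) x = plus_group s (plus_group t x).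
Proof.
pose n := Rabs s + Rabs t.
have [hs ht] : - s <= Rabs s /\ - t <= Rabs t.
  by split; [have := Rle_abs (- s)|have := Rle_abs (- t)]; rewrite Rabs_Ropp.
have [s0 t0] := (Rabs_pos s, Rabs_pos t).
have n0 : 0 <= n by rewrite /n; lra.
apply: (semigroup_inj_plus (n := n)) => //; try exact: pi_plus_group.
rewrite semigroup_plus_group; [|done|rewrite /n; lra].
rewrite semigroup_plus_group; [|done|rewrite /n; lra].
rewrite pi_plus_group semigroup_plus_group; [|rewrite /n; lra|rewrite /n; lra].
by congr S; ring.
Qed.

Lemma plus_group0 x : plus_group 0 x = pi x.
Proof. exact: semigroup_0 hS _. Qed.

Lemma plus_group_le s x : s <= 0 -> norm (plus_group s x) <= exp (hl * s) * norm x.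
Proof. by move=> s0; rewrite -pi_plus_group; apply: (dich_plus hd). Qed.

Lemma plus_group_linear s : is_linear (plus_group s).
Proof.
have lp := dich_pi_linear hd.
have [s0|s0] := Rle_lt_dec 0 s.
  exact: is_linear_comp lp (semigroup_linear hS s0).
have ns : 0 <= - s by lra.
have lS := semigroup_linear hS ns.
have inv x : S (- s) (plus_group s x) = pi x.
  by rewrite semigroup_plus_group ?Rplus_opp_l ?(semigroup_0 hS) //; lra.
split.
- move=> x y; apply: (semigroup_inj_plus ns); rewrite ?pi_plus_group //.
    by rewrite (linear_plus _ lp) !pi_plus_group.
  by rewrite (linear_plus _ lS) !inv (linear_plus _ lp).
- move=> k x; apply: (semigroup_inj_plus ns); rewrite ?pi_plus_group //.
    by rewrite (linear_scal _ lp) !pi_plus_group.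
  by rewrite (linear_scal _ lS) !inv (linear_scal _ lp).
- exists (exp (hl * s)); split=> [|x]; first exact: exp_pos.
  by apply: plus_group_le; lra.
Qed.

Lemma semigroup_right_cont x e : 0 < e ->
  exists d, 0 < d /\ forall t, 0 <= t < d -> norm (minus (S t x) x) < e.
Proof.
move=> e0.
have cS : filterlim (fun t => S t x) (at_right 0) (locally x) by exact: (@semigroup_cont _ _ hS x).
have [d hd'] := (filterlim_locally_ball_norm (fun t => S t x) x).1 cS (mkposreal _ e0).
exists d; split=> [|t [t0 td]]; first exact: cond_pos.
have [t1|<-] := t0; last by rewrite (semigroup_0 hS) minus_eq_zero norm_zero.
apply: (hd' t) => //; rewrite /ball /= /AbsRing_ball /abs /minus /plus /opp /=.
by rewrite Ropp_0 Rplus_0_r Rabs_pos_eq.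
Qed.

Lemma exp_le_exp a b : a <= b -> exp a <= exp b.
Proof. by case=> [/exp_increasing|->]; lra. Qed.

Lemma mult_le_abs k s m : Rabs s <= m -> k * s <= Rabs k * m.
Proof.
move=> sm; apply: Rle_trans (Rle_abs _) _; rewrite Rabs_mult.
by apply: Rmult_le_compat_l => //; apply: Rabs_pos.
Qed.

(** Continuity from the left is reduced to continuity from the right at time 0
    by factoring out [plus_group (s - s0)], which is bounded. *)
Lemma plus_group_strong_cont s0 x e : 0 < e ->
  exists d, 0 < d /\ forall s, Rabs (s - s0) < d ->
    norm (minus (plus_group s x) (plus_group s0 x)) < e.
Proof.
move=> e0; set y := plus_group s0 x.
have py : pi y = y by apply: pi_plus_group.
have k0 := exp_pos (Rabs hl * 1).
have [d [d0 hd']] := semigroup_right_cont y (Rdiv_lt_0_compat _ _ e0 k0).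
exists (Rmin d 1); split=> [|s sd]; first by apply: Rmin_glb_lt; lra.
have [sd1 sd2] := (Rlt_le_trans _ _ _ sd (Rmin_l d 1), Rlt_le_trans _ _ _ sd (Rmin_r d 1)).
have k1 : 1 <= exp (Rabs hl * 1).
  by rewrite -{1}exp_0; apply: exp_le_exp; have := Rabs_pos hl; lra.
have eE : exp (Rabs hl * 1) * (e / exp (Rabs hl * 1)) = e by field; lra.
have [ss|ss] := Rle_lt_dec s0 s.
  have -> : plus_group s x = S (s - s0) y.
    rewrite -{1}py -/(plus_group (s - s0) y) /y -plus_group_add; congr plus_group; ring.
  have h : norm (minus (S (s - s0) y) y) < e / exp (Rabs hl * 1).
    by apply: hd'; rewrite Rabs_pos_eq in sd1; lra.
  apply: Rlt_le_trans h _; rewrite -{2}eE -[X in X <= _]Rmult_1_l.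
  by apply: Rmult_le_compat_r => //; apply/Rlt_le/Rdiv_lt_0_compat.
have -> : minus (plus_group s x) y = opp (plus_group (s - s0) (minus (S (s0 - s) y) y)).
  rewrite (linear_minus _ _ _ (plus_group_linear _)) opp_minus; congr minus.
    rewrite /y -plus_group_add; congr plus_group; ring.
  have -> : S (s0 - s) y = plus_group (s0 - s) y by rewrite /plus_group py.
  rewrite -plus_group_add.
  have -> : s - s0 + (s0 - s) = 0 by ring.
  by rewrite plus_group0.
rewrite norm_opp; apply: Rle_lt_trans (plus_group_le _ _) _; first lra.
have h : norm (minus (S (s0 - s) y) y) < e / exp (Rabs hl * 1).
  by apply: hd'; rewrite Rabs_left in sd1; lra.
apply: (Rle_lt_trans _ (exp (Rabs hl * 1) * norm (minus (S (s0 - s) y) y))).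
  apply: Rmult_le_compat_r (norm_ge_0 _) _; apply: exp_le_exp.
  by apply: mult_le_abs; lra.
by rewrite -[X in _ < X]eE; apply: Rmult_lt_compat_l.
Qed.

(** Strong continuity and a local bound on the norms give joint continuity. *)
Lemma joint_continuity (U : R -> H -> H) s0 x0 M :
  (forall s, is_linear (U s)) ->
  (forall s x, Rabs (s - s0) < 1 -> norm (U s x) <= M * norm x) ->
  (forall x e, 0 < e -> exists d, 0 < d /\ forall s, Rabs (s - s0) < d ->
    norm (minus (U s x) (U s0 x)) < e) ->
  Continuity.continuous (fun p : R * H => U p.1 p.2) (s0, x0).
Proof.
move=> lU UM cU; apply/filterlim_locally_ball_norm => e.
have e2 := is_pos_div_2 e.
have [d [d0 hd']] := cU x0 _ e2.
have M1 : 0 < Rabs M + 1 by have := Rabs_pos M; lra.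
have eM : 0 < e / 2 / (Rabs M + 1) by apply: Rdiv_lt_0_compat.
have d1 : 0 < Rmin d 1 by apply: Rmin_glb_lt; lra.
have [d2 hd2] : locally x0 (fun x => norm (minus x x0) < e / 2 / (Rabs M + 1)).
  by apply/locally_le_locally_norm; exists (mkposreal _ eM).
have d3 : 0 < Rmin (Rmin d 1) d2 by apply: Rmin_glb_lt => //; apply: cond_pos.
exists (mkposreal _ d3) => -[s x] [bs bx]; rewrite /ball_norm /=.
have sd : Rabs (s - s0) < Rmin d 1 := Rlt_le_trans _ _ _ bs (Rmin_l _ _).
have xd := hd2 x (ball_le _ _ _ (Rmin_r _ _) _ bx).
have sd1 := Rlt_le_trans _ _ _ sd (Rmin_l _ _).
have sd2 := Rlt_le_trans _ _ _ sd (Rmin_r _ _).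
apply: Rle_lt_trans (norm_minus_triangle (U s x0) _ _) _.
have h1 := hd' s sd1.
have h2 : norm (minus (U s x) (U s x0)) <= e / 2.
  rewrite -(linear_minus _ _ _ (lU s)); apply: Rle_trans (UM _ _ sd2) _.
  have -> : e / 2 = (Rabs M + 1) * (e / 2 / (Rabs M + 1)) by field; lra.
  apply: Rle_trans (_ : (Rabs M + 1) * norm (minus x x0) <= _).
    by apply: Rmult_le_compat_r (norm_ge_0 _) _; have := Rle_abs M; lra.
  by apply: Rmult_le_compat_l; lra.
have -> : pos e = e / 2 + e / 2 by field.
by apply: Rplus_le_lt_compat.
Qed.

Lemma plus_group_cont s x :
  Continuity.continuous (fun p : R * H => plus_group p.1 p.2) (s, x).
Proof.
have [M [M0 hM]] := linear_norm _ (plus_group_linear (s + 1)).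
apply: (joint_continuity (M := exp (Rabs hl * 2) * M)); first exact: plus_group_linear.
  move=> t y /Rabs_def2[ts1 ts2].
  have -> : t = t - (s + 1) + (s + 1) by ring.
  rewrite plus_group_add Rmult_assoc.
  apply: Rle_trans (plus_group_le _ _) _; first lra.
  apply: Rle_trans (Rmult_le_compat_l _ _ _ (Rlt_le _ _ (exp_pos _)) (hM y)) _.
  apply: Rmult_le_compat_r; first by apply: Rmult_le_pos; [lra|exact: norm_ge_0].
  by apply: exp_le_exp; apply: mult_le_abs; apply: Rabs_le; lra.
by move=> y e e0; apply: plus_group_strong_cont.
Qed.

Lemma semigroup_compl t x : 0 <= t -> q (S t x) = S t (q x).
Proof.
by move=> t0; rewrite /compl_proj (dich_comm hd) // (linear_minus _ _ _ (semigroup_linear hS t0)).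
Qed.

Lemma compl_idem x : q (q x) = q x.
Proof.
rewrite {1}/compl_proj (_ : pi (q x) = zero) ?minus_zero_r //.
by apply/HminusP; exists x.
Qed.

Lemma minus_semigroupE s x : 0 <= s -> minus_semigroup s x = q (S s (q x)).
Proof. by move=> s0; rewrite /minus_semigroup Rmax_right. Qed.

Lemma minus_semigroup_add s t x : 0 <= s -> 0 <= t ->
  minus_semigroup (s + t) x = minus_semigroup s (minus_semigroup t x).
Proof.
move=> s0 t0; rewrite !minus_semigroupE //; last lra.
by rewrite compl_idem (semigroup_compl _ t0) compl_idem -(semigroup_add hS).
Qed.

Lemma minus_semigroup0 x : minus_semigroup 0 x = q x.
Proof. by rewrite minus_semigroupE ?(semigroup_0 hS) ?compl_idem //; lra. Qed.

Lemma minus_semigroup_linear s : is_linear (minus_semigroup s).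
Proof.
apply: (is_linear_comp (fun x => S (Rmax 0 s) (q x)) q); last exact: q_linear.
apply: is_linear_comp q_linear _.
by apply: (semigroup_linear hS); apply: Rmax_l.
Qed.

Lemma minus_semigroup_le s x : 0 <= s -> norm (minus_semigroup s x) <= exp (cl * s) * norm x.
Proof. by move=> s0; rewrite minus_semigroupE //; apply: (dich_minus hd). Qed.

Lemma minus_semigroup_clamp s x : minus_semigroup s x = minus_semigroup (Rmax 0 s) x.
Proof. by rewrite /minus_semigroup (Rmax_right 0 (Rmax 0 s)) //; apply: Rmax_l. Qed.

Lemma norm_q_le x : norm (q x) <= norm x.
Proof.
have := minus_semigroup_le x (Rle_refl 0).
by rewrite minus_semigroup0 Rmult_0_r exp_0 Rmult_1_l.
Qed.

Lemma minus_semigroup_strong_cont s0 x e : 0 < e ->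
  exists d, 0 < d /\ forall s, Rabs (s - s0) < d ->
    norm (minus (minus_semigroup s x) (minus_semigroup s0 x)) < e.
Proof.
move=> e0; pose m := Rabs s0 + 1; pose k := exp (Rabs cl * m).
have k0 : 0 < k := exp_pos _.
have [d [d0 hd']] := semigroup_right_cont (q x) (Rdiv_lt_0_compat _ _ e0 k0).
have key s t : 0 <= s -> s <= m -> 0 <= t < d ->
    norm (minus (minus_semigroup (s + t) x) (minus_semigroup s x)) < e.
  move=> sp sm [t0 td].
  have -> : minus_semigroup s x = minus_semigroup s (q x).
    by rewrite /minus_semigroup compl_idem.
  rewrite minus_semigroup_add // -(linear_minus _ _ _ (minus_semigroup_linear s)).
  apply: Rle_lt_trans (minus_semigroup_le _ sp) _.
  have h : norm (minus (minus_semigroup t x) (q x)) < e / k.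
    rewrite minus_semigroupE // -{2}(compl_idem x) -(linear_minus _ _ _ q_linear).
    by apply: Rle_lt_trans (norm_q_le _) (hd' t (conj t0 td)).
  apply: (Rle_lt_trans _ (k * norm (minus (minus_semigroup t x) (q x)))).
    apply: Rmult_le_compat_r (norm_ge_0 _) _; apply: exp_le_exp.
    by apply: mult_le_abs; rewrite Rabs_pos_eq.
  have -> : e = k * (e / k) by field; lra.
  exact: Rmult_lt_compat_l.
exists (Rmin d 1); split=> [|s sd]; first by apply: Rmin_glb_lt; lra.
have [sd1 sd2] := (Rlt_le_trans _ _ _ sd (Rmin_l d 1), Rlt_le_trans _ _ _ sd (Rmin_r d 1)).
rewrite (minus_semigroup_clamp s) (minus_semigroup_clamp s0).
have [a1 a2] := Rabs_def2 _ _ sd1; have [b1 b2] := Rabs_def2 _ _ sd2.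
have h0 := Rle_abs s0; have h1 := Rabs_pos s0.
have [ss|ss] := Rle_lt_dec (Rmax 0 s0) (Rmax 0 s).
  have -> : Rmax 0 s = Rmax 0 s0 + (Rmax 0 s - Rmax 0 s0) by ring.
  by apply: key; move: ss; rewrite /Rmax /m; do ! case: Rle_dec; lra.
rewrite norm_minusC.
have -> : Rmax 0 s0 = Rmax 0 s + (Rmax 0 s0 - Rmax 0 s) by ring.
by apply: key; move: ss; rewrite /Rmax /m; do ! case: Rle_dec; lra.
Qed.

Lemma minus_semigroup_cont s x :
  Continuity.continuous (fun p : R * H => minus_semigroup p.1 p.2) (s, x).
Proof.
apply: (joint_continuity (M := exp (Rabs cl * (Rabs s + 1)))).
- exact: minus_semigroup_linear.
- move=> t y /Rabs_def2[ts1 ts2]; rewrite minus_semigroup_clamp.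
  apply: Rle_trans (minus_semigroup_le _ (Rmax_l _ _)) _.
  apply: Rmult_le_compat_r (norm_ge_0 _) _; apply: exp_le_exp; apply: mult_le_abs.
  rewrite Rabs_pos_eq; last exact: Rmax_l.
  by have := Rle_abs s; have := Rabs_pos s; rewrite /Rmax; case: Rle_dec; lra.
- by move=> y e e0; apply: minus_semigroup_strong_cont.
Qed.

Lemma dichotomy_splitting : splitting pi plus_group minus_semigroup hl cl.
Proof.
split.
- exact: dich_pi_linear hd.
- exact: dich_pi_proj hd.
- exact: plus_group_linear.
- exact: plus_group_add.
- exact: plus_group0.
- exact: plus_group_cont.
- exact: plus_group_le.
- exact: minus_semigroup_linear.
- exact: minus_semigroup_add.
- exact: minus_semigroup0.
- exact: minus_semigroup_cont.
- exact: minus_semigroup_le.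
Qed.

End Semigroup.

(** * The gap matrix *)

(** The eigenvector equation is [L e^2 - (hl - cl - 2 L) e + L = 0], whose two
    roots have product 1: [kappa], the inverse of the larger root, is the
    smaller one, and the eigenvalue [cl + L + L e] of the larger root lies above
    the mean of [hl] and [cl]. *)
Lemma state_space_gap (hl cl L kappa : R) :
  state_space_constant hl cl L kappa -> 0 < L -> 4 * L < hl - cl ->
  exists lam, gap_constants hl cl L kappa lam.
Proof.
move=> [lp [lm [ep [em [/RltP ll [/RltP ep0 /RltP em0] eqp eqm ->]]]]] L0 gap.
have {}ep0 : 0 < ep := ep0.
have {}em0 : 0 < em := em0.
have rows e l : (gap_matrix hl cl L *m col_e1 e)%R = (l *: col_e1 e)%R ->
    (hl - L) * e - L = l * e /\ L * e + (cl + L) = l.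
  rewrite /gap_matrix /col_e1 mul_block_col scale_col_mx => /eq_col_mx[e1 e2].
  have f1 := congr1 (fun M => fun_of_matrix M ord0 ord0) e1.
  have f2 := congr1 (fun M => fun_of_matrix M ord0 ord0) e2.
  move: f1 f2; rewrite -!scalar_mxM !mxE !GRing.mulr1n /=.
  rewrite /GRing.mul /GRing.add /GRing.opp /GRing.one /=; move=> f1 f2; split.
    by rewrite -f1; ring.
  by have := f2; rewrite !Rmult_1_r.
have [p1 p2] := rows _ _ eqp; have [m1 m2] := rows _ _ eqm.
have em_lt : em < ep by apply: (Rmult_lt_reg_l L) => //; lra.
have quad e l : (hl - L) * e - L = l * e -> L * e + (cl + L) = l ->
    L * (e * e) = (hl - cl - 2 * L) * e - L by move=> h e'; rewrite -e' in h; lra.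
have qp := quad _ _ p1 p2; have qm := quad _ _ m1 m2.
have sum : L * (ep + em) = hl - cl - 2 * L.
  apply: (Rmult_eq_reg_r (ep - em)); last lra.
  by have : L * (ep * ep) - L * (em * em) = (hl - cl - 2 * L) * (ep - em); lra.
have prod : ep * em = 1.
  apply: (Rmult_eq_reg_l L); last lra.
  have : (hl - cl - 2 * L) * ep = L * (ep + em) * ep by rewrite sum.
  by lra.
have ep1 : 1 < ep.
  apply: Rnot_le_lt => h.
  by have := Rmult_le_compat_r em _ _ (Rlt_le _ _ em0) h; rewrite prod; lra.
have inv : / ep = em by apply: (Rmult_eq_reg_l ep); [rewrite Rinv_r ?prod; lra|lra].
have -> : (ep^-1)%R = em by rewrite -inv RinvE.
exists lp; split=> //.
- by split=> //; have := Rmult_lt_compat_r em _ _ em0 ep1; rewrite prod; lra.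
- by rewrite -p2; lra.
- rewrite -p2; have -> : (L * ep + (cl + L) - cl) * em = L * (ep * em) + L * em by ring.
  by rewrite prod; ring.
- by rewrite -p2; have := Rmult_lt_compat_l L _ _ L0 em_lt; lra.
Qed.

(** * The equation along a noise path *)

Section Path.
Context {H : CompleteNormedModule R_AbsRing}.
Context (pi F : H -> H) {L : R}.
Hypothesis pi_lin : is_linear pi.
Hypothesis hF : nonlinearity pi F L.
Variable zeta : R -> R.
Hypothesis cz : forall t, Continuity.continuous zeta t.

(** [G] as a function of time along the path. *)
Definition scaled_field (r : R) (x : H) : H :=
  scal (exp (- zeta r)) (F (scal (exp (zeta r)) x)).

Definition primitive (t : R) : R := RInt (V := R_CompleteNormedModule) zeta 0 t.

Lemma primitive_diff r t :
  RInt (V := R_CompleteNormedModule) zeta r t = primitive t - primitive r.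
Proof.
have cancel (x y : R) : y = x + y - x by ring.
rewrite /primitive -(RInt_Chasles (V := R_CompleteNormedModule) zeta 0 r t);
  try exact: ex_RInt_cont.
exact: cancel.
Qed.

Lemma primitive_cont t : Continuity.continuous primitive t.
Proof.
apply: (continuous_RInt_param (H := R_CompleteNormedModule) (f := fun _ => zeta)) => s r.
by apply: (Continuity.continuous_comp snd zeta); [exact: continuous_snd|exact: cz].
Qed.

Lemma nonlinearity_cont x : Continuity.continuous F x.
Proof.
have L0 := nonlin_L hF.
apply/filterlim_locally_ball_norm => e.
have eL : 0 < e / (2 * L) by apply: Rdiv_lt_0_compat; [exact: cond_pos|lra].
apply/locally_le_locally_norm; exists (mkposreal _ eL) => y xy.
have {}xy : norm (minus y x) < e / (2 * L) := xy.
rewrite /ball_norm.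
have -> : minus (F y) (F x) =
    plus (pi (minus (F y) (F x))) (compl_proj pi (minus (F y) (F x))).
  by rewrite /compl_proj; lin_ring.
apply: Rle_lt_trans (norm_plus_le (nonlin_plus hF _ _) (nonlin_minus hF _ _)) _.
have -> : pos e = 2 * L * (e / (2 * L)) by field; lra.
have -> : L * norm (minus y x) + L * norm (minus y x) = 2 * L * norm (minus y x) by ring.
by apply: Rmult_lt_compat_l; lra.
Qed.

Lemma scaled_diff r x y : minus (scaled_field r x) (scaled_field r y) =
  scal (exp (- zeta r)) (minus (F (scal (exp (zeta r)) x)) (F (scal (exp (zeta r)) y))).
Proof. by rewrite /scaled_field; lin_ring. Qed.

Lemma scaled_le (p : H -> H) r x y : is_linear p ->
  (forall x y, norm (p (minus (F x) (F y))) <= L * norm (minus x y)) ->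
  norm (p (minus (scaled_field r x) (scaled_field r y))) <= L * norm (minus x y).
Proof.
move=> lp hp; rewrite scaled_diff (linear_scal _ lp).
apply: Rle_trans (norm_scal_exp _ _) _.
apply: Rle_trans (Rmult_le_compat_l _ _ _ (Rlt_le _ _ (exp_pos _)) (hp _ _)) _.
have -> : minus (scal (exp (zeta r)) x) (scal (exp (zeta r)) y) =
    scal (exp (zeta r)) (minus x y) by lin_ring.
have L0 := nonlin_L hF.
apply: Rle_trans (Rmult_le_compat_l _ _ _ (Rlt_le _ _ (exp_pos _))
  (Rmult_le_compat_l _ _ _ (Rlt_le _ _ L0) (norm_scal_exp _ _))) _.
have -> : exp (- zeta r) * (L * (exp (zeta r) * norm (minus x y))) =
    exp (- zeta r) * exp (zeta r) * (L * norm (minus x y)) by ring.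
by rewrite -exp_plus Rplus_opp_l exp_0 Rmult_1_l; apply: Rle_refl.
Qed.

Lemma scaled_forcing : forcing pi scaled_field L.
Proof.
split.
- move=> X cX t.
  have ce (k : R) : Continuity.continuous (fun r => exp (k * zeta r)) t.
    apply: (Continuity.continuous_comp (fun r => k * zeta r) exp).
      exact: (continuous_scal_r (V := R_NormedModule) k zeta).
    exact: continuous_exp.
  apply: (continuous_scal (fun r => exp (- zeta r)) (fun r => F (scal (exp (zeta r)) (X r)))).
    by apply: Continuity.continuous_ext (ce (-1)) => r; congr exp; ring.
  apply: (Continuity.continuous_comp (fun r => scal (exp (zeta r)) (X r)) F).
    apply: (continuous_scal (fun r => exp (zeta r)) X); last exact: cX.
    by apply: Continuity.continuous_ext (ce 1) => r; congr exp; ring.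
  exact: nonlinearity_cont.
- by move=> r; rewrite /scaled_field scal_zero_r (nonlin_0 hF) scal_zero_r.
- by move=> r x y; apply: scaled_le => // {}x {}y; apply: nonlin_plus hF _ _.
- move=> r x y; apply: scaled_le; first exact: compl_proj_linear.
  by move=> {}x {}y; apply: nonlin_minus hF _ _.
Qed.
End Path.

Lemma theta_theta (r s : R) (w : C0) : theta r (theta s w) = theta (r + s) w.
Proof.
apply: val_inj; apply: funext => t.
change ((w (t + r + s) - w s) - (w (r + s) - w s) = w (t + (r + s)) - w (r + s)).
by rewrite Rplus_assoc; ring.
Qed.

Lemma theta0 (w : C0) : w 0 = 0 -> theta 0 w = w.
Proof.
move=> w0; apply: val_inj; apply: funext => t.
by change (w (t + 0) - w 0 = w t); rewrite w0 Rplus_0_r Rminus_0_r.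
Qed.

Definition noise_path (w : C0) (r : R) : R := z (theta r w).

Lemma noise_path_theta s w r : noise_path (theta s w) r = noise_path w (r + s).
Proof. by rewrite /noise_path theta_theta. Qed.

(** * Graph systems and mild solutions as trajectories *)

Section Bridge.
Context {H : CompleteNormedModule R_AbsRing}.
Context (S : R -> H -> H) (pi F : H -> H) {hl cl L kappa lam : R}.
Hypothesis hS : strongly_continuous_semigroup S.
Hypothesis hd : dichotomy S pi hl cl.
Hypothesis hF : nonlinearity pi F L.
Hypothesis gap : gap_constants hl cl L kappa lam.
Variable w : C0.
Hypothesis cz : forall t, Continuity.continuous (noise_path w) t.

Local Notation q := (compl_proj pi).
Local Notation Up := (plus_group S pi).
Local Notation Um := (minus_semigroup S pi).
Local Notation C := (primitive (noise_path w)).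
Local Notation N := (scaled_field F (noise_path w)).

Let spl := dichotomy_splitting hS hd.
Let frc := scaled_forcing (dich_pi_linear hd) hF cz.
Let cC := primitive_cont cz.

Lemma zint_primitive r t : zint w r t = C t - C r.
Proof. exact: (primitive_diff cz). Qed.

Lemma continuous_on_clamp (u : R -> H) (D : set R) T : 0 <= T ->
  (forall t, 0 <= t <= T -> D t) -> continuous_on D u ->
  forall t, Continuity.continuous (fun t => u (clamp 0 T t)) t.
Proof.
move=> T0 DT cu t.
apply: (filterlim_comp _ _ _ (clamp 0 T) u (locally t)
  (within D (locally (clamp 0 T t)))); last first.
  by apply: cu; apply: DT; apply: clamp_in.
move=> P PD.
have h : locally t (fun s => D (clamp 0 T s) -> P (clamp 0 T s)) := clamp_cont PD.
apply: Hierarchy.filter_imp h => s; apply.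
by apply: DT; apply: clamp_in.
Qed.

Lemma calH_lipschitz g : calH pi kappa g -> lipschitz_graph pi kappa g.
Proof.
move=> [mg g0 lg]; split=> //.
- by move=> x /(HplusP hd)/mg/(HminusP hd).
- by move=> x y /(HplusP hd) Hx /(HplusP hd) Hy; apply: lg.
Qed.

Lemma lipschitz_calH g : lipschitz_graph pi kappa g -> calH pi kappa g.
Proof.
move=> [mg g0 lg]; split=> //.
- by move=> x /(HplusP hd)/mg/(HminusP hd).
- by move=> x y /(HplusP hd) Hx /(HplusP hd) Hy; apply: lg.
Qed.

Lemma graph_system_steered T g y u v : 0 <= T -> Hplus pi y -> maps_to pi g ->
  graph_system S pi F T w g y u v ->
  steered pi Up Um C N g 0 T y (fun t => plus (u (clamp 0 T t)) (v (clamp 0 T t))).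
Proof.
move=> T0 /(HplusP hd) yp mg [[cu cv] mem equ eqv].
set X := fun t => _.
have XE t : 0 <= t <= T -> X t = plus (u t) (v t) by move=> tT; rewrite /X clamp_id.
have up t : 0 <= t <= T -> pi (u t) = u t by move=> /mem[/(HplusP hd)].
have vm t : 0 <= t <= T -> pi (v t) = zero by move=> /mem[_ /(HminusP hd)].
have piX t : 0 <= t <= T -> pi (X t) = u t.
  by move=> tT; rewrite XE // (linear_plus _ (dich_pi_linear hd)) up // vm // plus_zero_r.
have qX t : 0 <= t <= T -> q (X t) = v t.
  by move=> tT; rewrite /compl_proj piX // XE //; lin_ring.
have TT : 0 <= T <= T by lra.
have T00 : 0 <= 0 <= T by lra.
have uT : u T = y.
  rewrite equ // RInt_point minus_zero_r /zint RInt_point exp_0 (@scal_one R_Ring).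
  by rewrite Rminus_diag (semigroup_0 hS).
have v0 : v 0 = g (u 0).
  rewrite eqv // RInt_point plus_zero_r /zint RInt_point exp_0 (@scal_one R_Ring).
  rewrite (semigroup_0 hS) /compl_proj.
  by have [/mg/(HminusP hd) -> _] := mem _ T00; rewrite minus_zero_r.
split; first split.
- move=> t; apply: continuous_plus.
  + exact: (continuous_on_clamp (D := [set t | 0 <= t <= T])).
  + exact: (continuous_on_clamp (D := [set t | 0 <= t <= T])).
- move=> t tT; rewrite (piX t) // (piX T) // uT equ // /plus_part.
  rewrite zint_primitive; congr minus.
    by congr scal; rewrite -[in LHS]yp (pi_plus_group hd) // /plus_group yp.
  apply: RInt_eq => [|r rt]; first lra.
  rewrite /plus_kernel zint_primitive -(pi_plus_group hd) // /plus_group XE //; lra.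
- move=> t tT; rewrite (qX t) // (qX 0) // v0 eqv // /minus_part.
  rewrite zint_primitive; congr plus.
    rewrite minus_semigroupE ?Rminus_0_r; try lra.
    have [/mg/(HminusP hd) gm _] := mem _ T00.
    by rewrite {3}/compl_proj gm minus_zero_r.
  apply: RInt_eq => [|r rt]; first lra.
  rewrite /minus_kernel zint_primitive minus_semigroupE ?XE //; lra.
- by rewrite piX.
- by rewrite qX // piX.
Qed.

Lemma steered_graph_system T g y X : 0 <= T -> Hplus pi y ->
  steered pi Up Um C N g 0 T y X ->
  graph_system S pi F T w g y (fun t => pi (X t)) (fun t => q (X t)).
Proof.
move=> T0 /(HplusP hd) yp [[cX hp hm] eX sX]; split.
- have cp (p : H -> H) : is_linear p ->
      continuous_on [set t | 0 <= t <= T] (fun t => p (X t)).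
    move=> lp t _; have c : Continuity.continuous (fun t => p (X t)) t.
      apply: (Continuity.continuous_comp X p); first exact: cX.
      exact: linear_cont.
    move=> P /c h; have {}h : locally t (fun s => P (p (X s))) := h.
    by apply: (Hierarchy.filter_imp (fun s => P (p (X s))) _ _ h) => s hs _.
  by split; apply: cp; [exact: dich_pi_linear hd|exact: compl_proj_linear (dich_pi_linear hd)].
- move=> t _; split; first by exists (X t).
  by exists (X t).
- move=> t tT; have {}tT : 0 <= t <= T := tT; rewrite hp // eX /plus_part zint_primitive; congr minus.
    by congr scal; rewrite -[in RHS]yp (pi_plus_group hd) // /plus_group yp.
  apply: RInt_eq => [|r rt]; first lra.
  rewrite /plus_kernel zint_primitive -(pi_plus_group hd) // /plus_group pi_plus_compl //.
- move=> t tT; have {}tT : 0 <= t <= T := tT; rewrite hm // sX /minus_part zint_primitive; congr plus.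
    rewrite minus_semigroupE ?Rminus_0_r; last lra.
    by rewrite -sX (compl_idem hd).
  apply: RInt_eq => [|r rt]; first lra.
  by rewrite /minus_kernel zint_primitive minus_semigroupE ?pi_plus_compl //; lra.
Qed.

Lemma graph_transform_intro T g g' : 0 <= T -> calH pi kappa g ->
  (forall y X, pi y = y -> steered pi Up Um C N g 0 T y X -> g' y = q (X T)) ->
  graph_transform S pi F T w g g'.
Proof.
move=> T0 hg hg' y Hy; have lg := calH_lipschitz hg; have [mg _ _] := hg.
have yp := (HplusP hd y).1 Hy.
have [X sX] := steered_exists spl frc gap cC lg T0 yp.
exists (fun t => pi (X t)), (fun t => q (X t)); split.
- exact: steered_graph_system.
- move=> u v sys t tT; have sY := graph_system_steered T0 Hy mg sys.
  have <- := steered_unique spl frc gap cC lg T0 sY sX tT; rewrite clamp_id //.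
  have [_ mem _ _] := sys.
  have [/(HplusP hd) up /(HminusP hd) vm] := mem t tT.
  have e : pi (plus (u t) (v t)) = u t.
    by rewrite (linear_plus _ (dich_pi_linear hd)) up vm plus_zero_r.
  by rewrite /compl_proj e; split=> //; lin_ring.
- exact: hg'.
Qed.

Lemma graph_transform_elim T g g' y X : 0 <= T -> calH pi kappa g ->
  graph_transform S pi F T w g g' -> pi y = y ->
  steered pi Up Um C N g 0 T y X -> g' y = q (X T).
Proof.
move=> T0 hg tr yp sX; have lg := calH_lipschitz hg; have [mg _ _] := hg.
have Hy := (HplusP hd y).2 yp.
have [u [v [sys _ ->]]] := tr y Hy.
have TT : 0 <= T <= T by lra.
have sY := graph_system_steered T0 Hy mg sys.
rewrite -(steered_unique spl frc gap cC lg T0 sY sX TT) clamp_id //.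
have [_ mem _ _] := sys.
have [/(HplusP hd) up /(HminusP hd) vm] := mem T TT.
rewrite /compl_proj (linear_plus _ (dich_pi_linear hd)) up vm plus_zero_r; lin_ring.
Qed.

(** The forward solution is split by the two projections; the group property
    on the range of [pi] lets its unstable part be steered from the endpoint. *)
Lemma mild_solution_steered T g x (u : R -> H) : 0 <= T -> q x = g (pi x) ->
  mild_solution S F w x u ->
  steered pi Up Um C N g 0 T (pi (u T)) (fun t => u (clamp 0 T t)).
Proof.
move=> T0 xg [cu equ]; set X := fun t => _.
have XE t : 0 <= t <= T -> X t = u t by move=> tT; rewrite /X clamp_id.
have cX : path X.
  by apply: (continuous_on_clamp (D := [set t | 0 <= t])) => // t [].
have SE s h : 0 <= s -> S s h = plus (Up s h) (Um s h).
  move=> s0; rewrite minus_semigroupE // (semigroup_compl hS hd) // (compl_idem hd).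
  by rewrite /plus_group -(linear_plus _ (semigroup_linear hS s0)) pi_plus_compl.
have split_u t : 0 <= t <= T ->
    X t = plus (plus_part Up C N 0 x X t) (minus_part Um C N 0 x X t).
  move=> tT; rewrite (XE t) // equ; last lra.
  have -> : RInt (fun r => scal (exp (zint w r t)) (S (t - r) (G F (theta r w) (u r)))) 0 t =
      RInt (fun r => plus (plus_kernel Up C N X t r) (minus_kernel Um C N X t r)) 0 t.
    apply: RInt_eq => [|r rt]; first lra.
    rewrite zint_primitive SE; last lra.
    by rewrite /plus_kernel /minus_kernel XE ?scal_distr_l //; lra.
  have ep : ex_RInt (plus_kernel Up C N X t) 0 t.
    by apply: ex_RInt_cont => r; apply: (plus_kernel_cont1 spl frc cC).
  rewrite RInt_plus //; last first.
    by apply: ex_RInt_cont => r; apply: (minus_kernel_cont1 spl frc cC).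
  rewrite /plus_part /minus_part Rminus_0_r -(opp_RInt_swap _ _ _ ep).
  rewrite SE; last lra.
  by rewrite zint_primitive; lin_ring.
have piX t : 0 <= t <= T -> pi (X t) = plus_part Up C N 0 x X t.
  move=> tT; rewrite split_u // (linear_plus _ (dich_pi_linear hd)).
  rewrite (pi_plus_part spl frc cC) // -(compl_minus_part spl frc cC _ cX tT.1).
  by rewrite (pi_compl spl) plus_zero_r.
have qX t : 0 <= t <= T -> q (X t) = minus_part Um C N 0 x X t.
  by move=> tT; rewrite /compl_proj piX // [X in minus X _]split_u //; lin_ring.
have TT : 0 <= T <= T by lra.
have T00 : 0 <= 0 <= T by lra.
have X0 : X 0 = x.
  rewrite split_u // (plus_part_end spl) (minus_part_start spl).
  exact: pi_plus_compl.
split; first split=> // t tT.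
- by rewrite (piX t) // (piX T) // (plus_part_split spl frc cC).
- rewrite (qX t) // X0 /minus_part; congr plus; congr scal.
  by rewrite (um_compl spl) //; lra.
- by rewrite XE.
- by rewrite X0.
Qed.

End Bridge.

(** * Measurable functions with values in a separable Banach space *)

Section BallMeasurable.
Context {d : measure_display} {T : measurableType d}.
Variable D : set T.
Hypothesis mD : measurable D.

(** Asking only for preimages of balls makes stability under pointwise limits
    a direct computation; on a separable space they determine the preimages of
    all open sets. *)
Definition ball_measurable {V : NormedModule R_AbsRing} (f : T -> V) : Prop :=
  forall c x, measurable (D `&` [set w | norm (minus (f w) c) < x]).

(** [i] encodes a countable partition of [D] into measurable pieces. *)
Definition index_measurable (i : T -> nat) : Prop :=
  forall n, measurable (D `&` [set w | i w = n]).

Lemma index_measurable2 i j (P : nat -> nat -> Prop) :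
  index_measurable i -> index_measurable j ->
  measurable (D `&` [set w | P (i w) (j w)]).
Proof.
move=> mi mj.
have -> : D `&` [set w | P (i w) (j w)] = \bigcup_n \bigcup_m
    (if `[< P n m >] then (D `&` [set w | i w = n]) `&` (D `&` [set w | j w = m]) else set0).
  apply/seteqP; split=> [w [Dw Pw]|w [n _ [m _]]].
    exists (i w) => //; exists (j w) => //.
    by rewrite (asboolT Pw).
  by case: asboolP => // Pnm [[Dw /= e1] [_ /= e2]]; split=> //=; rewrite e1 e2.
apply: bigcupT_measurable => n; apply: bigcupT_measurable => m.
by case: asboolP => // _; apply: measurableI.
Qed.

Lemma ball_measurable_ext {V : NormedModule R_AbsRing} (f g : T -> V) :
  (forall w, D w -> f w = g w) -> ball_measurable f -> ball_measurable g.
Proof.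
move=> fg mf c x.
have <- : D `&` [set w | norm (minus (f w) c) < x] =
    D `&` [set w | norm (minus (g w) c) < x].
  by apply/seteqP; split=> w [Dw /=]; [rewrite fg|rewrite -fg].
exact: mf.
Qed.

Lemma ball_measurable_cst {V : NormedModule R_AbsRing} (v : V) : ball_measurable (fun _ => v).
Proof.
move=> c x; have [h|h] := EM (norm (minus v c) < x).
  by rewrite (_ : _ `&` _ = D) //; apply/seteqP; split=> w // [].
by rewrite (_ : _ `&` _ = set0) //; apply/seteqP; split=> w // [].
Qed.

Lemma inv_INR_small (e : R) : 0 < e -> exists k, / (INR k + 1) < e.
Proof.
move=> e0; have [k hk] := INR_unbounded (/ e).
exists k; rewrite -[X in _ < X]Rinv_inv.
have := Rinv_0_lt_compat _ e0 => ie.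
by apply: Rinv_lt_contravar; [apply: Rmult_lt_0_compat|]; lra.
Qed.

Lemma inv_INR_gt0 k : 0 < / (INR k + 1).
Proof. by apply: Rinv_0_lt_compat; have := pos_INR k; lra. Qed.

Lemma ball_measurable_limit {V : CompleteNormedModule R_AbsRing} (f : nat -> T -> V) (g : T -> V) :
  (forall n, ball_measurable (f n)) ->
  (forall w, D w -> filterlim (fun n => f n w) eventually (locally (g w))) ->
  ball_measurable g.
Proof.
move=> mf fg c x.
have -> : D `&` [set w | norm (minus (g w) c) < x] =
    \bigcup_k \bigcup_m \bigcap_(n in [set n | (m <= n)%coq_nat])
      (D `&` [set w | norm (minus (f n w) c) < x - / (INR k + 1)]).
  apply/seteqP; split=> [w [Dw /= gx]|w [k _ [m _ hw]]].
    pose e := (x - norm (minus (g w) c)) / 2.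
    have e0 : 0 < e by rewrite /e; lra.
    have [k hk] := inv_INR_small e0.
    have [m hm] := (filterlim_locally_ball_norm _ _).1 (fg w Dw) (mkposreal _ e0).
    exists k => //; exists m => // n mn; split=> //=.
    have h : norm (minus (f n w) (g w)) < e := hm n mn.
    have := norm_minus_triangle (g w) (f n w) c.
    by move: hk h; rewrite /e; lra.
  have Dw : D w by have [] := hw m (le_n m).
  split=> //=; have e0 := inv_INR_gt0 k.
  have [m' hm'] := (filterlim_locally_ball_norm _ _).1 (fg w Dw) (mkposreal _ e0).
  have h : norm (minus (f (m + m')%coq_nat w) (g w)) < / (INR k + 1).
    by apply: (hm' (m + m')%coq_nat); rewrite Nat.add_comm; apply: Nat.le_add_r.
  have [_ /= h2] := hw (m + m')%coq_nat (Nat.le_add_r _ _).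
  have := norm_minus_triangle (f (m + m')%coq_nat w) (g w) c.
  by rewrite (norm_minusC (g w) (f _ w)); lra.
apply: bigcupT_measurable => k; apply: bigcupT_measurable => m.
by apply: bigcap_measurable => [|n _]; [exists m => /=|exact: mf].
Qed.

(** Rounding to the first point of a dense sequence that is close enough. *)
Lemma ball_measurable_round {V : CompleteNormedModule R_AbsRing} (u : nat -> V) (f : T -> V) e :
  (forall x (e : R), 0 < e -> exists n, norm (minus x (u n)) < e) ->
  0 < e -> ball_measurable f ->
  exists i, index_measurable i /\ forall w, norm (minus (f w) (u (i w))) < e.
Proof.
move=> du e0 mf.
have ex w : exists n, `[< norm (minus (f w) (u n)) < e >].
  by have [n hn] := du (f w) e e0; exists n; apply/asboolP.
exists (fun w => ex_minn (ex w)); split=> [n|w]; last first.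
  by case: ex_minnP => n /asboolP.
have -> : D `&` [set w | ex_minn (ex w) = n] =
    (D `&` [set w | norm (minus (f w) (u n)) < e]) `\`
    \bigcup_(m in [set m | (m < n)%N]) (D `&` [set w | norm (minus (f w) (u m)) < e]).
  apply/seteqP; split=> [w [Dw /=]|w [[Dw /= hn] nm]].
    case: ex_minnP => k /asboolP hk kmin <-; split=> // -[m /= mk [_ hm]].
    by have := kmin m (introT (asboolP _) hm); rewrite leqNgt mk.
  split=> //=; case: ex_minnP => k /asboolP hk kmin.
  apply/eqP; rewrite eqn_leq kmin ?(introT (asboolP _) hn) //=.
  by rewrite leqNgt; apply/negP => kn; apply: nm; exists k.
apply: measurableD; first exact: mf.
by apply: bigcup_measurable => m _; apply: mf.
Qed.

(** Rounding both arguments leaves functions with countably many values, and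
    continuity recovers [h (f w) (g w)] as their limit. *)
Lemma ball_measurable_comp2 {V1 V2 V3 : CompleteNormedModule R_AbsRing}
    (h : V1 -> V2 -> V3) (f : T -> V1) (g : T -> V2) :
  separable V1 -> separable V2 ->
  (forall a b, Continuity.continuous (fun p : V1 * V2 => h p.1 p.2) (a, b)) ->
  ball_measurable f -> ball_measurable g -> ball_measurable (fun w => h (f w) (g w)).
Proof.
move=> [u du] [v dv] ch mf mg.
have [i hi] := choice (fun k => ball_measurable_round du (inv_INR_gt0 k) mf).
have [j hj] := choice (fun k => ball_measurable_round dv (inv_INR_gt0 k) mg).
apply: (ball_measurable_limit (f := fun k w => h (u (i k w)) (v (j k w)))).
  move=> k c x.
  apply: (index_measurable2 (fun n m => norm (minus (h (u n) (v m)) c) < x)).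
    exact: (hi k).1.
  exact: (hj k).1.
move=> w Dw P /ch[e he].
have [k0 hk0] := inv_INR_small (cond_pos e).
exists k0 => k kk0; have hk : / (INR k + 1) < e.
  apply: Rle_lt_trans hk0; apply: Rinv_le_contravar.
    by have := pos_INR k0; lra.
  by have := le_INR _ _ kk0; lra.
apply: (he (u (i k w), v (j k w))); split; apply: norm_compat1 => /=.
  by apply: Rlt_trans hk; rewrite norm_minusC; apply: (hi k).2.
by apply: Rlt_trans hk; rewrite norm_minusC; apply: (hj k).2.
Qed.

Lemma ball_measurable_comp {V1 V2 : CompleteNormedModule R_AbsRing}
    (h : V1 -> V2) (f : T -> V1) :
  separable V1 -> (forall a, Continuity.continuous h a) ->
  ball_measurable f -> ball_measurable (fun w => h (f w)).
Proof.
move=> sV ch mf.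
apply: (ball_measurable_comp2 (h := fun x _ => h x) sV sV _ mf mf) => a b.
apply: (Continuity.continuous_comp fst h); last exact: ch.
exact: continuous_fst.
Qed.

Lemma separable_R : separable R_CompleteNormedModule.
Proof.
pose u n := if @unpickle (nat * nat * nat)%type n is Some (a, b, k)
            then (INR a - INR b) / (INR k + 1) else 0.
exists u => x e e0.
have [k hk] := inv_INR_small e0.
pose m := up (x * (INR k + 1)).
exists (pickle (Z.to_nat m, Z.to_nat (- m), k)).
rewrite /u pickleK.
have -> : INR (Z.to_nat m) - INR (Z.to_nat (- m)) = IZR m.
  have parts (p : Z) : Z.sub (Z.of_nat (Z.to_nat p)) (Z.of_nat (Z.to_nat (Z.opp p))) = p by lia.
  by rewrite !INR_IZR_INZ -minus_IZR parts.
have [m1 m2] := archimed (x * (INR k + 1)).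
have k1 : 0 < INR k + 1 by have := pos_INR k; lra.
rewrite /norm /= /abs /= /minus /plus /opp /=.
have -> : x + - (IZR m / (INR k + 1)) = - ((IZR m - x * (INR k + 1)) * / (INR k + 1)).
  by field; lra.
rewrite Rabs_Ropp Rabs_pos_eq; last first.
  by apply: Rmult_le_pos; [rewrite /m; lra|exact/Rlt_le/Rinv_0_lt_compat].
apply: Rle_lt_trans hk; rewrite -[X in _ <= X]Rmult_1_l.
by apply: Rmult_le_compat_r; [exact/Rlt_le/Rinv_0_lt_compat|rewrite /m; lra].
Qed.

Section Operations.
Context {V : CompleteNormedModule R_AbsRing}.
Hypothesis sV : separable V.

Lemma ball_measurable_plus (f g : T -> V) :
  ball_measurable f -> ball_measurable g -> ball_measurable (fun w => plus (f w) (g w)).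
Proof.
apply: (ball_measurable_comp2 (h := plus)) => // a b.
by apply: (continuous_plus (fun p : V * V => p.1) (fun p : V * V => p.2));
  [exact: continuous_fst|exact: continuous_snd].
Qed.

Lemma ball_measurable_opp (f : T -> V) :
  ball_measurable f -> ball_measurable (fun w => opp (f w)).
Proof.
apply: ball_measurable_comp => // a.
exact: (continuous_opp (fun x : V => x) a (continuous_id a)).
Qed.

Lemma ball_measurable_scal (k : T -> R_CompleteNormedModule) (f : T -> V) :
  ball_measurable k -> ball_measurable f -> ball_measurable (fun w => scal (k w : R) (f w)).
Proof.
apply: (ball_measurable_comp2 (h := fun (k : R_CompleteNormedModule) x => scal (k : R) x)).
- exact: separable_R.
- exact: sV.
- move=> a b.
  by apply: (continuous_scal (fun p : R * V => p.1) (fun p : R * V => p.2));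
    [exact: continuous_fst|exact: continuous_snd].
Qed.

Lemma ball_measurable_Riemann_sum (f : T -> R -> V) (ptd : SF_seq) :
  (forall r, ball_measurable (fun w => f w r)) ->
  ball_measurable (fun w => Riemann_sum (f w) ptd).
Proof.
move=> mf; move: ptd; apply: (@SF_cons_ind R) => [u|[u v] s IH].
  exact: ball_measurable_cst.
apply: (ball_measurable_ext (f := fun w => plus (scal (SF_h s - u) (f w v)) (Riemann_sum (f w) s))).
  by move=> w _; rewrite Riemann_sum_cons.
apply: ball_measurable_plus => //; apply: ball_measurable_scal => //.
exact: ball_measurable_cst.
Qed.

(** The integral is a limit of Riemann sums over partitions that do not depend
    on [w]. *)
Lemma ball_measurable_RInt (f : T -> R -> V) a b : a <= b ->
  (forall r, ball_measurable (fun w => f w r)) ->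
  (forall w, D w -> forall r, Continuity.continuous (f w) r) ->
  ball_measurable (fun w => RInt (f w) a b).
Proof.
move=> [ab|<-] mf cf; last first.
  apply: (ball_measurable_ext (f := fun _ => zero)); last exact: ball_measurable_cst.
  by move=> w _; rewrite RInt_point.
pose ptd n := SF_seq_f2 (fun x _ : R => x) (unif_part a b n).
have fine n := Riemann_fine_unif_part (fun x _ => x) a b n
  (fun x y xy => conj (Rle_refl x) xy) (Rlt_le _ _ ab).
apply: (ball_measurable_limit (f := fun n w => Riemann_sum (f w) (ptd n))).
  by move=> n; apply: ball_measurable_Riemann_sum.
move=> w Dw P hP.
have [e he] := RInt_correct _ _ _ (ex_RInt_cont a b (cf w Dw)) P hP.
have ba : 0 < b - a by lra.
have [n0 hn0] := inv_INR_small (Rdiv_lt_0_compat _ _ (cond_pos e) ba).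
exists n0 => n nn0; have [st [pt [h1 h2]]] := fine n.
have := he (ptd n).
rewrite Rmin_left; last lra.
rewrite Rmax_right; last lra.
have -> : sign (b - a) = 1 by apply: sign_eq_1.
rewrite (@scal_one R_Ring); apply; last by [].
apply: Rle_lt_trans st _.
have hn : / (INR n + 1) <= / (INR n0 + 1).
  apply: Rinv_le_contravar; first by have := pos_INR n0; lra.
  by have := le_INR _ _ nn0; lra.
have -> : pos e = (b - a) * (e / (b - a)) by field; lra.
by apply: Rmult_lt_compat_l => //; lra.
Qed.
End Operations.

End BallMeasurable.

(** * Measurability along the noise *)

Section NoiseMeasurability.
Context {P : probability C0 R} {Om : set C0}.
Hypothesis hOm : noise_space P Om.

Let mOm := noise_borel hOm.

Lemma C0_continuous (w : C0) t : Continuity.continuous w t.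
Proof.
have [cw _] : C0_set (set_val w) by have := set_valP w.
apply/continuity_pt_filterlim.
exact/continuity_pt_cvg/cw.
Qed.

Lemma noise_integrand_continuous (w : C0) r s :
  Continuity.continuous (fun s => exp s * (w (s + r) - w r)) s.
Proof.
apply: (continuous_mult (K := R_AbsRing) exp (fun s => w (s + r) - w r)).
  exact: continuous_exp.
apply: (continuous_minus (V := R_NormedModule) (fun s => w (s + r)) (fun _ => w r)).
  apply: (Continuity.continuous_comp (fun s => s + r) w); last exact: C0_continuous.
  apply: (continuous_plus (V := R_NormedModule) (fun s => s) (fun _ => r)).
    exact: continuous_id.
  exact: continuous_const.
exact: continuous_const.
Qed.

Lemma eval_measurable t :
  ball_measurable Om (fun w : C0 => w t : R_CompleteNormedModule).
Proof.
move=> c x; apply: measurableI => //.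
apply: sub_sigma_algebra.
pose U : set R := [set` Interval (BRight (c - x)) (BLeft (c + x))].
exists [set g : {compact-open, R -> R} | (g : R -> R) @` [set t] `<=` U].
  apply: compact_open_open; first exact: compact_set1.
  exact: interval_open.
have evE (w : C0) : [set g : R -> R | g @` [set t] `<=` U] (w : R -> R) <->
    norm (minus (w t : R_CompleteNormedModule) c) < x.
  split=> [h|h _ [_ -> <-]].
    have : U (w t) by apply: h; exists t.
    rewrite /U /= in_itv /= => /andP[/RltP h1 /RltP h2].
    apply: Rabs_def1; rewrite /minus /plus /opp /=.
      by move: h2; rewrite /GRing.add /=; lra.
    by move: h1; rewrite /GRing.add /GRing.opp /=; lra.
  have [h1 h2] := Rabs_def2 _ _ h; move: h1 h2; rewrite /minus /plus /opp /= => h1 h2.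
  rewrite /U /= in_itv /=; apply/andP.
  by split; apply/RltP; lra.
by apply/seteqP; split=> w /evE.
Qed.

Lemma theta_Om s w : Om w -> Om (theta s w).
Proof. by move=> Ow; rewrite -(noise_theta hOm s); exists w. Qed.

Lemma noise_path_cont w : Om w -> forall t, Continuity.continuous (noise_path w) t.
Proof. by move=> Ow t; apply: (noise_zcont hOm Ow). Qed.

(** [z] is a limit of integrals over the intervals [[-n, 0]], and evaluation at
    a time is continuous for the compact-open topology. *)
Lemma noise_path_measurable r :
  ball_measurable Om (fun w => noise_path w r : R_CompleteNormedModule).
Proof.
pose f (w : C0) (s : R) : R_CompleteNormedModule :=
  scal (exp s : R) (plus (w (s + r)) (opp (w r) : R_CompleteNormedModule)).
have n0 n : - INR n <= 0 by have := pos_INR n; lra.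
apply: (ball_measurable_limit (f := fun n w => opp (RInt (f w) (- INR n) 0))).
  move=> n; apply: ball_measurable_opp; first exact: separable_R.
  apply: (ball_measurable_RInt mOm separable_R) => //.
    move=> s; apply: (ball_measurable_scal separable_R).
      exact: ball_measurable_cst.
    apply: (ball_measurable_plus separable_R).
      exact: eval_measurable.
    apply: (ball_measurable_opp separable_R).
    exact: eval_measurable.
  by move=> w _ s; exact: (@noise_integrand_continuous w r s).
move=> w Ow; rewrite /noise_path /z.
apply: (filterlim_comp _ _ _ (fun n => RInt (f w) (- INR n) 0) opp);
  last exact: filterlim_opp.
have := RInt_gen_correct _ (noise_z hOm (theta_Om r Ow)).
move=> gen Q /gen[A B [M hM] hB h].
have [n1 hn1] := INR_unbounded (- M).
exists n1 => n nn1; have := le_INR _ _ nn1 => nn.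
have hn : - INR n < M by lra.
have [y [iy Qy]] := h (- INR n) 0 (hM _ hn) hB.
by have <- : y = RInt (f w) (- INR n) 0 by rewrite -(is_RInt_unique _ _ _ _ iy).
Qed.

Lemma primitive_measurable t :
  ball_measurable Om (fun w => primitive (noise_path w) t : R_CompleteNormedModule).
Proof.
have key a b : a <= b -> ball_measurable Om
    (fun w => RInt (V := R_CompleteNormedModule) (noise_path w) a b : R_CompleteNormedModule).
  move=> ab; apply: (ball_measurable_RInt mOm separable_R) => //.
    exact: noise_path_measurable.
  exact: noise_path_cont.
have [t0|t0] := Rle_lt_dec 0 t; first exact: key.
apply: (ball_measurable_ext (f := fun w =>
  opp (RInt (V := R_CompleteNormedModule) (noise_path w) t 0))).
  move=> w Ow; apply: opp_RInt_swap; apply: ex_RInt_cont.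
  exact: noise_path_cont.
apply: (ball_measurable_opp separable_R).
by apply: key; lra.
Qed.

Lemma exp_measurable (f : C0 -> R_CompleteNormedModule) : ball_measurable Om f ->
  ball_measurable Om (fun w => exp (f w) : R_CompleteNormedModule).
Proof.
apply: (ball_measurable_comp (V1 := R_CompleteNormedModule)
  (V2 := R_CompleteNormedModule) (h := exp)); first exact: separable_R.
exact: continuous_exp.
Qed.

Context {H : CompleteNormedModule R_AbsRing}.
Context (S : R -> H -> H) (pi F : H -> H) {hl cl L : R}.
Hypothesis sH : separable H.
Hypothesis hS : strongly_continuous_semigroup S.
Hypothesis hd : dichotomy S pi hl cl.
Hypothesis hF : nonlinearity pi F L.

Local Notation Up := (plus_group S pi).
Local Notation Um := (minus_semigroup S pi).
Local Notation C w := (primitive (noise_path w)).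
Local Notation N w := (scaled_field F (noise_path w)).

Let spl := dichotomy_splitting hS hd.
Let frc w (Ow : Om w) := scaled_forcing (dich_pi_linear hd) hF (noise_path_cont Ow).

Lemma weight_measurable t r :
  ball_measurable Om (fun w => exp (C w t - C w r) : R_CompleteNormedModule).
Proof.
apply: exp_measurable.
apply: (ball_measurable_plus separable_R (f := fun w => C w t)
  (g := fun w => opp (C w r : R_CompleteNormedModule))).
  exact: primitive_measurable.
apply: (ball_measurable_opp separable_R).
exact: primitive_measurable.
Qed.

Lemma scaled_field_measurable r (X : C0 -> H) :
  ball_measurable Om X -> ball_measurable Om (fun w => N w r (X w)).
Proof.
move=> mX.
have mz := noise_path_measurable r.
apply: (ball_measurable_scal sH (k := fun w => exp (- noise_path w r))).
  apply: (exp_measurable (f := fun w => - noise_path w r)).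
  exact: (ball_measurable_opp separable_R mz).
apply: (ball_measurable_comp (h := F)) => //.
  exact: nonlinearity_cont hF.
apply: (ball_measurable_scal sH (k := fun w => exp (noise_path w r))) => //.
exact: exp_measurable.
Qed.

Lemma linear_measurable (U : H -> H) (X : C0 -> H) : is_linear U ->
  ball_measurable Om X -> ball_measurable Om (fun w => U (X w)).
Proof. by move=> lU; apply: ball_measurable_comp => // x; apply: linear_cont. Qed.

Lemma picard_measurable a b y n t : a <= b ->
  ball_measurable Om (fun w => picard Up Um (C w) (N w) (fun _ => zero) a b y n t).
Proof.
move=> ab; elim: n t => [|n IH] t; first exact: ball_measurable_cst.
rewrite /= /window_map; have [sa sb] := clamp_in t ab.
set s := clamp a b t in sa sb *.
have cX w : Om w -> path (picard Up Um (C w) (N w) (fun _ => zero) a b y n).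
  by move=> Ow; apply: (picard_cont spl (frc Ow) (primitive_cont (noise_path_cont Ow))).
apply: ball_measurable_plus => //; rewrite /plus_part /minus_part.
- apply: ball_measurable_plus => //.
    apply: ball_measurable_scal => //; first exact: weight_measurable.
    exact: ball_measurable_cst.
  apply: ball_measurable_opp => //; apply: ball_measurable_RInt => //.
    move=> r; apply: ball_measurable_scal => //; first exact: weight_measurable.
    apply: linear_measurable; first exact: (split_up_linear spl).
    exact: scaled_field_measurable.
  move=> w Ow r.
  by apply: (plus_kernel_cont1 spl (frc Ow) (primitive_cont (noise_path_cont Ow))); apply: cX.
- apply: ball_measurable_plus => //.
    apply: ball_measurable_scal => //; first exact: weight_measurable.
    exact: ball_measurable_cst.
  apply: ball_measurable_RInt => //.
    move=> r; apply: ball_measurable_scal => //; first exact: weight_measurable.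
    apply: linear_measurable; first exact: (split_um_linear spl).
    exact: scaled_field_measurable.
  move=> w Ow r.
  by apply: (minus_kernel_cont1 spl (frc Ow) (primitive_cont (noise_path_cont Ow))); apply: cX.
Qed.

End NoiseMeasurability.

(** * Graphs of Lipschitz maps and their distance functions *)

Section Graphs.
Context {H : CompleteNormedModule R_AbsRing}.
Context (pi : H -> H) {Up Um : R -> H -> H} {hl cl kappa : R}.
Hypothesis spl : splitting pi Up Um hl cl.
Hypothesis k01 : 0 < kappa <= 1.

Local Notation q := (compl_proj pi).

Lemma HplusE x : Hplus pi x <-> pi x = x.
Proof. exact: Hplus_fixed (split_pi_idem spl) x. Qed.

Lemma graph_ofP g v : lipschitz_graph pi kappa g ->
  graph_of pi g v <-> q v = g (pi v).
Proof.
move=> lg; split=> [[x /HplusE px <-]|qv].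
  have gx := graph_minus lg px.
  have e : pi (plus x (g x)) = x by rewrite (linear_plus _ (split_pi spl)) px gx plus_zero_r.
  by rewrite /compl_proj e; lin_ring.
exists (pi v); first by exists v.
by rewrite -qv pi_plus_compl.
Qed.

Lemma lipschitz_graph_close g x y : lipschitz_graph pi kappa g ->
  pi x = x -> pi y = y -> norm (minus (g x) (g y)) <= norm (minus x y).
Proof.
move=> lg px py; apply: Rle_trans (graph_lip lg px py) _.
rewrite -[X in _ <= X]Rmult_1_l; apply: Rmult_le_compat_r; first exact: norm_ge_0.
exact: k01.2.
Qed.

Lemma graph_of_closed g : lipschitz_graph pi kappa g -> Hierarchy.closed (graph_of pi g).
Proof.
move=> lg x nx; apply: contrapT => Gx; apply: nx.
have ne : q x <> g (pi x) by move=> /(graph_ofP _ lg).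
have e0 : 0 < norm (minus (q x) (g (pi x))).
  have [//|e] := norm_ge_0 (minus (q x) (g (pi x))).
  case: ne; apply: norm_minus_eq0 => e' e'0; rewrite -e; exact/Rlt_le.
have e3 : 0 < norm (minus (q x) (g (pi x))) / 3 by lra.
apply/locally_le_locally_norm; exists (mkposreal _ e3) => v xv.
have {}xv : norm (minus v x) < norm (minus (q x) (g (pi x))) / 3 := xv.
move=> /(graph_ofP _ lg) qv.
have h1 : norm (minus (q v) (q x)) <= norm (minus v x).
  by rewrite -(compl_minus spl); apply: norm_compl_le spl _.
have h2 : norm (minus (g (pi v)) (g (pi x))) <= norm (minus v x).
  apply: Rle_trans (lipschitz_graph_close lg _ _) _; try exact: split_pi_idem spl _.
  by rewrite -(pi_minus spl); apply: norm_pi_le spl _.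
have := norm_minus_triangle (q v) (q x) (g (pi x)).
rewrite (norm_minusC (q x) (q v)) {2}qv => h3.
by lra.
Qed.

(** The distance to a graph needs only a dense sequence of abscissae. *)
Lemma dist_graph_lt g (u : nat -> H) x c : lipschitz_graph pi kappa g ->
  (forall x (e : R), 0 < e -> exists n, norm (minus x (u n)) < e) ->
  inf [set norm (minus x y) | y in graph_of pi g] < c <->
  exists n, norm (minus (plus (pi (u n)) (g (pi (u n)))) x) < c.
Proof.
move=> lg du; set A := [set _ | _ in _].
have idem y : pi (pi y) = pi y := split_pi_idem spl y.
split=> [lt|[n hn]].
  have A0 : A !=set0.
    exists (norm (minus x (plus (pi x) (g (pi x))))).
    by exists (plus (pi x) (g (pi x))) => //; exists (pi x) => //; exists x.
  have [_ [_ [p /HplusE pp <-] <-] /RltP pc] := inf_lt A0 (introT RltP lt).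
  pose e := (c - norm (minus x (plus p (g p)))) / 2.
  have e0 : 0 < e by rewrite /e; lra.
  have [n hn] := du p e e0; exists n.
  have h1 : norm (minus p (pi (u n))) < e.
    by rewrite -{1}pp -(pi_minus spl); apply: Rle_lt_trans (norm_pi_le spl _) hn.
  have h2 : norm (minus (g p) (g (pi (u n)))) < e.
    exact: Rle_lt_trans (lipschitz_graph_close lg pp (idem _)) h1.
  have -> : minus (plus (pi (u n)) (g (pi (u n)))) x =
      opp (plus (minus x (plus p (g p))) (plus (minus p (pi (u n))) (minus (g p) (g (pi (u n)))))).
    by lin_ring.
  rewrite norm_opp.
  apply: Rle_lt_trans (norm_plus_le (Rle_refl _) (norm_plus_le (Rle_refl _) (Rle_refl _))) _.
  by move: h1 h2; rewrite /e; lra.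
have lb : has_lbound A.
  by exists 0 => _ [y _ <-]; apply/RleP; apply: norm_ge_0.
have Ay : A (norm (minus x (plus (pi (u n)) (g (pi (u n)))))).
  exists (plus (pi (u n)) (g (pi (u n)))) => //.
  by exists (pi (u n)) => //; exists (u n).
have /RleP le := ge_inf lb Ay.
apply: Rle_lt_trans le _.
by rewrite norm_minusC.
Qed.
End Graphs.

Lemma dist_graph_measurable {d : measure_display} {T : measurableType d} (D : set T)
    {H : CompleteNormedModule R_AbsRing} (pi : H -> H) {Up Um : R -> H -> H}
    {hl cl kappa : R} (g : T -> H -> H) x :
  measurable D -> separable H -> splitting pi Up Um hl cl -> 0 < kappa <= 1 ->
  (forall w, D w -> lipschitz_graph pi kappa (g w)) ->
  (forall y, pi y = y -> ball_measurable D (fun w => g w y)) ->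
  measurable_fun D
    (fun w => inf [set norm (minus x y) | y in graph_of pi (g w)] : measurableTypeR R).
Proof.
move=> mD sH spl k01 lg mg; have [u du] := sH => _.
apply: (measurability _ (measurable_realfun.RGenInftyO.measurableE R)) => //.
move=> _ [_ [c ->] <-].
have -> : D `&` (fun w => inf [set norm (minus x y) | y in graph_of pi (g w)] : R)
    @^-1` [set` Interval -oo%O (BLeft c)] =
    \bigcup_n (D `&` [set w | norm (minus (plus (pi (u n)) (g w (pi (u n)))) x) < c]).
  apply/seteqP; split=> w.
    move=> [Dw]; rewrite /= in_itv /= => /RltP /(dist_graph_lt spl k01 _ _ (lg w Dw) du)[n hn].
    by exists n.
  move=> [n _ [Dw hn]]; split=> //; rewrite /= in_itv /=; apply/RltP.
  by apply/(dist_graph_lt spl k01 _ _ (lg w Dw) du); exists n.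
apply: bigcupT_measurable => n.
apply: (ball_measurable_plus sH (f := fun _ => pi (u n)) (g := fun w => g w (pi (u n)))).
  exact: ball_measurable_cst.
by apply: mg; apply: split_pi_idem spl _.
Qed.

(** * The invariant manifold *)

Section InvariantGraph.
Context {P : probability C0 R} {Om : set C0}.
Context {H : CompleteNormedModule R_AbsRing}.
Context (S : R -> H -> H) (pi F : H -> H) {hl cl L kappa lam : R}.
Hypothesis hOm : noise_space P Om.
Hypothesis hS : strongly_continuous_semigroup S.
Hypothesis hd : dichotomy S pi hl cl.
Hypothesis hF : nonlinearity pi F L.
Hypothesis gap : gap_constants hl cl L kappa lam.

Local Notation q := (compl_proj pi).
Local Notation Up := (plus_group S pi).
Local Notation Um := (minus_semigroup S pi).
Local Notation C w := (primitive (noise_path w)).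
Local Notation N w := (scaled_field F (noise_path w)).
Local Notation limit_at w t G := (limit_graph pi Up Um (C w) (N w) hl cl L kappa lam t G).

Let spl := dichotomy_splitting hS hd.
Let frc w (Ow : Om w) := scaled_forcing (dich_pi_linear hd) hF (noise_path_cont hOm Ow).
Let cC w (Ow : Om w) := primitive_cont (noise_path_cont hOm Ow).

Lemma primitive_theta w s t : Om w -> C (theta s w) t = C w (t + s) - C w s.
Proof.
move=> Ow; have cz := noise_path_cont hOm Ow.
rewrite -(primitive_diff cz) /primitive.
rewrite (RInt_ext (V := R_CompleteNormedModule) _ (fun r => noise_path w (r + s))).
  by rewrite (RInt_translate (H := R_CompleteNormedModule) s 0 t cz) Rplus_0_l.
by move=> r _; apply: noise_path_theta.
Qed.

Lemma limit_graph_theta w s t G : Om w -> limit_at w (t + s) G -> limit_at (theta s w) t G.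
Proof.
move=> Ow; apply: (limit_graph_translate spl (frc Ow) (cC Ow) (k := C w s)).
  by move=> r; apply: primitive_theta.
by move=> r x; rewrite /scaled_field noise_path_theta.
Qed.

Variable gs : C0 -> H -> H.
Hypothesis gs_limit : forall w, Om w -> limit_at w 0 (gs w).

Lemma gs_lipschitz w : Om w -> lipschitz_graph pi kappa (gs w).
Proof.
by move=> Ow; apply: (limit_graph_lipschitz spl (frc Ow) gap (cC Ow) (gs_limit Ow)).
Qed.

Lemma gs_theta w T G y : Om w -> limit_at w T G -> pi y = y -> gs (theta T w) y = G y.
Proof.
move=> Ow lG yp; have Ow' := theta_Om hOm T Ow.
apply: (limit_graph_unique spl (frc Ow') gap (cC Ow') (gs_limit Ow')) => //.
by apply: limit_graph_theta => //; rewrite Rplus_0_l.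
Qed.

Lemma gs_steered w T y X : Om w -> 0 <= T -> pi y = y ->
  steered pi Up Um (C w) (N w) (gs w) 0 T y X -> q (X T) = gs (theta T w) y.
Proof.
move=> Ow T0 yp sX.
have [G lG] := limit_graph_exists spl (frc Ow) gap (cC Ow) T.
rewrite (gs_theta Ow lG yp).
exact: (limit_graph_invariant spl (frc Ow) gap (cC Ow) (gs_limit Ow) lG T0 yp sX).
Qed.

Lemma gs_fixed_point : generalized_fixed_point Om S pi F gs.
Proof.
move=> w T Ow T0.
apply: (graph_transform_intro hS hd hF gap (noise_path_cont hOm Ow) T0).
  exact (lipschitz_calH hd (gs_lipschitz Ow)).
by move=> y X yp sX; rewrite (gs_steered Ow T0 yp sX).
Qed.

(** A fixed point in the cone is reached, at every time, by a trajectory that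
    started in the cone arbitrarily long ago. *)
Lemma gs_unique gs' : (forall w, Om w -> calH pi kappa (gs' w)) ->
  generalized_fixed_point Om S pi F gs' ->
  forall w x, Om w -> Hplus pi x -> gs' w x = gs w x.
Proof.
move=> hg fix_gs' w x Ow /(HplusP hd) xp; apply: norm_minus_eq0 => e e0.
have [a0 ha0] := approach_bound_small gap (norm x) e0.
pose T := - Rmin a0 0.
have T0 : 0 <= T by rewrite /T; have := Rmin_r a0 0; lra.
pose w' := theta (- T) w.
have Ow' : Om w' := theta_Om hOm _ Ow.
have ww' : theta T w' = w.
  rewrite /w' theta_theta Rplus_opp_r theta0 //.
  by have [_] : C0_set (set_val w) by have := set_valP w.
have lg := calH_lipschitz hd (hg w' Ow').
have [X sX] := steered_exists spl (frc Ow') gap (cC Ow') lg T0 xp.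
have gx := graph_transform_elim hS hd hF gap (noise_path_cont hOm Ow') T0 (hg w' Ow')
  (fix_gs' w' T Ow' T0) xp sX.
rewrite ww' in gx.
have [G lG] := limit_graph_exists spl (frc Ow') gap (cC Ow') T.
have Gx := gs_theta Ow' lG xp; rewrite ww' in Gx.
have cX := steered_cone_full spl (frc Ow') gap (cC Ow') lg T0 sX.
have := lG 0 X T0 cX; rewrite (steered_end sX) gx Gx norm_minusC => /Rle_trans; apply.
by apply: ha0; rewrite /T; have := Rmin_l a0 0; lra.
Qed.

Lemma gs_invariant (phi : R -> C0 -> H -> H) : generated_rds Om S F phi ->
  invariant_set Om phi (fun w => graph_of pi (gs w)).
Proof.
move=> hphi t w t0 Ow _ [x Mx <-].
have lg := gs_lipschitz Ow.
have /(graph_ofP spl x lg) qx := Mx.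
have sX := mild_solution_steered hS hd hF (noise_path_cont hOm Ow) t0 qx (hphi w x Ow).
have pp : pi (pi (phi t w x)) = pi (phi t w x) by apply: dich_pi_proj hd _.
apply/(graph_ofP spl _ (gs_lipschitz (theta_Om hOm t Ow))).
have tt : 0 <= t <= t by lra.
by rewrite -(gs_steered Ow t0 pp sX) (clamp_id tt).
Qed.

(** A double limit: first of Picard iterates on a window, then as the window
    extends to the infinite past. *)
Lemma gs_measurable y : separable H -> pi y = y ->
  ball_measurable Om (fun w => gs w y).
Proof.
move=> sH yp.
have n0 n : - INR n <= 0 by have := pos_INR n; lra.
have zg := zero_graph spl gap.
have ex n w : exists X, Om w ->
    steered pi Up Um (C w) (N w) (fun _ => zero) (- INR n) 0 y X.
  have [Ow|nOw] := EM (Om w); last by exists (fun _ => zero).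
  by have [X sX] := steered_exists spl (frc Ow) gap (cC Ow) zg (n0 n) yp; exists X.
have exn n : exists X : C0 -> R -> H, forall w, Om w ->
    steered pi Up Um (C w) (N w) (fun _ => zero) (- INR n) 0 y (X w).
  by have [X sX] := choice (ex n); exists X.
have [X sX] := choice exn.
have nn0 n : - INR n <= 0 <= 0 by have := n0 n; lra.
apply: (ball_measurable_limit (f := fun n w => q (X n w 0))).
  move=> n; apply: (linear_measurable sH); first exact: compl_proj_linear (dich_pi_linear hd).
  apply: (ball_measurable_limit (f := fun k w =>
    picard Up Um (C w) (N w) (fun _ => zero) (- INR n) 0 y k 0)).
    by move=> k; apply: (picard_measurable hOm sH hS hd hF).
  move=> w Ow.
  exact: (picard_cv spl (frc Ow) gap (cC Ow) zg (n0 n) (sX n w Ow) (nn0 n)).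
move=> w Ow; apply/filterlim_locally_ball_norm => e.
have e2 := is_pos_div_2 e.
have [a0 ha0] := approach_bound_small gap (norm y) e2.
have [n1 hn1] := INR_unbounded (- a0).
exists n1 => n nn; have nn1 := le_INR _ _ nn.
have := gs_limit Ow (n0 n) (steered_cone_full spl (frc Ow) gap (cC Ow) zg (n0 n) (sX n w Ow)).
rewrite (steered_end (sX n w Ow)) norm_minusC => h.
have small := ha0 (- INR n - 0) ltac:(lra).
apply: Rle_lt_trans h _; apply: Rle_lt_trans small _.
by have := cond_pos e; lra.
Qed.

Lemma gs_manifold (phi : R -> C0 -> H -> H) : separable H -> generated_rds Om S F phi ->
  lipschitz_invariant_manifold Om pi phi (fun w => graph_of pi (gs w)).
Proof.
move=> sH hphi; have lg := gs_lipschitz.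
split; first split.
- move=> w Ow; split; last first.
    by apply: (graph_of_closed spl (gap_kappa gap)); apply: lg.
  by exists (plus (pi zero) (gs w (pi zero))), (pi zero) => //; exists zero.
- move=> x; apply: (dist_graph_measurable x (noise_borel hOm) sH spl (gap_kappa gap)).
    exact: lg.
  by move=> y yp; apply: gs_measurable.
- exact: gs_invariant.
- exists gs => w Ow; have [mg _ kg] := lipschitz_calH hd (lg w Ow).
  by split=> //; exists kappa.
Qed.
End InvariantGraph.

Theorem theorem5p2
    (P : probability C0 R) (Om : set C0)
    (H : CompleteNormedModule R_AbsRing)
    (DA : set H) (A : H -> H) (S : R -> H -> H) (pi F : H -> H)
    (hl cl L kappa : R) (phi : R -> C0 -> H -> H)
    (hP : wiener_measure P) (hOm : noise_space P Om)
    (hH : separable H)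
    (hS : strongly_continuous_semigroup S) (hA : generator DA A S)
    (hdich : dichotomy S pi hl cl) (hF : nonlinearity pi F L)
    (hphi : generated_rds Om S F phi)
    (hkappa : state_space_constant hl cl L kappa)
    (hgap : hl - cl > 4 * L) :
  exists gs : C0 -> H -> H,
    [/\ (forall w, Om w -> calH pi kappa (gs w)),
        generalized_fixed_point Om S pi F gs,
        (forall gs' : C0 -> H -> H,
           (forall w, Om w -> calH pi kappa (gs' w)) ->
           generalized_fixed_point Om S pi F gs' ->
           forall w x, Om w -> Hplus pi x -> gs' w x = gs w x) &
        lipschitz_invariant_manifold Om pi phi
          (fun w => graph_of pi (gs w))].
Proof.
have [lam gap] := state_space_gap hkappa (nonlin_L hF) (Rgt_lt _ _ hgap).
have spl := dichotomy_splitting hS hdich.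
have ex w : exists G, Om w -> limit_graph pi (plus_group S pi) (minus_semigroup S pi)
    (primitive (noise_path w)) (scaled_field F (noise_path w)) hl cl L kappa lam 0 G.
  have [Ow|nOw] := EM (Om w); last by exists id.
  have cz := noise_path_cont hOm Ow.
  have [G lG] := limit_graph_exists spl (scaled_forcing (dich_pi_linear hdich) hF cz) gap
    (primitive_cont cz) 0.
  by exists G.
have [gs gs_limit] := choice ex.
exists gs; split.
- move=> w Ow; exact (lipschitz_calH hdich (gs_lipschitz hOm hS hdich hF gap gs_limit Ow)).
- exact (gs_fixed_point hOm hS hdich hF gap gs_limit).
- exact (gs_unique hOm hS hdich hF gap gs_limit).
- exact (gs_manifold hOm hS hdich hF gap gs_limit hH hphi).
Qed.
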